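(* Let $\mathcal H$ be a Hilbert space, let $(T_t)_{t\ge 0}$ be a semigroup of Schwarz maps on $\mathcal B(\mathcal H)$, and let $\rho\in\mathcal S_1(\mathcal H)$ be such that $\omega_\rho(x)=\operatorname{Tr}(\rho x)$ is a faithful state on $\mathcal B(\mathcal H)$ which is subinvariant for $(T_t)_{t\ge 0}$. Then there exists a unique semigroup $(\widetilde T_t)_{t\ge 0}$ of contractions on $\mathcal S_2(\mathcal H)$ such that $$\widetilde T_t(i_\rho(x))=i_\rho(T_t(x))\quad\text{for all } x\in\mathcal B(\mathcal H),\ t\ge 0,$$ where $i_\rho(x)=\rho^{1/4}x\rho^{1/4}$. Moreover, if $(T_t)_{t\ge0}$ is weak$^*$ continuous, then $(\widetilde T_t)_{t\ge0}$ is strongly continuous. In this weak$^*$ continuous case, let $L$ denote the generator of $(T_t)_{t\ge 0}$, let $\widetilde L$ denote the generator of $(\widetilde T_t)_{t\ge 0}$, and let $L_{(h_n)}$ denote the extended generator of $(T_t)_{t\ge0}$ with respect to $(h_n)_{n\in\mathbb N}$, where $(h_n)_{n\in\mathbb N}$ is an orthonormal basis of $\mathcal H$ consisting of eigenvectors of $\rho$. Then $x\in D(L)$ implies $i_\rho(x)\in D(\widetilde L)$ and $$\widetilde L(i_\rho(x))=i_\rho(L(x)).$$ Conversely, for $x\in\mathcal B(\mathcal H)$, $i_\rho(x)\in D(\widetilde L)$ implies $x\in D(L_{(h_n)})$ and $$L_{(h_n)}(x)=i_{\rho^{(-1)}}\bigl(\widetilde L(i_\rho(x))\bigr).$$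
   Context: $\mathcal B(\mathcal H)$ is the space of bounded linear operators on $\mathcal H$; $\mathcal S_1(\mathcal H)$ and $\mathcal S_2(\mathcal H)$ are the trace-class and Hilbert-Schmidt operators, the latter a Hilbert space with inner product $\langle x,y\rangle_{\mathcal S_2(\mathcal H)}=\operatorname{Tr}(x^*y)$. Inner products are linear in the second variable. A bounded linear operator $T$ on a $C^*$-algebra $\mathcal A$ is a Schwarz map if $T(x)^*T(x)\le T(x^*x)$ for all $x\in\mathcal A$ (no unitality is assumed). A positive functional $\omega$ on $\mathcal B(\mathcal H)$ is faithful if $\omega(x)>0$ for all $x\geq 0$, $x\neq 0$. It is subinvariant for a positive operator $T$ on $\mathcal B(\mathcal H)$ if $\omega(T(a))\le\omega(a)$ for all $a\ge0$, and subinvariant for a semigroup $(T_t)_{t\ge0}$ if it is subinvariant for every $T_t$. (The existence of a faithful normal state forces $\mathcal H$ to be separable.) A semigroup on a Banach space $X$ is a family $(T_t)_{t\ge0}$ of bounded operators with $T_{t+s}=T_tT_s$ and $T_0=I$. It is strongly continuous if $t\mapsto T_tx$ is norm continuous for all $x\in X$. For $X=\mathcal B(\mathcal H)=\mathcal S_1(\mathcal H)^*$ it is weak$^*$ continuous if $t\mapsto \operatorname{Tr}(yT_t(x))$ is continuous for all $x\in \mathcal B(\mathcal H)$, $y\in\mathcal S_1(\mathcal H)$. The generator of a strongly (resp. weak$^*$) continuous semigroup has as domain the set of all $x$ for which $\lim_{t\to0}(T_t(x)-x)/t$ exists in norm (resp. weak$^*$), and its value at $x$ is this limit. Extended generator: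 given an orthonormal basis $(h_n)_{n\in N}$ of $\mathcal H$, $D(L_{(h_n)})$ is the linear subspace of all $x\in\mathcal B(\mathcal H)$ such that $\lim_{t\to0}\langle h_n,\frac{T_t(x)-x}{t}h_m\rangle$ exists for every $n,m\in N$; for such $x$, $L_{(h_n)}(x)$ is the complex $N\times N$ matrix whose $(n,m)$ entry is this limit. The Moore-Penrose inverse $x^{(-1)}$ of $x\in\mathcal B(\mathcal H)$ is the unique linear extension of $(x|_{\mathcal N(x)^\perp})^{-1}$ to $D(x^{(-1)})=\mathcal R(x)+\mathcal R(x)^\perp$ with null space $\mathcal R(x)^\perp$, where $\mathcal N(x)$, $\mathcal R(x)$ are the null space and range of $x$. One writes $i_{\rho^{(-1)}}(y)=(\rho^{1/4})^{(-1)}\,y\,(\rho^{1/4})^{(-1)}$. In the last displayed equality the right-hand side is identified with its matrix with respect to $(h_n)$, whose $(n,m)$ entry is $\langle(\rho^{1/4})^{(-1)}h_n,\ \widetilde L(i_\rho(x))\,(\rho^{1/4})^{(-1)}h_m\rangle$. If $\mathcal H$ is finite dimensional the index set $\mathbb N$ is replaced by a finite set. *)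

(* Defs.v *)
From HB Require Import structures.
From mathcomp Require Import all_boot all_order all_algebra.
From mathcomp Require Import complex ring.
From mathcomp Require Import all_classical all_reals all_analysis.
From mathcomp.analysis Require showcase.summability.

Set Implicit Arguments.
Unset Strict Implicit.
Unset Printing Implicit Defensive.

Import Order.TTheory GRing.Theory Num.Theory.
Import numFieldNormedType.Exports.

Local Open Scope classical_set_scope.
Local Open Scope complex_scope.
Local Open Scope ring_scope.

(* The inner product is linear in its second variable; positive definiteness
   is contained in innerE, as the norm is that of a normed module. *)
HB.mixin Record CompleteNormedModule_isHilbert (R : realType) H
    & CompleteNormedModule R[i] H := {
  inner : H -> H -> R[i];
  innerDr : forall u v w, inner u (v + w) = inner u v + inner u w;
  innerZr : forall a u v, inner u (a *: v) = a * inner u v;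
  inner_conj : forall u v, inner v u = (inner u v)^*;
  innerE : forall u, inner u u = `|u| ^+ 2 }.

#[short(type="hilbertType")]
HB.structure Definition Hilbert (R : realType) :=
  {H of CompleteNormedModule R[i] H & CompleteNormedModule_isHilbert R H}.

Section BoundedLinear.
Context {R : realType}.

Definition bounded_linear (X : lmodType R[i]) (N : X -> R) (f : X -> X) : Prop :=
  linear f /\ exists M : R, forall x, N (f x) <= M * N x.

Definition hnorm {H : hilbertType R} (u : H) : R := complex.Re `|u|.

Lemma hnormE (H : hilbertType R) (u : H) : (hnorm u)%:C = `|u|.
Proof.
have := normr_ge0 u.
rewrite /hnorm; by case: `|u| => a b; rewrite lecE /= => /andP[/eqP -> _].
Qed.

Lemma hnorm_ge0 (H : hilbertType R) (u : H) : 0 <= hnorm u.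
Proof. by rewrite -lecR hnormE; exact: normr_ge0. Qed.

Lemma hnormD (H : hilbertType R) (u v : H) : hnorm (u + v) <= hnorm u + hnorm v.
Proof. by rewrite -lecR rmorphD /= !hnormE ler_normD. Qed.

Lemma hnormZ (H : hilbertType R) (a : R[i]) (u : H) :
  hnorm (a *: u) = complex.Re `|a| * hnorm u.
Proof.
apply: (@complexI R); rewrite rmorphM /= !hnormE normrZ normc_def.
by case: a.
Qed.

End BoundedLinear.

Section BoundedOperators.
Context {R : realType} (H : hilbertType R).

Definition bop_pred : {pred H -> H} := mem [set f | bounded_linear hnorm f].

Record bop := Bop { bop_fun :> H -> H; bop_funP : bop_fun \in bop_pred }.

HB.instance Definition _ := [isSub of bop for bop_fun].
HB.instance Definition _ := [Choice of bop by <:].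

Lemma bop_submod_closed : submod_closed bop_pred.
Proof.
split=> [|a f g].
  rewrite inE; split=> [c u v|]; first by rewrite scaler0 addr0.
  exists 0 => u; rewrite mul0r -lecR hnormE normr0 //.
rewrite !inE => -[lf [Mf bf]] [lg [Mg bg]]; split=> [c u v|].
  have E w : (a *: f + g) w = a *: f w + g w by [].
  by rewrite !E lf lg !scalerDr !scalerA addrACA (mulrC a c).
exists (complex.Re `|a| * Mf + Mg) => u.
apply: (le_trans (hnormD _ _)); rewrite mulrDl lerD// hnormZ -mulrA.
by rewrite ler_wpM2l// normc_def /= sqrtr_ge0.
Qed.
HB.instance Definition _ :=
  GRing.isSubmodClosed.Build R[i] (H -> H) bop_pred bop_submod_closed.
HB.instance Definition _ := [SubChoice_isSubLmodule of bop by <:].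

Lemma bop_ext (x y : bop) : (forall u, x u = y u) -> x = y.
Proof. by move=> xy; apply/val_inj/funext. Qed.

Lemma bop_linear (x : bop) : linear x.
Proof. by have := bop_funP x; rewrite inE => -[]. Qed.

Lemma bop1_subproof : (@id H) \in bop_pred.
Proof. by rewrite inE; split=> //; exists 1 => u; rewrite mul1r. Qed.

Lemma bopM_subproof (x y : bop) : x \o y \in bop_pred.
Proof.
case: x y => [f Pf] [g Pg] /=; move: Pf Pg.
rewrite !inE => -[lf [Mf bf]] [lg [Mg bg]]; split=> [c u v|].
  by rewrite /= lg lf.
exists (`|Mf| * Mg) => u; apply: (le_trans (bf _)).
apply: (@le_trans _ _ (`|Mf| * hnorm (g u))).
  by rewrite ler_wpM2r ?hnorm_ge0// ler_norm.
by rewrite -mulrA ler_wpM2l.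
Qed.

Definition bop_one : bop := Bop bop1_subproof.
Definition bop_mul (x y : bop) : bop := Bop (bopM_subproof x y).

Lemma bop_mulA : associative bop_mul. Proof. by move=> *; exact: bop_ext. Qed.
Lemma bop_mul1x : left_id bop_one bop_mul. Proof. by move=> *; exact: bop_ext. Qed.
Lemma bop_mulx1 : right_id bop_one bop_mul. Proof. by move=> *; exact: bop_ext. Qed.
Lemma bop_mulDl : left_distributive bop_mul +%R.
Proof. by move=> *; exact: bop_ext. Qed.
Lemma bop_mulDr : right_distributive bop_mul +%R.
Proof.
move=> x y z; apply: bop_ext => u /=.
by have := bop_linear x 1 (y u) (z u); rewrite !scale1r.
Qed.

(* A possibly trivial ring, as H may be zero; x * y is composition. *)
HB.instance Definition _ := GRing.Zmodule_isPzRing.Build bop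
  bop_mulA bop_mul1x bop_mulx1 bop_mulDl bop_mulDr.

Definition opnorm (x : bop) : R :=
  sup [set hnorm (x u) | u in [set u : H | hnorm u <= 1]].

Definition adj (x : bop) : bop :=
  xget 0 [set y : bop | forall u v, inner u (x v) = inner (y u) v].

(* The order of R[i] makes a nonnegative number real. *)
Definition positive (x : bop) : Prop := forall u : H, 0 <= inner u (x u).

Definition op_le (x y : bop) : Prop := positive (y - x).

(* The unique positive n-th root of a positive operator. *)
Definition pos_root (n : nat) (x : bop) : bop :=
  xget 0 [set y | positive y /\ y ^+ n = x].

Definition abs_op (x : bop) : bop := pos_root 2 (adj x * x).

(* A maximal orthonormal family. *)
Definition orthonormal_basis (I : eqType) (h : I -> H) : Prop :=
  (forall n m, inner (h n) (h m) = (n == m)%:R) /\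
  (forall u, (forall n, inner (h n) u = 0) -> u = 0).

(* An arbitrary orthonormal basis (one exists by Zorn's lemma), used to write
   traces; the notions below do not depend on the choice. *)
Definition onb : set H :=
  xget set0 [set B : set H | orthonormal_basis (fun e : B => \val e)].

(* Unordered sum: the limit of the finite partial sums along finite subsets. *)
Definition trace (x : bop) : R[i] :=
  summability.sum (fun e : onb => inner (\val e) (x (\val e)) : R[i]^o).

Definition trace_class (x : bop) : Prop :=
  summable [set: onb]
    (fun e => (complex.Re (inner (\val e) (abs_op x (\val e))))%:E).

Definition hs_pred : {pred bop} :=
  mem [set x : bop | summable [set: onb] (fun e => (hnorm (x (\val e)) ^+ 2)%:E)].

Record S2 := HS { hs_op :> bop; hs_opP : hs_op \in hs_pred }.

HB.instance Definition _ := [isSub of S2 for hs_op].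
HB.instance Definition _ := [Choice of S2 by <:].

Lemma hs_submod_closed : submod_closed hs_pred.
Proof.
split=> [|a x y].
  rewrite inE /= /summable esum1 // => e _.
  have -> : hnorm ((0 : bop) (\val e)) = 0.
    by apply: (@complexI R); rewrite hnormE normr0.
  by rewrite expr0n /= normr0.
rewrite !inE /= /summable => sx sy.
pose c := complex.Re `|a|.
have c0 : 0 <= c by rewrite /c normc_def /= sqrtr_ge0.
pose F (e : onb) := ((c ^+ 2 *+ 2)%:E * (hnorm (x (\val e)) ^+ 2)%:E
  + 2%:E * (hnorm (y (\val e)) ^+ 2)%:E)%E.
apply: (@le_lt_trans _ _ (\esum_(e in [set: onb]) F e)).
  apply: le_esum => e _; rewrite /F -!EFinM -EFinD /= lee_fin.
  rewrite ger0_norm ?sqr_ge0//.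
  have : hnorm ((a *: x + y) (\val e))
      <= c * hnorm (x (\val e)) + hnorm (y (\val e)).
    by apply: (le_trans (hnormD _ _)); rewrite hnormZ.
  move: (hnorm_ge0 ((a *: x + y) (\val e))) (hnorm_ge0 (x (\val e))).
  move: (hnorm_ge0 (y (\val e))).
  set p := hnorm (x _); set q := hnorm (y _); set n := hnorm _ => q0 n0 p0 le.
  apply: (@le_trans _ _ ((c * p + q) ^+ 2)).
    by rewrite ler_sqr ?nnegrE// addr_ge0// mulr_ge0.
  rewrite -subr_ge0.
  have -> : c ^+ 2 *+ 2 * p ^+ 2 + 2 * q ^+ 2 - (c * p + q) ^+ 2 = (c * p - q) ^+ 2.
    by ring.
  exact: sqr_ge0.
have h0 (z : bop) (e : onb) : (0 <= (hnorm (z (\val e)) ^+ 2)%:E)%E.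
  by rewrite lee_fin sqr_ge0.
have k0 : (0 <= (c ^+ 2 *+ 2)%:E)%E by rewrite lee_fin mulrn_wge0 ?sqr_ge0.
rewrite esumD; last 2 first.
- by move=> e _; rewrite mule_ge0.
- by move=> e _; rewrite mule_ge0.
have eZ (k : R) (z : bop) : 0 <= k ->
    (\esum_(e in [set: onb]) `|(hnorm (z (\val e)) ^+ 2)%:E| < +oo ->
    \esum_(e in [set: onb]) (k%:E * (hnorm (z (\val e)) ^+ 2)%:E) < +oo)%E.
  move=> kge0 sz; apply: (@le_lt_trans _ _ (k%:E *
      \esum_(e in [set: onb]) `|(hnorm (z (\val e)) ^+ 2)%:E|)%E); last first.
    by rewrite lte_mul_pinfty.
  rewrite ge_ereal_sup// => _ [X [finX XI]] <-.
  rewrite -ge0_mule_fsumr// lee_wpmul2l// esum_ge//.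
  by exists X => //; apply: lee_fsum => // e _; rewrite lee_abs.
by apply: lte_add_pinfty; apply: eZ => //; rewrite mulrn_wge0 ?sqr_ge0.
Qed.
HB.instance Definition _ :=
  GRing.isSubmodClosed.Build R[i] bop hs_pred hs_submod_closed.
HB.instance Definition _ := [SubChoice_isSubLmodule of S2 by <:].

Definition hs_inner (x y : S2) : R[i] := trace (adj x * y).

Definition hs_norm (x : S2) : R := Num.sqrt (complex.Re (hs_inner x x)).

Definition schwarz (T : bop -> bop) : Prop :=
  bounded_linear opnorm T /\ forall x, op_le (adj (T x) * T x) (T (adj x * x)).

Definition state (w : bop -> R[i]) : Prop :=
  [/\ scalar w, forall x, positive x -> 0 <= w x & w 1 = 1].

Definition faithful (w : bop -> R[i]) : Prop :=
  forall x, positive x -> x != 0 -> 0 < w x.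

Definition subinvariant (w : bop -> R[i]) (T : bop -> bop) : Prop :=
  forall a, positive a -> w (T a) <= w a.

Definition omega (rho x : bop) : R[i] := trace (rho * x).

Definition i_op (rho x : bop) : bop := pos_root 4 rho * x * pos_root 4 rho.

(* i_op rho x as an element of S2; insubd returns 0 on operators that are not
   Hilbert-Schmidt. *)
Definition i_S2 (rho x : bop) : S2 := insubd 0 (i_op rho x).

Definition orth (A : set H) : set H := [set u | forall v, A v -> inner v u = 0].

Definition null_space (x : bop) : set H := [set u | x u = 0].

Definition mp_dom (x : bop) : set H :=
  [set v | exists a b, [/\ range x a, orth (range x) b & v = a + b]].

(* A partial linear map is represented by a total function that vanishes off
   its domain. *)
Definition is_mp_inverse (x : bop) (g : H -> H) : Prop :=
  [/\ forall a u v, mp_dom x u -> mp_dom x v -> g (a *: u + v) = a *: g u + g v,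
      forall u, orth (null_space x) u -> g (x u) = u,
      forall v, mp_dom x v -> (g v = 0 <-> orth (range x) v)
    & forall v, ~ mp_dom x v -> g v = 0].

Definition mp_inverse (x : bop) : H -> H := xget (fun=> 0) (is_mp_inverse x).

(* The (n, m) entry of (rho^(1/4))^(-1) y (rho^(1/4))^(-1). *)
Definition i_inv_mx (I : Type) (rho : bop) (h : I -> H) (y : bop) (n m : I) : R[i] :=
  inner (mp_inverse (pos_root 4 rho) (h n)) (y (mp_inverse (pos_root 4 rho) (h m))).

End BoundedOperators.

Arguments onb {R} H.
Arguments S2 {R} H.
Arguments opnorm {R H} x.
Arguments hs_norm {R H} x.
Arguments hs_pred {R H}.

(* In this section N is the norm of X, time is R and only times t >= 0 are
   constrained. *)
Section Semigroups.
Context {R : realType}.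

Definition semigroup (X : lmodType R[i]) (N : X -> R) (T : R -> X -> X) : Prop :=
  [/\ forall t, 0 <= t -> bounded_linear N (T t),
      forall s t, 0 <= s -> 0 <= t -> T (t + s) = T t \o T s
    & T 0 = id].

Definition contraction_semigroup (X : lmodType R[i]) (N : X -> R)
    (T : R -> X -> X) : Prop :=
  semigroup N T /\ forall t x, 0 <= t -> N (T t x) <= N x.

Definition diff_quot (X : lmodType R[i]) (T : R -> X -> X) (x : X) (t : R) : X :=
  (t^-1)%:C *: (T t x - x).

Definition strongly_continuous (X : lmodType R[i]) (N : X -> R)
    (T : R -> X -> X) : Prop :=
  forall x t, 0 <= t ->
    N (T s x - T t x) @[s --> within `[0, +oo[ (nbhs t)] --> (0 : R).

Definition strong_gen_graph (X : lmodType R[i]) (N : X -> R) (T : R -> X -> X)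
    (x y : X) : Prop :=
  N (diff_quot T x t - y) @[t --> 0^'+] --> (0 : R).

Definition strong_gen_dom (X : lmodType R[i]) (N : X -> R) (T : R -> X -> X) : set X :=
  [set x | exists y, strong_gen_graph N T x y].

Definition strong_gen (X : lmodType R[i]) (N : X -> R) (T : R -> X -> X) (x : X) : X :=
  xget 0 (strong_gen_graph N T x).

Definition weak_star_continuous (H : hilbertType R) (T : R -> bop H -> bop H) : Prop :=
  forall x y, trace_class y ->
    {within `[0, +oo[, continuous (fun t => trace (y * T t x) : R[i]^o)}.

Definition weak_star_gen_graph (H : hilbertType R) (T : R -> bop H -> bop H)
    (x z : bop H) : Prop :=
  forall y, trace_class y ->
    (trace (y * diff_quot T x t) : R[i]^o) @[t --> 0^'+] --> (trace (y * z) : R[i]^o).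

Definition weak_star_gen_dom (H : hilbertType R) (T : R -> bop H -> bop H) :
  set (bop H) := [set x | exists z, weak_star_gen_graph T x z].

Definition weak_star_gen (H : hilbertType R) (T : R -> bop H -> bop H)
  (x : bop H) : bop H := xget 0 (weak_star_gen_graph T x).

Definition ext_gen_dom (H : hilbertType R) (I : Type) (h : I -> H)
    (T : R -> bop H -> bop H) : set (bop H) :=
  [set x | forall n m,
    cvg ((inner (h n) (diff_quot T x t (h m)) : R[i]^o) @[t --> 0^'+])].

Definition ext_gen (H : hilbertType R) (I : Type) (h : I -> H)
    (T : R -> bop H -> bop H) (x : bop H) : I -> I -> R[i] :=
  fun n m => lim ((inner (h n) (diff_quot T x t (h m)) : R[i]^o) @[t --> 0^'+]).

End Semigroups.

(* Main.v *)
Require Import Defs.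
From HB Require Import structures.
From mathcomp Require Import all_boot all_order all_algebra finmap.
From mathcomp Require Import complex ring lra.
From mathcomp Require Import all_classical all_reals all_analysis.
From mathcomp.analysis Require showcase.summability.

(**
  Let [s] be the square root of [rho], in the basis of eigenvectors of [rho].
  Since [omega rho (x^* x)] is the squared Hilbert-Schmidt norm of [x s], the
  Schwarz inequality makes each [T t] a contraction for the seminorms [|x s|]
  and [|s x|].  The form [<i x, i y> = <x s, s y>] is the geometric mean of
  these two, that is, the largest form [g] with [|g x y| <= |x s| |s y|]; hence
  [|i (T t x)| <= |i x|], and [T t] extends to S2.  For weak* continuous [T],
  strong continuity follows from weak continuity on finite matrices in the
  eigenbasis.  For [x] in the domain of the generator, uniform boundedness
  turns weak* convergence of the difference quotients into weak convergence in
  S2; a mean value estimate along the orbit upgrades this to norm convergence.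
*)

Set Implicit Arguments.
Unset Strict Implicit.
Unset Printing Implicit Defensive.

Import Order.TTheory GRing.Theory Num.Theory numFieldNormedType.Exports.
Local Open Scope classical_set_scope.
Local Open Scope complex_scope.
Local Open Scope ring_scope.

(** * Hermitian forms and Hilbert spaces *)

(** Cauchy-Schwarz alone gives [|i (T t x)|^2 <= |x s| |s x|], whose right-hand side can exceed
    [|i x|^2]. The improvement comes from using the bounds for all pairs [x], [y] at once. In the
    matrix units of an eigenbasis the squared norms of [x s], [s x] and [i x] are diagonal with
    weights [l_j], [l_i] and [sqrt (l_i l_j)]; on finite matrices this is a statement about weighted
    sums, proved by iterating the operator that represents [g], and general [x] are reached by
    truncation. Weak* limits are tested on operators of rank one, which yields matrix elements and
    no bounds; this is why bounds for the difference quotients have to be recovered separately. The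
    orbit is never integrated: a monotonicity criterion for real functions takes the place of the
    integral. Adjoints, roots, Moore-Penrose inverses and traces are chosen objects with default
    values. Each has to be shown to exist before it can be used, and roots are evaluated on
    eigenvectors, where positivity determines them. *)

Notation re := complex.Re.

Section ComplexModulus.
Context {R : realType}.
Implicit Types z w : R[i].

(** The norm of [R[i]] takes values in [R[i]]; this is the same modulus as an element of [R], where
    order arguments and [lra] are available. *)
Definition cabs z : R := re `|z|.

Lemma cabsE z : (cabs z)%:C = `|z|.
Proof. by rewrite /cabs normc_def. Qed.

Lemma cabs_ge0 z : 0 <= cabs z.
Proof. by rewrite -lecR cabsE normr_ge0. Qed.

Lemma cabs0 : cabs 0 = 0.
Proof. by apply: (@complexI R); rewrite cabsE normr0. Qed.

Lemma cabs_eq0 z : (cabs z == 0) = (z == 0).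
Proof. by rewrite -(inj_eq (@complexI R)) cabsE normr_eq0. Qed.

Lemma cabsM z w : cabs (z * w) = cabs z * cabs w.
Proof. by apply: (@complexI R); rewrite rmorphM /= !cabsE normrM. Qed.

Lemma cabsD z w : cabs (z + w) <= cabs z + cabs w.
Proof. by rewrite -lecR rmorphD /= !cabsE ler_normD. Qed.

Lemma cabsN z : cabs (- z) = cabs z.
Proof. by rewrite /cabs normrN. Qed.

Lemma cabsJ z : cabs z^* = cabs z.
Proof. by rewrite /cabs normcJ. Qed.

Lemma cabsR (a : R) : cabs a%:C = `|a|.
Proof. by rewrite /cabs normc_def /= expr0n addr0 sqrtr_sqr. Qed.

Lemma cabs_sqr z : (cabs z ^+ 2)%:C = z * z^*.
Proof. by rewrite rmorphXn /= cabsE sqr_normc. Qed.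

Lemma cabs_sqrE z : cabs z ^+ 2 = re z ^+ 2 + complex.Im z ^+ 2.
Proof. by rewrite /cabs normc_def /= sqr_sqrtr// addr_ge0 ?sqr_ge0. Qed.

Lemma le_re_cabs z : re z <= cabs z.
Proof.
rewrite -lecR cabsE; apply: le_trans (normc_ge_Re z).
by rewrite lecR ler_norm.
Qed.

Lemma reD z w : re (z + w) = re z + re w.
Proof. by case: z w => [a b] [c d]. Qed.

Lemma reN z : re (- z) = - re z.
Proof. by case: z. Qed.

Lemma reB z w : re (z - w) = re z - re w.
Proof. by rewrite reD reN. Qed.

Lemma reJ z : re z^* = re z.
Proof. by case: z. Qed.

Lemma reZ (a : R) z : re (a%:C * z) = a * re z.
Proof. by case: z => [b c] /=; rewrite mul0r subr0. Qed.

Lemma conj_sum (I : Type) (s : seq I) (P : pred I) (F : I -> R[i]) :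
  (\sum_(i <- s | P i) F i)^* = \sum_(i <- s | P i) (F i)^*.
Proof. exact: (rmorph_sum (@conjc R)). Qed.

Lemma realc_sum (I : Type) (s : seq I) (P : pred I) (F : I -> R) :
  (\sum_(i <- s | P i) F i)%:C = \sum_(i <- s | P i) (F i)%:C.
Proof. exact: (rmorph_sum (real_complex R)). Qed.

Lemma ge0_re z : 0 <= z -> (re z)%:C = z.
Proof. by case: z => a b; rewrite lecE /= => /andP[/eqP -> _]. Qed.

Lemma ge0_re_ge0 z : 0 <= z -> 0 <= re z.
Proof. by case: z => a b; rewrite lecE /= => /andP[]. Qed.

Lemma conj_realM (a : R) z : (a%:C * z^*)^* = a%:C * z.
Proof.
by case: z => b c; apply/eqP; rewrite eq_complex /=; apply/andP; split; apply/eqP; ring.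
Qed.

Lemma conj_real (a : R) : (a%:C)^* = a%:C.
Proof. exact: conjc_real. Qed.

Lemma conj_invol z : z^*^* = z.
Proof. exact: conjcK. Qed.

Lemma ltc0R_exists (e : R[i]) : 0 < e -> exists2 d : R, 0 < d & d%:C = e.
Proof.
case: e => a b; rewrite ltcE /= => /andP[/eqP -> a0].
by exists a.
Qed.

End ComplexModulus.

Section Forms.
Context {R : realType} (V : lmodType R[i]).
Implicit Types g : V -> V -> R[i].

(** Kept apart from [hermitian], since the symmetry of a positive form is itself derived by
    polarization. *)
Record sesquilinear g : Prop := Sesquilinear {
  sesqDr : forall u v w, g u (v + w) = g u v + g u w;
  sesqDl : forall u v w, g (u + v) w = g u w + g v w;
  sesqZr : forall a u v, g u (a *: v) = a * g u v;
  sesqZl : forall a u v, g (a *: u) v = a^* * g u v }.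

Lemma polarization g u v : sesquilinear g -> 4 * g u v =
  g (u + v) (u + v) - g (u - v) (u - v)
  - 'i * g (u + 'i *: v) (u + 'i *: v) + 'i * g (u - 'i *: v) (u - 'i *: v).
Proof.
move=> hg; have i2 : 'i * 'i = -1 :> R[i] by rewrite -expr2 sqr_i.
have ci : ('i : R[i])^* = - 'i by apply/eqP; rewrite eq_complex /= oppr0 !eqxx.
have Nr a b : g a (- b) = - g a b by rewrite -scaleN1r (sesqZr hg) mulN1r.
have Nl a b : g (- a) b = - g a b by rewrite -scaleN1r (sesqZl hg) rmorphN1 mulN1r.
rewrite !(sesqDr hg) !(sesqDl hg) !Nr !Nl !(sesqZr hg) !(sesqZl hg) ci.
(* [ring] treats ['i] as an indeterminate, so products of two of them are collected and replaced by
   [-1]. *)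
have -> : 'i * (g u u + - 'i * g v u + ('i * g u v + 'i * (- 'i * g v v))) =
  'i * g u u + g v u - g u v + 'i * g v v.
  transitivity ('i * g u u - ('i * 'i) * g v u + ('i * 'i) * g u v - 'i * ('i * 'i) * g v v).
    by ring.
  by rewrite i2; ring.
have -> : 'i * (g u u - - 'i * g v u + (- ('i * g u v) - - ('i * (- 'i * g v v)))) =
  'i * g u u - g v u + g u v + 'i * g v v.
  transitivity ('i * g u u + ('i * 'i) * g v u - ('i * 'i) * g u v - 'i * ('i * 'i) * g v v).
    by ring.
  by rewrite i2; ring.
by ring.
Qed.

Lemma sesquilinear_eq g k : sesquilinear g -> sesquilinear k ->
  (forall u, g u u = k u u) -> forall u v, g u v = k u v.
Proof.
move=> hg hk gk u v; have n4 : (4 : R[i]) != 0 by rewrite pnatr_eq0.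
by apply: (mulfI n4); rewrite !polarization// !gk.
Qed.

Record hermitian g : Prop := Hermitian {
  formDr : forall u v w, g u (v + w) = g u v + g u w;
  formZr : forall a u v, g u (a *: v) = a * g u v;
  formC : forall u v, g v u = (g u v)^* }.

(** The form [(u, v) |-> (g v u)^*] is sesquilinear and has the same real diagonal as [g];
    polarization identifies the two. *)
Lemma sesquilinear_hermitian g : sesquilinear g -> (forall u, 0 <= g u u) -> hermitian g.
Proof.
move=> hg g0; split=> [| |u v]; [exact: sesqDr hg|exact: sesqZr hg|].
apply: (sesquilinear_eq (k := fun v u => (g u v)^*) hg) => [|w].
  split=> *; first by rewrite (sesqDl hg) rmorphD.
  - by rewrite (sesqDr hg) rmorphD.
  - by rewrite (sesqZl hg) rmorphM /= conj_invol.
  - by rewrite (sesqZr hg) rmorphM.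
by rewrite -(ge0_re (g0 w)) conj_real.
Qed.

Section Hermitian.
Variable g : V -> V -> R[i].
Hypothesis hg : hermitian g.

Lemma formDl u v w : g (u + v) w = g u w + g v w.
Proof. by rewrite (formC hg) (formDr hg) rmorphD /= -!(formC hg). Qed.

Lemma formZl a u v : g (a *: u) v = a^* * g u v.
Proof. by rewrite (formC hg) (formZr hg) rmorphM /= -(formC hg). Qed.

Lemma hermitian_sesquilinear : sesquilinear g.
Proof. by split; [exact: formDr|exact: formDl|exact: formZr|exact: formZl]. Qed.

Lemma form0r u : g u 0 = 0.
Proof. by rewrite -(scale0r 0) (formZr hg) mul0r. Qed.

Lemma form0l u : g 0 u = 0.
Proof. by rewrite (formC hg) form0r rmorph0. Qed.

Lemma formNr u v : g u (- v) = - g u v.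
Proof. by rewrite -scaleN1r (formZr hg) mulN1r. Qed.

Lemma formNl u v : g (- u) v = - g u v.
Proof. by rewrite (formC hg) formNr rmorphN /= -(formC hg). Qed.

Lemma formBr u v w : g u (v - w) = g u v - g u w.
Proof. by rewrite (formDr hg) formNr. Qed.

Lemma formBl u v w : g (u - v) w = g u w - g v w.
Proof. by rewrite formDl formNl. Qed.

Lemma form_sumr (I : Type) (s : seq I) (P : pred I) (F : I -> V) u :
  g u (\sum_(i <- s | P i) F i) = \sum_(i <- s | P i) g u (F i).
Proof. exact: (big_morph (g u) (formDr hg u) (form0r u)). Qed.

Lemma form_suml (I : Type) (s : seq I) (P : pred I) (F : I -> V) u :
  g (\sum_(i <- s | P i) F i) u = \sum_(i <- s | P i) g (F i) u.
Proof.
by rewrite (formC hg) form_sumr conj_sum; apply: eq_bigr => i _; rewrite -(formC hg).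
Qed.

Hypothesis g_ge0 : forall u, 0 <= g u u.

(** Positivity at [u - s (g u v)^* v], for real [s], is a quadratic inequality in [s], used at
    [s = 1 / g v v]. The form is only semidefinite, so [g v v = 0] is a case of its own. *)
Lemma form_cauchy_schwarz u v : cabs (g u v) ^+ 2 <= re (g u u) * re (g v v).
Proof.
set c := cabs (g u v) ^+ 2; set a := re (g u u); set b := re (g v v).
have a0 : 0 <= a by exact: ge0_re_ge0.
have b0 : 0 <= b by exact: ge0_re_ge0.
have c0 : 0 <= c by exact: sqr_ge0.
have key (s : R) : 0 <= a - 2 * s * c + s ^+ 2 * c * b.
  have := ge0_re_ge0 (g_ge0 (u - (s%:C * (g u v)^*) *: v)).
  rewrite formBr !formBl formZl !(formZr hg) formZl.
  rewrite (formC hg u v) conj_realM.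
  rewrite -[g v v]ge0_re// -/b.
  have -> : g u u - s%:C * g u v * (g u v)^* - (s%:C * (g u v)^* * g u v
     - s%:C * (g u v)^* * (s%:C * g u v * b%:C)) =
     g u u - (2 * s * c - s ^+ 2 * c * b)%:C.
    have -> : (2 * s * c - s ^+ 2 * c * b)%:C =
        2 * s%:C * c%:C - s%:C * s%:C * c%:C * b%:C.
      by rewrite expr2 !(rmorphB, rmorphM, rmorph_nat).
    by rewrite /c cabs_sqr; ring.
  by rewrite reB -/a => h; move: h => /=; lra.
have [b_eq0|bn0] := eqVneq b 0.
  rewrite b_eq0 mulr0; case: (ltgtP c 0) c0 => // cp _.
  have := key ((a + 1) / (2 * c)); rewrite b_eq0 mulr0 addr0.
  have -> : 2 * ((a + 1) / (2 * c)) * c = a + 1 by field; rewrite gt_eqF.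
  lra.
have bp : 0 < b by rewrite lt_def bn0.
have := key b^-1.
have -> : a - 2 * b^-1 * c + b^-1 ^+ 2 * c * b = (a * b - c) / b by field.
by rewrite pmulr_lge0 ?invr_gt0// subr_ge0.
Qed.

Definition fnorm u : R := Num.sqrt (re (g u u)).

Lemma fnorm_sqr u : fnorm u ^+ 2 = re (g u u).
Proof. by rewrite sqr_sqrtr// ge0_re_ge0. Qed.

Lemma fnorm_ge0 u : 0 <= fnorm u. Proof. exact: sqrtr_ge0. Qed.

Lemma form_cauchy_schwarz_norm u v : cabs (g u v) <= fnorm u * fnorm v.
Proof.
rewrite -ler_sqr ?nnegrE ?cabs_ge0 ?mulr_ge0 ?fnorm_ge0//.
by rewrite exprMn !fnorm_sqr form_cauchy_schwarz.
Qed.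

Lemma fnormD u v : fnorm (u + v) <= fnorm u + fnorm v.
Proof.
rewrite -ler_sqr ?nnegrE ?addr_ge0 ?fnorm_ge0//.
have -> : fnorm (u + v) ^+ 2 = fnorm u ^+ 2 + re (g u v) + (re (g u v) + fnorm v ^+ 2).
  rewrite 3!fnorm_sqr (formDr hg (u + v)) (formDl u v u) (formDl u v v) 3!reD.
  by rewrite (formC hg u v) reJ.
have := le_trans (le_re_cabs _) (form_cauchy_schwarz_norm u v).
by move=> h; rewrite sqrrD; lra.
Qed.

Lemma fnormZ a u : fnorm (a *: u) = cabs a * fnorm u.
Proof.
apply/eqP; rewrite -(@eqrXn2 _ 2) ?mulr_ge0 ?fnorm_ge0 ?cabs_ge0//; apply/eqP.
rewrite exprMn 2!fnorm_sqr (formZr hg) formZl mulrA -cabs_sqr; exact: reZ.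
Qed.

Lemma fnorm_sum (I : Type) (s : seq I) (F : I -> V) :
  fnorm (\sum_(i <- s) F i) <= \sum_(i <- s) fnorm (F i).
Proof.
elim/big_rec2: _ => [|i y u _ h]; last by apply: le_trans (fnormD _ _) _; rewrite lerD2l.
by rewrite /fnorm form0r sqrtr0.
Qed.

End Hermitian.
End Forms.

(** Induction on the list: the new term adds [X b^2 + Y a^2 - 2 S a b], nonnegative because
    [S^2 <= X Y]; multiplication by [X] completes the square. *)
Lemma sum_cauchy_schwarz (R : realType) (I : Type) (s : seq I) (a b : I -> R) :
  (\sum_(i <- s) a i * b i) ^+ 2 <= (\sum_(i <- s) a i ^+ 2) * (\sum_(i <- s) b i ^+ 2).
Proof.
elim: s => [|i s IH]; first by rewrite !big_nil expr0n mul0r.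
rewrite !big_cons.
have X0 : 0 <= \sum_(j <- s) a j ^+ 2 by apply: sumr_ge0 => j _; exact: sqr_ge0.
have Y0 : 0 <= \sum_(j <- s) b j ^+ 2 by apply: sumr_ge0 => j _; exact: sqr_ge0.
move: IH X0 Y0; set S := \sum_(j <- s) _ * _; set X := \sum_(j <- s) a j ^+ 2.
set Y := \sum_(j <- s) b j ^+ 2; move: (a i) (b i) S X Y => {}a {}b S X Y IH X0 Y0.
suff : 0 <= X * b ^+ 2 + Y * a ^+ 2 - 2 * S * a * b.
  move=> h; rewrite -subr_ge0.
  have -> : (a ^+ 2 + X) * (b ^+ 2 + Y) - (a * b + S) ^+ 2 =
    (X * Y - S ^+ 2) + (X * b ^+ 2 + Y * a ^+ 2 - 2 * S * a * b) by ring.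
  by rewrite addr_ge0// subr_ge0.
have [X_eq0|Xn0] := eqVneq X 0.
  have S0 : S = 0.
    apply/eqP; rewrite -sqrf_eq0; apply/eqP/le_anti.
    by rewrite sqr_ge0 andbT (le_trans IH)// X_eq0 mul0r.
  by rewrite X_eq0 S0 mulr0 !mul0r add0r subr0 mulr_ge0// sqr_ge0.
have Xp : 0 < X by rewrite lt_def Xn0.
rewrite -(pmulr_rge0 _ Xp).
have -> : X * (X * b ^+ 2 + Y * a ^+ 2 - 2 * S * a * b) =
  (X * b - S * a) ^+ 2 + (X * Y - S ^+ 2) * a ^+ 2 by ring.
by rewrite addr_ge0 ?sqr_ge0// mulr_ge0 ?sqr_ge0// subr_ge0.
Qed.

Section HilbertBasics.
Context {R : realType} {H : hilbertType R}.
Implicit Types u v w : H.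

Lemma inner_hermitian : hermitian (@inner R H).
Proof. by split; [exact: innerDr|exact: innerZr|exact: inner_conj]. Qed.

Local Notation ih := inner_hermitian.

Definition innerDl := formDl ih.
Definition innerZl := formZl ih.
Definition inner0r := form0r ih.
Definition inner0l := form0l ih.
Definition innerNr := formNr ih.
Definition innerNl := formNl ih.
Definition innerBr := formBr ih.
Definition innerBl := formBl ih.
Definition inner_sumr := form_sumr ih.
Definition inner_suml := form_suml ih.

Lemma inner_hnorm u : inner u u = (hnorm u ^+ 2)%:C.
Proof. by rewrite innerE rmorphXn /= hnormE. Qed.

Lemma inner_ge0 u : 0 <= inner u u.
Proof. by rewrite inner_hnorm lecR sqr_ge0. Qed.

Lemma hnorm_sqr u : hnorm u ^+ 2 = re (inner u u).
Proof. by rewrite inner_hnorm. Qed.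

Lemma hnorm0 : hnorm (0 : H) = 0.
Proof. by apply: (@complexI R); rewrite hnormE normr0. Qed.

Lemma hnorm_eq0 u : (hnorm u == 0) = (u == 0).
Proof. by rewrite -(inj_eq (@complexI R)) hnormE normr_eq0. Qed.

Lemma hnormN u : hnorm (- u) = hnorm u.
Proof. by rewrite /hnorm normrN. Qed.

Lemma hnormBC u v : hnorm (u - v) = hnorm (v - u).
Proof. by rewrite -hnormN opprB. Qed.

Lemma hnormB u v : hnorm (u - v) <= hnorm u + hnorm v.
Proof. by apply: le_trans (Defs.hnormD _ _) _; rewrite hnormN. Qed.

Lemma hnorm_triangle w u v : hnorm (u - v) <= hnorm (u - w) + hnorm (w - v).
Proof. by apply: le_trans (Defs.hnormD _ _); rewrite addrA subrK. Qed.

Lemma ler_hnormB u v : hnorm u - hnorm v <= hnorm (u - v).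
Proof. by rewrite lerBlDr; apply: le_trans (Defs.hnormD _ _); rewrite subrK. Qed.

Lemma hnorm_scale (a : R[i]) u : hnorm (a *: u) = cabs a * hnorm u.
Proof. exact: Defs.hnormZ. Qed.

Lemma cauchy_schwarz u v : cabs (inner u v) <= hnorm u * hnorm v.
Proof.
rewrite -ler_sqr ?nnegrE ?cabs_ge0 ?mulr_ge0 ?hnorm_ge0//.
rewrite exprMn !hnorm_sqr; exact: (form_cauchy_schwarz ih inner_ge0).
Qed.

Lemma re_inner_le u v : re (inner u v) <= hnorm u * hnorm v.
Proof. exact: le_trans (le_re_cabs _) (cauchy_schwarz u v). Qed.

Lemma ler_hnorm_sqr u (a : R) : 0 <= a -> hnorm u ^+ 2 <= a ^+ 2 -> hnorm u <= a.
Proof. by move=> a0; rewrite ler_sqr// nnegrE hnorm_ge0. Qed.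

Lemma inner_eqP u v : (forall w, inner w u = inner w v) -> u = v.
Proof.
move=> e; apply/eqP; rewrite -subr_eq0 -hnorm_eq0 -sqrf_eq0 hnorm_sqr.
by rewrite innerBr e subrr.
Qed.

Lemma cvg_hnormP (T : Type) (F : set_system T) {FF : Filter F} (f : T -> H) l :
  (f x @[x --> F] --> l) <->
  (forall e : R, 0 < e -> \forall x \near F, hnorm (l - f x) < e).
Proof.
split=> [/cvgrPdist_lt h e e0|h].
  have := h e%:C; rewrite ltcR => /(_ e0).
  by apply: filterS => x; rewrite -hnormE ltcR.
apply/cvgrPdist_lt => _ /ltc0R_exists[e e0 <-].
by apply: filterS (h e e0) => x; rewrite -hnormE ltcR.
Qed.

Lemma cvg_hnorm_lt (T : Type) (F : set_system T) {FF : Filter F} (f : T -> H) l e :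
  (f x @[x --> F] --> l) -> 0 < e -> \forall x \near F, hnorm (l - f x) < e.
Proof. by move=> /cvg_hnormP; apply. Qed.

(** Completeness for arbitrary proper filters: it serves for nets of finite sums, for sequences, for
    ultrafilters and for approximation through a dense map. *)
Lemma cauchy_hnorm_cvg (T : Type) (F : set_system T) {FF : ProperFilter F} (f : T -> H) :
  (forall e : R, 0 < e -> exists2 A, F A &
     forall x y, A x -> A y -> hnorm (f x - f y) <= e) ->
  exists l : H, f x @[x --> F] --> l.
Proof.
move=> h; apply/cvg_ex/cauchy_cvgP/cauchyP => _ /ltc0R_exists[e e0 <-].
have e20 : 0 < e / 2 by rewrite divr_gt0.
have [A FA Ah] := h _ e20.
have [x Ax] := filter_ex FA.
exists (f x); apply: (@filterS _ F _ A _ _ FA) => y Ay /=.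
rewrite -ball_normE /= -hnormE ltcR.
by apply: le_lt_trans (Ah _ _ Ax Ay) _; lra.
Qed.

End HilbertBasics.

(** * Orthonormal families *)

Notation totally := showcase.summability.totally.

#[global] Existing Instance showcase.summability.totally_filter.

Section FsetSums.

Lemma big_fset_subD (V : nmodType) (I : choiceType) (A B : {fset I}) (f : I -> V) :
  (A `<=` B)%fset -> \sum_(i <- B) f i = \sum_(i <- A) f i + \sum_(i <- (B `\` A)%fset) f i.
Proof.
move=> AB; rewrite (big_fsetID _ (mem A)) /=; congr (_ + _).
  by congr (\sum_(i <- enum_fset _) _); apply/fsetP => i; rewrite !inE /= andbC;
    case: (boolP (i \in A)) => //= /(fsubsetP AB) ->.
by congr (\sum_(i <- enum_fset _) _); apply/fsetP => i; rewrite !inE /= andbC.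
Qed.

Lemma ler_fset_sum (R : numDomainType) (I : choiceType) (A B : {fset I}) (f : I -> R) :
  (forall i, 0 <= f i) -> (A `<=` B)%fset -> \sum_(i <- A) f i <= \sum_(i <- B) f i.
Proof. by move=> f0 /big_fset_subD ->; rewrite lerDl sumr_ge0. Qed.

Lemma big_fset_delta (R : nzSemiRingType) (I : choiceType) (A : {fset I}) (f : I -> R) j :
  \sum_(i <- A) f i * (i == j)%:R = if j \in A then f j else 0.
Proof.
case: ifPn => jA; last first.
  rewrite big_seq big1// => i iA; case: eqVneq => [ij|]; last by rewrite mulr0.
  by move: iA jA; rewrite ij => ->.
rewrite (big_fsetD1 j)//= eqxx mulr1 big_seq big1 ?addr0// => i.
by rewrite !inE => /andP[/negPf -> _]; rewrite mulr0.
Qed.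

Lemma totally_ge (I : choiceType) (A : {fset I}) :
  \forall B \near totally, (A `<=` B)%fset.
Proof. by exists A. Qed.

Variable R : realType.

Lemma fset_sum_le_esum (I : choiceType) (f : I -> R) (A : {fset I}) :
  ((\sum_(i <- A) f i)%:E <= \esum_(i in [set: I]) (f i)%:E)%E.
Proof.
apply: esum_ge; exists [set` A]; first by split.
by rewrite fsbig_finite//= set_fsetK sumEFin.
Qed.

Lemma esum_le_fset (I : choiceType) (f : I -> R) (M : \bar R) :
  (forall A : {fset I}, ((\sum_(i <- A) f i)%:E <= M)%E) ->
  (\esum_(i in [set: I]) (f i)%:E <= M)%E.
Proof.
move=> h; rewrite ge_ereal_sup// => _ [A [finA _]] <-.
by rewrite fsbig_finite//= sumEFin.
Qed.

Lemma cvg_fset_sum (I : choiceType) (f : I -> R) (s : R) : (forall i, 0 <= f i) ->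
  \esum_(i in [set: I]) (f i)%:E = s%:E ->
  forall e : R, 0 < e -> totally (fun A : {fset I} => s - e < \sum_(i <- A) f i <= s).
Proof.
move=> f0 fs e e0.
have ub (A : {fset I}) : \sum_(i <- A) f i <= s by have := fset_sum_le_esum f A; rewrite fs lee_fin.
suff [A sA] : exists A : {fset I}, s - e < \sum_(i <- A) f i.
  by exists A => // B AB /=; rewrite ub andbT (lt_le_trans sA)// ler_fset_sum.
apply: contrapT => /forallNP h.
have : (\esum_(i in [set: I]) (f i)%:E <= (s - e)%:E)%E.
  by apply: esum_le_fset => A; rewrite lee_fin leNgt; apply/negP.
by rewrite fs lee_fin; lra.
Qed.

Lemma esum_exchange (I J : choiceType) (f : I -> J -> \bar R) :
  (forall i j, (0 <= f i j)%E) ->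
  \esum_(i in [set: I]) \esum_(j in [set: J]) f i j =
  \esum_(j in [set: J]) \esum_(i in [set: I]) f i j.
Proof.
move=> f0; rewrite !esum_esum//.
rewrite (reindex_esum ([set: J] `*`` fun=> [set: I]) _ (fun p => (p.2, p.1)))//.
split=> [[a b]//|[a b] [c d] _ _ [-> ->]//|[a b] _].
by exists (b, a).
Qed.

Lemma esum_EFin_cst (I : choiceType) (f : I -> R) (k : R) : 0 <= k -> (forall i, 0 <= f i) ->
  (\esum_(i in [set: I]) (k * f i)%:E <= k%:E * \esum_(i in [set: I]) (f i)%:E)%E.
Proof.
move=> k0 f0; apply: esum_le_fset => A; rewrite -mulr_sumr EFinM.
by rewrite lee_wpmul2l// fset_sum_le_esum.
Qed.

End FsetSums.

Section Orthonormal.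
Context {R : realType} {H : hilbertType R}.
Implicit Types u v w : H.

Definition orthonormal (I : eqType) (h : I -> H) :=
  forall i j, inner (h i) (h j) = (i == j)%:R.

Lemma net_hnorm_lt (I : choiceType) (f : {fset I} -> H) v (e : R) B :
  f A @[A --> totally] --> v -> 0 < e ->
  exists A, (B `<=` A)%fset /\ hnorm (v - f A) < e.
Proof.
move=> vlim e0.
have vlime : \forall A \near totally, hnorm (v - f A) < e by exact: cvg_hnorm_lt.
by have [A [? ?]] := filter_ex (filterI vlime (totally_ge B)); exists A.
Qed.

Section Family.
Variables (I : choiceType) (h : I -> H).
Hypothesis oh : orthonormal h.
Implicit Types (c : I -> R[i]) (A B : {fset I}).

Definition hsum c A : H := \sum_(i <- A) c i *: h i.

Lemma hnorm_orthonormal i : hnorm (h i) = 1.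
Proof.
by apply/eqP; rewrite -sqrp_eq1 ?hnorm_ge0// hnorm_sqr oh eqxx.
Qed.

Lemma inner_hsum i c A : inner (h i) (hsum c A) = if i \in A then c i else 0.
Proof.
rewrite /hsum inner_sumr -[RHS]big_fset_delta; apply: eq_bigr => j _.
by rewrite innerZr oh eq_sym.
Qed.

Lemma hsum_sub c A B : (A `<=` B)%fset -> hsum c B - hsum c A = hsum c ((B `\` A)%fset).
Proof. by move=> AB; rewrite /hsum (big_fset_subD _ AB) addrC addKr. Qed.

Lemma hnorm_hsum c A : hnorm (hsum c A) ^+ 2 = \sum_(i <- A) cabs (c i) ^+ 2.
Proof.
apply: (@complexI R); rewrite -inner_hnorm {1}/hsum inner_suml realc_sum.
rewrite big_seq [RHS]big_seq; apply: eq_bigr => i iA.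
by rewrite innerZl inner_hsum iA cabs_sqr mulrC.
Qed.

Lemma bessel_residual u A : hnorm (u - hsum (fun i => inner (h i) u) A) ^+ 2 =
  hnorm u ^+ 2 - \sum_(i <- A) cabs (inner (h i) u) ^+ 2.
Proof.
set c := fun i => inner (h i) u.
have E : inner (hsum c A) u = (\sum_(i <- A) cabs (c i) ^+ 2)%:C.
  rewrite inner_suml realc_sum; apply: eq_bigr => i _.
  by rewrite innerZl cabs_sqr mulrC.
have E' : inner u (hsum c A) = (\sum_(i <- A) cabs (c i) ^+ 2)%:C.
  by rewrite inner_conj E conj_real.
rewrite hnorm_sqr innerBr !innerBl E E' !reB -!hnorm_sqr hnorm_hsum /=; ring.
Qed.

Lemma bessel u A : \sum_(i <- A) cabs (inner (h i) u) ^+ 2 <= hnorm u ^+ 2.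
Proof. by rewrite -subr_ge0 -bessel_residual sqr_ge0. Qed.

(** A finite set whose sum of squares almost attains the supremum leaves little outside, so the
    finite sums form a Cauchy net; the coefficients survive the limit by continuity of the inner
    product. *)
Lemma riesz_fischer c (M : R) : (forall A, \sum_(i <- A) cabs (c i) ^+ 2 <= M) ->
  exists2 v, (forall i, inner (h i) v = c i) & hsum c A @[A --> totally] --> v.
Proof.
move=> cM.
pose S := [set \sum_(i <- A) cabs (c i) ^+ 2 | A in [set: {fset I}]].
have supS : has_sup S.
  split; first by exists (\sum_(i <- fset0) cabs (c i) ^+ 2), fset0.
  by exists M => _ [A _ <-].
have [v vlim] : exists v : H, hsum c A @[A --> totally] --> v.
  apply: cauchy_hnorm_cvg => e e0.
  have d0 : 0 < (e / 2) ^+ 2 by rewrite exprn_gt0// divr_gt0.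
  have [_ [A _ <-] hA] := sup_adherent d0 supS.
  exists (fun B => (A `<=` B)%fset); first exact: totally_ge.
  have key B : (A `<=` B)%fset -> hnorm (hsum c B - hsum c A) <= e / 2.
    move=> AB; rewrite -ler_sqr ?nnegrE ?hnorm_ge0//; last by lra.
    rewrite (hsum_sub _ AB) hnorm_hsum.
    have : \sum_(i <- B) cabs (c i) ^+ 2 <= sup S.
      by apply: sup_upper_bound => //; exists B.
    by rewrite (big_fset_subD _ AB); lra.
  move=> B C AB AC; apply: le_trans (hnorm_triangle (hsum c A) _ _) _.
  by have := key _ AB; have := key _ AC; rewrite [hnorm (_ - hsum c C)]hnormBC; lra.
exists v => // i; apply/eqP; rewrite -subr_eq0 -cabs_eq0; apply/eqP/le_anti.
rewrite cabs_ge0 andbT; apply/ler_addgt0Pr => e e0; rewrite add0r.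
have [A [iA Ae]] := net_hnorm_lt [fset i]%fset vlim e0.
have <- : inner (h i) (hsum c A) = c i by rewrite inner_hsum -fsub1set iA.
rewrite -innerBr; apply: le_trans (cauchy_schwarz _ _) _.
by rewrite hnorm_orthonormal mul1r ltW.
Qed.

Lemma hsum_esum c v : hsum c A @[A --> totally] --> v ->
  \esum_(i in [set: I]) (cabs (c i) ^+ 2)%:E = (hnorm v ^+ 2)%:E.
Proof.
move=> vlim.
have ub A : \sum_(i <- A) cabs (c i) ^+ 2 <= hnorm v ^+ 2.
  rewrite -hnorm_hsum ler_sqr ?nnegrE ?hnorm_ge0//.
  apply/ler_addgt0Pr => e e0.
  have [B [AB Be]] := net_hnorm_lt A vlim e0.
  apply: (@le_trans _ _ (hnorm (hsum c B))).
    by rewrite -ler_sqr ?nnegrE ?hnorm_ge0// !hnorm_hsum ler_fset_sum// => i; exact: sqr_ge0.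
  rewrite -lerBlDl; apply: le_trans (ler_hnormB _ _) _.
  by rewrite hnormBC ltW.
apply/eqP; rewrite eq_le; apply/andP; split.
  by apply: esum_le_fset => A; rewrite lee_fin.
have v0 := hnorm_ge0 v.
apply/lee_addgt0Pr => e e0.
(* With [n = hnorm v] and [p <= n] the norm of a finite sum within [d] of [v], [n^2 - p^2 <= 2 n d];
   the extra [1] in the denominator covers [v = 0]. *)
pose d := Num.min 1 (e / (2 * hnorm v + 1)).
have d0 : 0 < d by rewrite /d lt_min ltr01 divr_gt0//; lra.
have [A [_ Ad]] := net_hnorm_lt fset0 vlim d0.
apply: le_trans (leeD2r _ (fset_sum_le_esum _ A)).
rewrite -EFinD lee_fin -hnorm_hsum.
have hA := le_trans (ler_hnormB _ _) (ltW Ad).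
have p0 := hnorm_ge0 (hsum c A).
have : d * (2 * hnorm v + 1) <= e.
  by rewrite -ler_pdivlMr /d ?ge_min ?lexx ?orbT//; lra.
move: hA p0; set p := hnorm (hsum c A); set n := hnorm v in v0 *.
move: d d0 {Ad} => d d0 hA p0 hd.
have [np|/ltW pn] := leP n p.
  have : n * n <= p * p by rewrite ler_pM.
  rewrite !expr2; lra.
have h1 : n * n <= n * (p + d) by rewrite ler_wpM2l//; lra.
have h2 : p * n <= p * (p + d) by rewrite ler_wpM2l//; lra.
have h3 : p * d <= n * d by rewrite ler_wpM2r// ltW.
by rewrite !expr2; lra.
Qed.

End Family.

Section Basis.
Variables (I : choiceType) (h : I -> H).
Hypothesis hb : orthonormal_basis h.
Let oh : orthonormal h := hb.1.

Lemma hsum_cvg u : hsum h (fun i => inner (h i) u) A @[A --> totally] --> u.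
Proof.
have [v vc vlim] := riesz_fischer oh (bessel oh u).
suff vu : v = u by rewrite vu in vlim.
apply/eqP; rewrite eq_sym -subr_eq0; apply/eqP/hb.2 => i.
by rewrite innerBr vc subrr.
Qed.

Arguments hsum_cvg : clear implicits.

Lemma parseval u : \esum_(i in [set: I]) (cabs (inner (h i) u) ^+ 2)%:E = (hnorm u ^+ 2)%:E.
Proof. exact: (hsum_esum oh (hsum_cvg u)). Qed.

Lemma hsum_dense u (e : R) : 0 < e ->
  exists A : {fset I}, hnorm (u - hsum h (fun i => inner (h i) u) A) < e.
Proof.
by move=> e0; have [A [_ ?]] := net_hnorm_lt fset0 (hsum_cvg u) e0; exists A.
Qed.

Lemma basis_inner_eqP u v : (forall i, inner (h i) u = inner (h i) v) -> u = v.
Proof.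
move=> e; apply/eqP; rewrite -subr_eq0; apply/eqP/hb.2 => i.
by rewrite innerBr e subrr.
Qed.

(** On the finite sum with coefficients [(phi (h i))^*] the functional equals the squared norm of
    that sum, so boundedness makes these coefficients square summable. The vector they define
    represents [phi] on finite sums, which are dense. *)
Lemma riesz (phi : H -> R[i]) (M : R) : (forall a u v, phi (a *: u + v) = a * phi u + phi v) ->
  (forall u, cabs (phi u) <= M * hnorm u) -> exists v, forall u, phi u = inner v u.
Proof.
move=> phil phiM.
have phi0 : phi 0 = 0.
  by have := phil 1 0 0; rewrite scaler0 addr0 mul1r => /eqP; rewrite -subr_eq subrr => /eqP.
have phisum c A : phi (hsum h c A) = \sum_(i <- A) c i * phi (h i).
  by apply: (big_rec2 (fun a b => phi a = b)) => // i a b _ <-; rewrite phil.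
have [|v vc vlim] := @riesz_fischer _ _ oh (fun i => (phi (h i))^*) (M ^+ 2).
  move=> A; pose c i := (phi (h i))^*; set s := \sum_(i <- A) _.
  have s0 : 0 <= s by apply: sumr_ge0 => i _; exact: sqr_ge0.
  have sE : s = hnorm (hsum h c A) ^+ 2 by rewrite (hnorm_hsum oh).
  have : cabs (phi (hsum h c A)) = s.
    rewrite phisum -[RHS]ger0_norm// -cabsR /s realc_sum; congr cabs.
    by apply: eq_bigr => i _; rewrite cabs_sqr /c conj_invol.
  have := phiM (hsum h c A).
  have := hnorm_ge0 (hsum h c A); rewrite sE; set p := hnorm _ => p0 h1 h2.
  have : p ^+ 2 <= M * p by rewrite -h2.
  case: (ltgtP p 0) p0 => // [p0 _|-> _ _]; last by rewrite expr0n sqr_ge0.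
  rewrite expr2 ler_pM2r// => pM.
  by rewrite -[p * p]expr2 ler_sqr ?nnegrE ?(le_trans (ltW p0) pM)// ltW.
exists v => u; apply/eqP; rewrite -subr_eq0 -cabs_eq0; apply/eqP/le_anti.
rewrite cabs_ge0 andbT; apply/ler_addgt0Pr => e e0; rewrite add0r.
have M1 : 0 < `|M| + hnorm v + 1 by have := hnorm_ge0 v; have := normr_ge0 M; lra.
have [A Ae] := hsum_dense u (divr_gt0 e0 M1).
set w := hsum _ _ _ in Ae.
have -> : phi u - inner v u = phi (u - w) - inner v (u - w).
  have phiB : phi (u - w) = phi u - phi w.
    have := phil (- 1) w u; rewrite scaleN1r addrC => ->; ring.
  rewrite phiB innerBr.
  have -> : phi w = inner v w.
    rewrite phisum inner_sumr; apply: eq_bigr => i _.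
    by rewrite innerZr (inner_conj (h i)) vc conj_invol.
  ring.
apply: le_trans (cabsD _ _) _; rewrite cabsN.
have := phiM (u - w); have := cauchy_schwarz v (u - w).
move: Ae; rewrite ltr_pdivlMr//; have := ler_norm M.
have := hnorm_ge0 (u - w); set p := hnorm _; set q := cabs _; set r := cabs _.
by nra.
Qed.

End Basis.

(** Zorn's lemma inside [P]. All of [H] gives an orthonormal basis; the set of eigenvectors of a
    density gives its eigenbasis. *)
Lemma maximal_orthonormal (P : set H) :
  exists B : set H, [/\ orthonormal (fun e : B => \val e), B `<=` P &
    forall v, P v -> hnorm v = 1 -> (forall e : B, inner (\val e) v = 0) -> False].
Proof.
pose Q (B : set H) := B `<=` P /\ forall e f, B e -> B f -> inner e f = (e == f)%:R.
have [|B [[BP QB] Bmax]] := @Zorn_bigcup _ Q.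
  move=> F FQ totF; split=> [e [X FX Xe]|e f [X FX Xe] [Y FY Yf]].
    exact: (FQ _ FX).1.
  have [XY|YX] := totF _ _ FX FY.
    by apply: (FQ _ FY).2 => //; exact: XY.
  by apply: (FQ _ FX).2 => //; exact: YX.
exists B; split=> // [e f|v Pv v1 vB].
  by rewrite QB ?(inj_eq val_inj)//; exact/set_mem/valP.
have vB' e : B e -> inner e v = 0 by move=> /mem_set Be; exact: (vB (SigSub Be)).
have vNB : ~ B v.
  by move=> /vB'; rewrite inner_hnorm v1 expr1n => /eqP; rewrite oner_eq0.
apply: (Bmax (B `|` [set v])).
  by split=> [|/(_ v)]; [exact: subsetUl|apply: contra_not vNB => /(_ (or_intror erefl))].
split=> [e [/BP//|->//]|e f [Be|->] [Bf|->]].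
- exact: QB.
- by rewrite vB'//; case: eqVneq => // ev; case: vNB; rewrite -ev.
- by rewrite inner_conj vB'// rmorph0; case: eqVneq => // ev; case: vNB; rewrite ev.
- by rewrite inner_hnorm v1 expr1n eqxx.
Qed.

(** Existence of a basis rules out the default branch of [onb]: a nonzero vector orthogonal to a
    maximal family, once normalized, would be a further member. *)
Lemma onb_basis : orthonormal_basis (fun e : onb H => \val e).
Proof.
rewrite /onb; case: xgetP => [B _ //|/(_ _)/=].
have [B [oB _ Bmax]] := maximal_orthonormal setT.
move=> /(_ B)[]; split=> // u u0; apply: contrapT => /eqP; rewrite -hnorm_eq0 => un0.
apply: (Bmax ((hnorm u)^-1%:C *: u)) => // [|e].
  by rewrite hnorm_scale cabsR ger0_norm ?invr_ge0 ?hnorm_ge0// mulVf.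
by rewrite innerZr u0 mulr0.
Qed.

End Orthonormal.
Arguments hsum_cvg {R H I h} hb u.

(** * Bounded operators *)

Section ComplexSums.
Context {R : realType}.

Lemma cvg_cabsP (T : Type) (F : set_system T) {FF : Filter F} (f : T -> R[i]) (l : R[i]) :
  ((f x : R[i]^o) @[x --> F] --> (l : R[i]^o)) <->
  (forall e : R, 0 < e -> \forall x \near F, cabs (l - f x) < e).
Proof.
split=> [/cvgrPdist_lt h e e0|h].
  have := h e%:C; rewrite ltcR => /(_ e0).
  by apply: filterS => x; rewrite -cabsE ltcR.
apply/cvgrPdist_lt => _ /ltc0R_exists[e e0 <-].
by apply: filterS (h e e0) => x; rewrite -cabsE ltcR.
Qed.

Variable I : choiceType.
Implicit Types (f g : I -> R[i]) (A B : {fset I}).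

(** Convergence of an unordered sum together with its value. [summability.sum] is a limit with a
    default value and does not by itself say that anything converges. *)
Definition csum f (l : R[i]) := forall e : R, 0 < e ->
  exists A, forall B, (A `<=` B)%fset -> cabs (l - \sum_(i <- B) f i) < e.

Lemma csum_cvgP f l : csum f l <->
  showcase.summability.partial_sum (f : I -> R[i]^o) A @[A --> totally] --> (l : R[i]^o).
Proof.
have E A : showcase.summability.partial_sum (f : I -> R[i]^o) A = \sum_(i <- A) f i.
  by rewrite /showcase.summability.partial_sum big_seq_fsetE.
rewrite cvg_cabsP; split=> h e e0.
  by have [A hA] := h e e0; exists A => // B AB; rewrite E; exact: hA.
by have [A _ hA] := h e e0; exists A => // B AB; rewrite -E; exact: hA.
Qed.

Lemma csum_sum f l : csum f l -> showcase.summability.sum (f : I -> R[i]^o) = l.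
Proof.
by move=> /csum_cvgP h; rewrite /showcase.summability.sum; apply: cvg_lim.
Qed.

Lemma csum_unique f l l' : csum f l -> csum f l' -> l = l'.
Proof. by move=> /csum_sum <- /csum_sum <-. Qed.

Lemma eq_csum f g l : (forall i, f i = g i) -> csum f l -> csum g l.
Proof. by move=> /funext ->. Qed.

Lemma csumD f g l k : csum f l -> csum g k -> csum (fun i => f i + g i) (l + k).
Proof.
move=> hf hg e e0; have e2 : 0 < e / 2 by rewrite divr_gt0.
have [A hA] := hf _ e2; have [B hB] := hg _ e2.
exists (A `|` B)%fset => C; rewrite fsubUset => /andP[/hA h1 /hB h2].
rewrite big_split /= opprD addrACA; apply: le_lt_trans (cabsD _ _) _; lra.
Qed.

Lemma csumZ (a : R[i]) f l : csum f l -> csum (fun i => a * f i) (a * l).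
Proof.
move=> hf e e0; have a0 := cabs_ge0 a.
have a1 : 0 < cabs a + 1 by lra.
have [A hA] := hf _ (divr_gt0 e0 a1); exists A => B /hA.
rewrite -mulr_sumr -mulrBr cabsM ltr_pdivlMr//.
have := cabs_ge0 (l - \sum_(i <- B) f i); set p := cabs (_ - _).
by move=> p0; rewrite mulrDr mulr1 (mulrC p); lra.
Qed.

Lemma csumJ f l : csum f l -> csum (fun i => (f i)^*) l^*.
Proof.
move=> hf e /hf[A hA]; exists A => B /hA.
by rewrite -conj_sum -rmorphB /= cabsJ.
Qed.

Lemma esum_csum (f : I -> R) (l : R) : (forall i, 0 <= f i) ->
  \esum_(i in [set: I]) (f i)%:E = l%:E -> csum (fun i => (f i)%:C) l%:C.
Proof.
move=> f0 fl e e0; have [A _ hA] := cvg_fset_sum f0 fl e0.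
exists A => B /hA /andP[h1 h2].
by rewrite -realc_sum -rmorphB /= cabsR ger0_norm; lra.
Qed.

(** Past some finite set all sums stay within [1] of [l]; monotonicity extends the bound to every
    finite set. *)
Lemma csum_esum (f : I -> R) (l : R[i]) : (forall i, 0 <= f i) ->
  csum (fun i => (f i)%:C) l -> (\esum_(i in [set: I]) (f i)%:E < +oo)%E.
Proof.
move=> f0 fl; have [A hA] := fl 1 ltr01.
apply: (@le_lt_trans _ _ (cabs l + 1)%:E); last exact: ltry.
apply: esum_le_fset => B; rewrite lee_fin.
have := hA (A `|` B)%fset (fsubsetUl _ _).
have := ler_fset_sum f0 (fsubsetUr A B).
rewrite -realc_sum; set s := \sum_(i <- (A `|` B)%fset) _.
have s0 : 0 <= s by exact: sumr_ge0.
have : s <= cabs l + cabs (l - s%:C).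
  have E : s%:C = l + - (l - s%:C) by ring.
  by have := cabsD l (- (l - s%:C)); rewrite -E cabsN cabsR ger0_norm.
lra.
Qed.

End ComplexSums.

Section BopTheory.
Context {R : realType} {H : hilbertType R}.
Implicit Types (x y z : bop H) (u v w : H) (a : R[i]).

Lemma bopDE x y u : (x + y) u = x u + y u. Proof. by []. Qed.
Lemma bopNE x u : (- x) u = - x u. Proof. by []. Qed.
Lemma bopBE x y u : (x - y) u = x u - y u. Proof. by []. Qed.
Lemma bopZE a x u : (a *: x) u = a *: x u. Proof. by []. Qed.
Lemma bopME x y u : (x * y) u = x (y u). Proof. by []. Qed.
Lemma bop0E u : (0 : bop H) u = 0. Proof. by []. Qed.
Lemma bopD x u v : x (u + v) = x u + x v.
Proof. by have := bop_linear x 1 u v; rewrite !scale1r. Qed.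
Lemma bop0 x : x 0 = 0.
Proof. by have := bopD x 0 0; rewrite addr0 => /eqP; rewrite -subr_eq subrr eq_sym => /eqP. Qed.
Lemma bopZ x a u : x (a *: u) = a *: x u.
Proof. by have := bop_linear x a u 0; rewrite !addr0 bop0 addr0. Qed.
Lemma bopN x u : x (- u) = - x u.
Proof. by rewrite -scaleN1r bopZ scaleN1r. Qed.
Lemma bopB x u v : x (u - v) = x u - x v.
Proof. by rewrite bopD bopN. Qed.
Lemma bop_sumE (I : Type) (s : seq I) (P : pred I) (F : I -> bop H) u :
  (\sum_(i <- s | P i) F i) u = \sum_(i <- s | P i) F i u.
Proof. exact: (big_morph (fun x : bop H => x u) (fun x y => bopDE x y u) (bop0E u)). Qed.

Lemma bop_scalerAl a x y : a *: (x * y) = (a *: x) * y.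
Proof. exact: bop_ext. Qed.
Lemma bop_scalerAr a x y : a *: (x * y) = x * (a *: y).
Proof. by apply: bop_ext => u; rewrite bopZE !bopME bopZE bopZ. Qed.

Lemma bop_predP (f : H -> H) : f \in @bop_pred R H <-> bounded_linear hnorm f.
Proof. by split=> [/set_mem//|fP]; exact/mem_set. Qed.

Lemma bop_bounded x : exists2 M : R, 0 <= M & forall u, hnorm (x u) <= M * hnorm u.
Proof.
have [_ [M hM]] := (bop_predP _).1 (bop_funP x); exists `|M| => // u.
by apply: le_trans (hM u) _; rewrite ler_wpM2r ?hnorm_ge0// ler_norm.
Qed.

Lemma bop_exists (f : H -> H) (M : R) : linear f -> (forall u, hnorm (f u) <= M * hnorm u) ->
  exists x : bop H, forall u, x u = f u.
Proof.
move=> lf bf; have Pf : f \in @bop_pred R H by apply/bop_predP; split=> //; exists M.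
by exists (Bop Pf).
Qed.

(** The Riesz representation at each [u] gives the adjoint pointwise; linearity and the bound
    [|f u|^2 = <u, x (f u)>] make it an operator, which excludes the default value of [adj]. *)
Lemma adjP x u v : inner u (x v) = inner (adj x u) v.
Proof.
suff [y yP] : exists y : bop H, forall u v, inner u (x v) = inner (y u) v.
  rewrite /adj; case: xgetP => [z _ //|/(_ y)]; by [].
have [M M0 hM] := bop_bounded x.
have h u' : exists w, forall v, inner u' (x v) = inner w v.
  apply: (riesz onb_basis (M := hnorm u' * M)) => [a v1 v2|v1].
    by rewrite bopD bopZ innerDr innerZr.
  by rewrite -mulrA (le_trans (cauchy_schwarz _ _))// ler_wpM2l ?hnorm_ge0.
have [f fP] := choice h.
have [||y yf] := @bop_exists f M.
- move=> a v1 v2; apply: inner_eqP => w.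
  rewrite innerDr innerZr !(inner_conj _ w) -!fP innerDl innerZl.
  by rewrite rmorphD rmorphM /= conj_invol.
- move=> u'; have := hnorm_sqr (f u'); rewrite -fP => E.
  have := re_inner_le u' (x (f u')); rewrite -E => h1.
  have := le_trans h1 (ler_wpM2l (hnorm_ge0 _) (hM (f u'))).
  case: (ltgtP (hnorm (f u')) 0) (hnorm_ge0 (f u')) => // [f0 _|-> _ _].
    by rewrite expr2 mulrA ler_pM2r// mulrC.
  by rewrite mulr_ge0// hnorm_ge0.
by exists y => u' v'; rewrite yf.
Qed.

Lemma adjP' x u v : inner (x u) v = inner u (adj x v).
Proof. by rewrite inner_conj adjP -inner_conj. Qed.

Lemma adj_unique x y : (forall u v, inner u (x v) = inner (y u) v) -> adj x = y.
Proof.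
move=> h; apply: bop_ext => u; apply: inner_eqP => w.
by rewrite !(inner_conj _ w) -adjP -h.
Qed.

Lemma adjK x : adj (adj x) = x.
Proof. by apply: adj_unique => u v; rewrite adjP'. Qed.
Lemma adjM x y : adj (x * y) = adj y * adj x.
Proof. by apply: adj_unique => u v; rewrite !bopME -!adjP. Qed.
Lemma adjD x y : adj (x + y) = adj x + adj y.
Proof. by apply: adj_unique => u v; rewrite !bopDE innerDl innerDr -!adjP. Qed.
Lemma adjZ a x : adj (a *: x) = a^* *: adj x.
Proof. by apply: adj_unique => u v; rewrite !bopZE innerZl innerZr -!adjP conj_invol. Qed.
Lemma adjN x : adj (- x) = - adj x.
Proof. by apply: adj_unique => u v; rewrite !bopNE innerNl innerNr -adjP. Qed.
Lemma adjB x y : adj (x - y) = adj x - adj y.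
Proof. by rewrite adjD adjN. Qed.
Lemma adj1 : adj 1 = 1 :> bop H.
Proof. exact: adj_unique. Qed.

Lemma adj_bound x M u : (forall v, hnorm (x v) <= M * hnorm v) ->
  hnorm (adj x u) <= M * hnorm u.
Proof.
move=> hM; have := re_inner_le u (x (adj x u)); rewrite adjP -hnorm_sqr => h1.
have := le_trans h1 (ler_wpM2l (hnorm_ge0 _) (hM (adj x u))).
case: (ltgtP (hnorm (adj x u)) 0) (hnorm_ge0 (adj x u)) => // [f0 _|e _ _].
  by rewrite expr2 mulrA ler_pM2r// mulrC.
have [->|un0] := eqVneq u 0; first by rewrite bop0 hnorm0 mulr0.
(* The sign of [M] is unknown; [0 <= M * hnorm u] is read off from the bound at [u]. *)
by rewrite e; apply: le_trans (hM u); exact: hnorm_ge0.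
Qed.

Lemma rank1_subproof u v : (fun w => inner v w *: u) \in @bop_pred R H.
Proof.
apply/bop_predP; split=> [a w1 w2|]; first by rewrite innerDr innerZr scalerDl scalerA.
exists (hnorm v * hnorm u) => w; rewrite hnorm_scale mulrAC.
by rewrite ler_wpM2r ?hnorm_ge0// cauchy_schwarz.
Qed.

(** The operator [|u><v|]. Traces against it are matrix elements, the only form in which weak*
    limits are used. *)
Definition rank1 u v : bop H := Bop (rank1_subproof u v).

Lemma rank1E u v w : rank1 u v w = inner v w *: u.
Proof. by []. Qed.
Lemma mul_rank1 x u v : x * rank1 u v = rank1 (x u) v.
Proof. by apply: bop_ext => w; rewrite bopME !rank1E bopZ. Qed.
Lemma rank1_mul x u v : rank1 u v * x = rank1 u (adj x v).
Proof. by apply: bop_ext => w; rewrite bopME !rank1E adjP. Qed.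
Lemma adj_rank1 u v : adj (rank1 u v) = rank1 v u.
Proof.
apply: adj_unique => w1 w2; rewrite !rank1E innerZr innerZl -inner_conj; ring.
Qed.
Lemma rank1Zl a u v : rank1 (a *: u) v = a *: rank1 u v.
Proof. by apply: bop_ext => w; rewrite bopZE !rank1E !scalerA mulrC. Qed.
Lemma rank1Zr a u v : rank1 u (a *: v) = a^* *: rank1 u v.
Proof. by apply: bop_ext => w; rewrite bopZE !rank1E innerZl scalerA. Qed.

Lemma basis_bop_ext (I : choiceType) (h : I -> H) x y : orthonormal_basis h ->
  (forall i, x (h i) = y (h i)) -> x = y.
Proof.
move=> hb xy; rewrite -[x]adjK -[y]adjK; congr adj; apply: bop_ext => u.
by apply: (basis_inner_eqP hb) => i; rewrite -!adjP' xy.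
Qed.

Lemma op_form_sesquilinear x : sesquilinear (fun u v => inner u (x v)).
Proof.
split=> *; first by rewrite bopD innerDr.
- by rewrite innerDl.
- by rewrite bopZ innerZr.
- by rewrite innerZl.
Qed.

Lemma positive_hermitian x : positive x -> hermitian (fun u v => inner u (x v)).
Proof. by move=> px; apply: sesquilinear_hermitian (op_form_sesquilinear x) px. Qed.

Lemma positive_selfadj x : positive x -> adj x = x.
Proof.
move=> px; apply: adj_unique => u v.
by rewrite (formC (positive_hermitian px) v u) -inner_conj.
Qed.

Lemma positive_adjM x : positive (adj x * x).
Proof. by move=> u; rewrite bopME adjP adjK inner_ge0. Qed.

Lemma positive_rank1 u : positive (rank1 u u).
Proof.
by move=> v; rewrite rank1E innerZr (inner_conj v u) mulrC -cabs_sqr lecR sqr_ge0.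
Qed.

(** [w = y u - m u] satisfies [y w = - m w], which for [m > 0] positivity allows only if [w = 0].
    This evaluates on eigenvectors whichever root [pos_root] selects. *)
Lemma positive_sqr_eigen (y : bop H) (m : R) u : positive y -> 0 <= m ->
  y (y u) = (m ^+ 2)%:C *: u -> y u = m%:C *: u.
Proof.
move=> py m0 yyu; have [m_eq0|mn0] := eqVneq m 0.
  rewrite m_eq0 scale0r; apply/eqP; rewrite -hnorm_eq0 -sqrf_eq0 hnorm_sqr.
  by rewrite -[in X in inner X _](positive_selfadj py) -adjP yyu m_eq0 expr0n scale0r inner0r.
have mp : 0 < m by rewrite lt_def mn0.
pose w := y u - m%:C *: u.
have yw : y w = - (m%:C *: w).
  by rewrite /w bopB bopZ yyu scalerBr scalerA opprB expr2 rmorphM.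
have := py w; rewrite yw innerNr innerZr inner_hnorm -rmorphM -rmorphN lecR oppr_ge0.
rewrite pmulr_rle0// => w0.
apply/eqP; rewrite -subr_eq0 -/w -hnorm_eq0 -sqrf_eq0; apply/eqP/le_anti.
by rewrite w0 sqr_ge0.
Qed.

(** Cauchy-Schwarz for the form of [y] at [y u] and [u]; one factor [hnorm (y u) ^+ 2] cancels. *)
Lemma positive_hnorm_le (y : bop H) (M : R) u : positive y -> 0 <= M ->
  (forall u, hnorm (y u) <= M * hnorm u) -> hnorm (y u) ^+ 2 <= M * re (inner u (y u)).
Proof.
move=> py M0 hM; have yu0 := hnorm_ge0 (y u).
have cs := form_cauchy_schwarz (positive_hermitian py) py (y u) u.
have E : inner (y u) (y u) = (hnorm (y u) ^+ 2)%:C by exact: inner_hnorm.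
rewrite E cabsR ger0_norm ?sqr_ge0// in cs.
have q0 : 0 <= re (inner u (y u)) := ge0_re_ge0 (py u).
have h1 : re (inner (y u) (y (y u))) <= hnorm (y u) * (M * hnorm (y u)).
  by apply: le_trans (re_inner_le _ _) _; rewrite ler_wpM2l.
have := le_trans cs (ler_wpM2r q0 h1).
case: (ltgtP (hnorm (y u)) 0) yu0 => // [p0 _|e0 _ _].
  set p := hnorm (y u) in p0 *; set q := re _ in q0 *.
  have -> : p * (M * p) * q = p ^+ 2 * (M * q) by ring.
  by rewrite [X in X <= _]expr2 ler_pM2l// exprn_gt0.
by rewrite e0 expr0n /= mulr_ge0.
Qed.

End BopTheory.

(** * Hilbert-Schmidt operators *)

Section HilbertSchmidt.
Context {R : realType} {H : hilbertType R}.
Implicit Types (x y z : bop H) (u v : H) (M : R).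

(** Extended real values allow a change of basis before anything is known to be summable. *)
Definition basis_hs (I : choiceType) (h : I -> H) x : \bar R :=
  \esum_(i in [set: I]) (hnorm (x (h i)) ^+ 2)%:E.

Definition hs2 x : \bar R := basis_hs (fun e : onb H => \val e) x.

(** Both sides are the double sum of [|<k_j, x h_i>|^2], by Parseval in each basis. Passing to the
    adjoint twice then replaces one basis by another. *)
Lemma basis_hs_adj (I J : choiceType) (h : I -> H) (k : J -> H) x :
  orthonormal_basis h -> orthonormal_basis k -> basis_hs h x = basis_hs k (adj x).
Proof.
move=> hb kb; rewrite /basis_hs.
under eq_esum do rewrite -(parseval kb).
rewrite esum_exchange => [|i j]; last by rewrite lee_fin sqr_ge0.
apply: eq_esum => j _; rewrite -(parseval hb); apply: eq_esum => i _.
by rewrite adjP inner_conj cabsJ.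
Qed.

Lemma hs2E (I : choiceType) (h : I -> H) x : orthonormal_basis h -> basis_hs h x = hs2 x.
Proof.
move=> hb; rewrite /hs2 (basis_hs_adj _ hb onb_basis).
by rewrite (basis_hs_adj _ onb_basis onb_basis) adjK.
Qed.

Lemma hs2_adj x : hs2 (adj x) = hs2 x.
Proof. by rewrite /hs2 -(basis_hs_adj _ onb_basis onb_basis). Qed.

Lemma hs2_ge0 x : (0 <= hs2 x)%E.
Proof. by apply: esum_ge0 => e _; rewrite lee_fin sqr_ge0. Qed.

Lemma hs_predP x : x \in @hs_pred R H <-> (hs2 x < +oo)%E.
Proof.
have E : summable [set: onb H] (fun e => (hnorm (x (\val e)) ^+ 2)%:E) = (hs2 x < +oo)%E.
  rewrite /summable /hs2 /basis_hs; congr (_ < _)%E; apply: eq_esum => e _ /=.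
  by rewrite ger0_norm// sqr_ge0.
by split=> [/set_mem|xs]; [|apply/mem_set]; rewrite /= ?E// -E.
Qed.

Lemma hs2_mull x y M : 0 <= M -> (forall u, hnorm (x u) <= M * hnorm u) ->
  (hs2 (x * y)%R <= (M ^+ 2)%:E * hs2 y)%E.
Proof.
move=> M0 hM; apply: (le_trans _ (esum_EFin_cst _ _)).
- apply: le_esum => e _; rewrite lee_fin -exprMn.
  by rewrite ler_sqr ?nnegrE ?mulr_ge0 ?hnorm_ge0//; exact: hM.
- exact: sqr_ge0.
- by move=> e; exact: sqr_ge0.
Qed.

Lemma hs2_mulr x y M : 0 <= M -> (forall u, hnorm (x u) <= M * hnorm u) ->
  (hs2 (y * x)%R <= (M ^+ 2)%:E * hs2 y)%E.
Proof.
move=> M0 hM; rewrite -hs2_adj adjM -[hs2 y]hs2_adj; apply: hs2_mull => // u.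
exact: adj_bound.
Qed.

Lemma hs_mull x y : y \in @hs_pred R H -> x * y \in @hs_pred R H.
Proof.
have [M M0 hM] := bop_bounded x; move=> /hs_predP hy; apply/hs_predP.
apply: le_lt_trans (hs2_mull _ M0 hM) _.
by rewrite lte_mul_pinfty// lee_fin sqr_ge0.
Qed.

Lemma hs_adj x : x \in @hs_pred R H -> adj x \in @hs_pred R H.
Proof. by rewrite !hs_predP hs2_adj. Qed.

Lemma hs_mulr x y : y \in @hs_pred R H -> y * x \in @hs_pred R H.
Proof.
by move=> hy; rewrite -[_ * _]adjK; apply: hs_adj; rewrite adjM; apply/hs_mull/hs_adj.
Qed.

Lemma hs_csum (I : choiceType) (h : I -> H) x : orthonormal_basis h ->
  x \in @hs_pred R H -> csum (fun i => inner (x (h i)) (x (h i))) (fine (hs2 x))%:C.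
Proof.
move=> hb /hs_predP hx.
apply: (@eq_csum _ _ (fun i => (hnorm (x (h i)) ^+ 2)%:C)) => [i|].
  by rewrite inner_hnorm.
apply: esum_csum => [i|]; first exact: sqr_ge0.
have -> : \esum_(i in [set: I]) (hnorm (x (h i)) ^+ 2)%:E = hs2 x by exact: hs2E.
by rewrite fineK// ge0_fin_numE ?hs2_ge0.
Qed.

(** The inner product by polarization of [hs2]: a number independent of the basis, shown next to be
    the sum in every orthonormal basis. In particular the series of the trace converges. *)
Definition hs_polar x y : R[i] := 4^-1 *
  ((fine (hs2 (x + y)))%:C - (fine (hs2 (x - y)))%:C
   - 'i * (fine (hs2 (x + 'i *: y)))%:C + 'i * (fine (hs2 (x - 'i *: y)))%:C).

Lemma hs_polar_csum (I : choiceType) (h : I -> H) x y : orthonormal_basis h ->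
  x \in @hs_pred R H -> y \in @hs_pred R H ->
  csum (fun i => inner (x (h i)) (y (h i))) (hs_polar x y).
Proof.
move=> hb hx hy.
have hD z w : z \in @hs_pred R H -> w \in @hs_pred R H -> z + w \in @hs_pred R H by exact: rpredD.
have hN z : z \in @hs_pred R H -> - z \in @hs_pred R H by rewrite rpredN.
have hZ a z : z \in @hs_pred R H -> a *: z \in @hs_pred R H by exact: rpredZ.
have h1 := hs_csum hb (hD _ _ hx hy).
have h2 := hs_csum hb (hD _ _ hx (hN _ hy)).
have h3 := hs_csum hb (hD _ _ hx (hZ 'i _ hy)).
have h4 := hs_csum hb (hD _ _ hx (hN _ (hZ 'i _ hy))).
have := csumZ 4^-1 (csumD (csumD (csumD h1 (csumZ (-1) h2)) (csumZ (- 'i) h3)) (csumZ 'i h4)).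
rewrite /hs_polar !mulN1r !mulNr; apply: eq_csum => i.
have n4 : (4 : R[i]) != 0 by rewrite pnatr_eq0.
apply: (mulfI n4); rewrite mulrA mulfV// mul1r.
rewrite (polarization _ _ (hermitian_sesquilinear (@inner_hermitian R H))).
by rewrite !mulN1r !mulNr.
Qed.

Lemma hs_trace_csum x y : x \in @hs_pred R H -> y \in @hs_pred R H ->
  trace (adj x * y) = hs_polar x y.
Proof.
move=> hx hy; apply: csum_sum; apply: eq_csum (hs_polar_csum onb_basis hx hy) => e.
by rewrite bopME adjP'.
Qed.

Lemma hs_inner_csum (I : choiceType) (h : I -> H) (x y : S2 H) : orthonormal_basis h ->
  csum (fun i => inner (x (h i)) (y (h i))) (hs_inner x y).
Proof.
move=> hb; rewrite /hs_inner hs_trace_csum ?hs_opP//.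
by apply: hs_polar_csum hb _ _; exact: hs_opP.
Qed.

Lemma hs_inner_unique (I : choiceType) (h : I -> H) (x y : S2 H) l : orthonormal_basis h ->
  csum (fun i => inner (x (h i)) (y (h i))) l -> hs_inner x y = l.
Proof. by move=> hb; apply: csum_unique; exact: hs_inner_csum. Qed.

Lemma hs_inner_hermitian : hermitian (@hs_inner R H).
Proof.
split=> [x y z|a x y|x y]; apply: (hs_inner_unique onb_basis).
- apply: eq_csum (csumD (hs_inner_csum x y onb_basis) (hs_inner_csum x z onb_basis)) => e.
  by rewrite -innerDr.
- by apply: eq_csum (csumZ a (hs_inner_csum x y onb_basis)) => e; rewrite -innerZr.
- by apply: eq_csum (csumJ (hs_inner_csum x y onb_basis)) => e; rewrite -inner_conj.
Qed.

Lemma hs_inner_self (x : S2 H) : hs_inner x x = (fine (hs2 x))%:C.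
Proof. by apply: (hs_inner_unique onb_basis); apply: hs_csum (hs_opP x); exact: onb_basis. Qed.

Lemma fine_hs2_ge0 x : 0 <= fine (hs2 x).
Proof. by rewrite fine_ge0 ?hs2_ge0. Qed.

Lemma hs_inner_ge0 (x : S2 H) : 0 <= hs_inner x x.
Proof. by rewrite hs_inner_self lecR fine_hs2_ge0. Qed.

Lemma hs_norm_sqr (x : S2 H) : hs_norm x ^+ 2 = fine (hs2 x).
Proof. by rewrite /hs_norm hs_inner_self sqr_sqrtr// fine_hs2_ge0. Qed.

Lemma hs_norm_ge0 (x : S2 H) : 0 <= hs_norm x.
Proof. exact: sqrtr_ge0. Qed.

Lemma hs_norm_hs2 (x : S2 H) : (hs_norm x ^+ 2)%:E = hs2 x.
Proof.
rewrite hs_norm_sqr fineK// ge0_fin_numE ?hs2_ge0//; exact/hs_predP/hs_opP.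
Qed.

Lemma hs_norm_inner (x : S2 H) : hs_inner x x = (hs_norm x ^+ 2)%:C.
Proof. by rewrite hs_inner_self hs_norm_sqr. Qed.

Lemma hs_norm_apply (x : S2 H) u : hnorm (x u) <= hs_norm x * hnorm u.
Proof.
rewrite -ler_sqr ?nnegrE ?mulr_ge0 ?hnorm_ge0 ?hs_norm_ge0//.
rewrite -lee_fin -(parseval onb_basis) exprMn mulrC.
rewrite [leRHS]EFinM hs_norm_hs2 -hs2_adj.
apply: (le_trans _ (esum_EFin_cst _ _)); rewrite ?sqr_ge0//; last first.
  by move=> e; exact: sqr_ge0.
apply: le_esum => e _; rewrite adjP lee_fin -exprMn ler_sqr ?nnegrE ?cabs_ge0//.
  by rewrite mulrC cauchy_schwarz.
by rewrite mulr_ge0 ?hnorm_ge0.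
Qed.

Lemma hs_norm0_eq0 (x : S2 H) : hs_norm x = 0 -> x = 0.
Proof.
move=> x0; apply/val_inj/bop_ext => u; apply/eqP; rewrite -hnorm_eq0.
by apply/eqP/le_anti; rewrite hnorm_ge0 (le_trans (hs_norm_apply x u))// x0 mul0r.
Qed.

Lemma hs_normD (x y : S2 H) : hs_norm (x + y) <= hs_norm x + hs_norm y.
Proof. exact: (fnormD hs_inner_hermitian hs_inner_ge0). Qed.

Lemma hs_normZ (a : R[i]) (x : S2 H) : hs_norm (a *: x) = cabs a * hs_norm x.
Proof. exact: (fnormZ hs_inner_hermitian hs_inner_ge0). Qed.

(** A normed module over [R[i]] takes its norm in [R[i]]. With it [S2 H] becomes a Hilbert space, to
    which the general results on bases and semigroups apply. *)
Definition hs_normc (x : S2 H) : R[i] := (hs_norm x)%:C.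

Lemma hs_normcD (x y : S2 H) : hs_normc (x + y) <= hs_normc x + hs_normc y.
Proof. by rewrite /hs_normc -rmorphD lecR hs_normD. Qed.

Lemma hs_normcZ (a : R[i]) (x : S2 H) : hs_normc (a *: x) = `|a| * hs_normc x.
Proof. by rewrite /hs_normc hs_normZ rmorphM /= cabsE. Qed.

Lemma hs_normc0_eq0 (x : S2 H) : hs_normc x = 0 -> x = 0.
Proof. by move=> /(@complexI R)/hs_norm0_eq0. Qed.

HB.instance Definition _ :=
  Lmodule_isNormed.Build R[i] (S2 H) hs_normcD hs_normcZ hs_normc0_eq0.

End HilbertSchmidt.

(** * Completeness of the Hilbert-Schmidt space *)

Section S2Hilbert.
Context {R : realType} {H : hilbertType R}.

Lemma S2_normE (x : S2 H) : `|x| = (hs_norm x)%:C.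
Proof. by []. Qed.

(** The Hilbert-Schmidt norm dominates the operator norm, so the filter converges pointwise. That
    the limit is also close in [hs2] is Fatou's argument, on finite sets of basis vectors. *)
Lemma hs_cauchy_cvg (F : set_system (S2 H)) : ProperFilter F -> cauchy F -> cvg F.
Proof.
move=> FF /cauchyP Fc.
have {}Fc (e : R) : 0 < e -> exists2 A : set (S2 H), F A &
    forall x y, A x -> A y -> hs_norm (x - y) <= e.
  move=> e0; have [|x Fx] := Fc (e / 2)%:C; first by rewrite ltcR divr_gt0.
  exists (ball x (e / 2)%:C) => // y z; rewrite -ball_normE /= !S2_normE !ltcR => h1 h2.
  have -> : y - z = (x - z) - (x - y) by rewrite opprB [RHS]addrC addrA subrK.
  apply: le_trans (hs_normD _ _) _.
  have -> : hs_norm (- (x - y)) = hs_norm (x - y).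
    by rewrite -scaleN1r hs_normZ cabsN /cabs normr1 mul1r.
  by lra.
have lim1 (u : H) : exists l : H, (x : S2 H) u @[x --> F] --> l.
  apply: cauchy_hnorm_cvg => e e0.
  have u1 : 0 < hnorm u + 1 by have := hnorm_ge0 u; lra.
  have [A FA hA] := Fc _ (divr_gt0 e0 u1).
  exists A => // x y Ax Ay; have := hA _ _ Ax Ay; rewrite ler_pdivlMr// => h.
  have -> : x u - y u = (x - y : S2 H) u by [].
  apply: le_trans (hs_norm_apply _ _) (le_trans _ h).
  by rewrite ler_wpM2l ?hs_norm_ge0//; lra.
have [g gP] := choice lim1.
have near_g u e : 0 < e -> F (fun x : S2 H => hnorm (g u - x u) < e).
  by move=> e0; exact: (cvg_hnorm_lt (gP u) e0).
have lg : linear g.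
  move=> a u v; apply/eqP; rewrite -subr_eq0 -hnorm_eq0; apply/eqP/le_anti.
  rewrite hnorm_ge0 andbT; apply/ler_addgt0Pr => e e0; rewrite add0r.
  have a0 := cabs_ge0 a; have a2 : 0 < cabs a + 2 by lra.
  have d0 : 0 < e / (cabs a + 2) by rewrite divr_gt0.
  have [x [h1 [h2 h3]]] := filter_ex (filterI (near_g (a *: u + v) _ d0)
    (filterI (near_g u _ d0) (near_g v _ d0))).
  have -> : g (a *: u + v) - (a *: g u + g v) =
      (g (a *: u + v) - x (a *: u + v)) - (a *: (g u - x u) + (g v - x v)).
    by rewrite bopD bopZ scalerBr addrACA -opprD opprB addrA subrK.
  apply: le_trans (hnormB _ _) _.
  have := Defs.hnormD (a *: (g u - x u)) (g v - x v); rewrite hnorm_scale => h4.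
  have h5 : cabs a * hnorm (g u - x u) <= cabs a * (e / (cabs a + 2)).
    by rewrite ler_wpM2l// ltW.
  have : e = (cabs a + 2) * (e / (cabs a + 2)) by rewrite mulrCA mulfV ?mulr1// gt_eqF.
  by lra.
have [A1 FA1 hA1] := Fc 1 ltr01.
have [x0 Ax0] := filter_ex FA1.
(* One unit bounds the distance to [x0] within [A1], the other the pointwise error, taken to be
   [hnorm u]. *)
have bg u : hnorm (g u) <= (hs_norm x0 + 2) * hnorm u.
  have [->|un0] := eqVneq u 0.
    have -> : g 0 = 0 by have := lg (-1) 0 0; rewrite scaler0 addr0 scaleN1r addNr.
    by rewrite hnorm0 mulr0.
  have u0 : 0 < hnorm u by rewrite lt_def hnorm_eq0 un0 hnorm_ge0.
  have [x [h1 Ax]] := filter_ex (filterI (near_g u _ u0) FA1).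
  have h2 := hA1 _ _ Ax Ax0.
  have -> : g u = (g u - x u) + ((x - x0 : S2 H) u + x0 u).
    by rewrite [(x - x0 : S2 H) u]bopBE subrK subrK.
  apply: le_trans (Defs.hnormD _ _) _.
  have h3 := Defs.hnormD ((x - x0 : S2 H) u) (x0 u).
  have h4 := hs_norm_apply (x - x0) u; have h5 := hs_norm_apply x0 u.
  have h6 : hs_norm (x - x0) * hnorm u <= 1 * hnorm u by rewrite ler_wpM2r// ltW.
  by lra.
have [G GE] := bop_exists lg bg.
have close (e : R) (A : set (S2 H)) : F A -> 0 <= e ->
    (forall x y, A x -> A y -> hs_norm (x - y) <= e) ->
    forall x, A x -> (hs2 (G - x)%R <= (e ^+ 2)%:E)%E.
  move=> FA e0 hA x Ax; apply: esum_le_fset => D; rewrite lee_fin.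
  apply/ler_addgt0Pr => d d0.
  (* On the finite set [D] the limit [G] is replaced by some [y] in [A]. The error [d] is shared
     among the elements of [D]; [+ 1] allows for an empty [D]. *)
  have [y [Ay hy]] : exists y, A y /\ forall b, b \in D ->
      hnorm ((G - x) (val b)) ^+ 2 <=
      hnorm ((y - x : S2 H) (val b)) ^+ 2 + d / (#|` D|%:R + 1).
    suff FB : F (fun y => forall b, b \in D -> hnorm ((G - x) (val b)) ^+ 2 <=
      hnorm ((y - x : S2 H) (val b)) ^+ 2 + d / (#|` D|%:R + 1)).
      by have [y [Ay hy]] := filter_ex (filterI FA FB); exists y.
    set dd := d / _; have dd0 : 0 < dd by rewrite divr_gt0// ltr_wpDl.
    pose P (b : onb H) (y : S2 H) : Prop := hnorm ((G - x) (val b)) ^+ 2 <=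
        hnorm ((y - x : S2 H) (val b)) ^+ 2 + dd.
    have FB b : b \in D -> F (P b).
      move=> _; rewrite /P; set p := hnorm ((G - x) (val b)); have p0 : 0 <= p := hnorm_ge0 _.
      have p1 : 0 < 2 * p + 1 by lra.
      apply: filterS (near_g (val b) _ (divr_gt0 dd0 p1)) => y.
      rewrite ltr_pdivlMr//; set c := hnorm (g _ - _) => hc.
      have c0 : 0 <= c := hnorm_ge0 _.
      set q := hnorm _; have q0 : 0 <= q := hnorm_ge0 _.
      have pq : p <= q + c.
        have -> : p = hnorm ((y - x : S2 H) (val b) + (g (val b) - y (val b))).
          by congr hnorm; rewrite bopBE GE [(y - x : S2 H) _]bopBE [RHS]addrC addrA subrK.
        exact: Defs.hnormD.
      have [le_pq|/ltW le_qp] := leP p q.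
        have : p * p <= q * q by rewrite ler_pM.
        by rewrite !expr2; lra.
      have h1 : p * p <= p * (q + c) by rewrite ler_wpM2l.
      have h2 : q * p <= q * (q + c) by rewrite ler_wpM2l.
      have h3 : c * q <= c * p by rewrite ler_wpM2l.
      by rewrite !expr2; nra.
    have FB1 : F (\bigcap_(i in [set` D]) P i) by exact: filter_bigI.
    apply: (@filterS _ F _ _ _ _ FB1) => y hy b bD. exact: (hy b bD).
  apply: (@le_trans _ _ (\sum_(b <- D) (hnorm ((y - x : S2 H) (val b)) ^+ 2 +
    d / (#|` D|%:R + 1)))).
    by rewrite big_seq [leRHS]big_seq; apply: ler_sum => b bD; exact: hy.
  rewrite big_split /=; apply: lerD.
    rewrite -lee_fin; apply: le_trans (fset_sum_le_esum _ D) _.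
    have -> : \esum_(i in [set: onb H]) (hnorm ((y - x : S2 H) (val i)) ^+ 2)%:E =
        hs2 (y - x : S2 H) by [].
    by rewrite -hs_norm_hs2 lee_fin ler_sqr ?nnegrE ?hs_norm_ge0//; exact: hA.
  rewrite big_const_seq count_predT iter_addr_0 -[leLHS]mulr_natr -mulrA ler_piMr ?ltW//.
  by rewrite ltr_pdivrMl ?ltr_wpDl// mulr1 ltrDl.
have GHS : G \in @hs_pred R H.
  have -> : G = (G - x0) + x0 by rewrite subrK.
  apply: rpredD; last exact: hs_opP.
  by apply/hs_predP; apply: le_lt_trans (close _ _ FA1 ler01 hA1 _ Ax0) (ltry _).
apply/cvg_ex; exists (HS GHS).
apply/cvgrPdist_le => _ /ltc0R_exists[e e0 <-].
have [A FA hA] := Fc _ e0.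
have FA2 := FA; apply: filterS FA2 => x Ax; rewrite S2_normE lecR.
rewrite -ler_sqr ?nnegrE ?hs_norm_ge0 ?(ltW e0)//.
by rewrite -lee_fin hs_norm_hs2; exact: (close _ _ FA (ltW e0) hA).
Qed.

HB.instance Definition _ := Uniform_isComplete.Build (S2 H) hs_cauchy_cvg.

Lemma hs_innerE (x : S2 H) : hs_inner x x = `|x| ^+ 2.
Proof. by rewrite S2_normE hs_norm_inner rmorphXn. Qed.

HB.instance Definition _ := CompleteNormedModule_isHilbert.Build R (S2 H)
  (formDr (@hs_inner_hermitian R H)) (formZr (@hs_inner_hermitian R H))
  (formC (@hs_inner_hermitian R H)) hs_innerE.

Lemma S2_innerE (x y : S2 H) : inner x y = hs_inner x y. Proof. by []. Qed.

Lemma S2_hnormE (x : S2 H) : hnorm x = hs_norm x. Proof. by []. Qed.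

End S2Hilbert.

(** * Spectral decomposition of a density *)

Section TraceFacts.
Context {R : realType} {H : hilbertType R}.
Implicit Types (x y z : bop H) (u v : H).

Lemma inner_csum (I : choiceType) (h : I -> H) u v : orthonormal_basis h ->
  csum (fun i => inner u (h i) * inner (h i) v) (inner u v).
Proof.
move=> hb e e0; have u1 : 0 < hnorm u + 1 by have := hnorm_ge0 u; lra.
have [A _ hA] := (cvg_hnormP _ _).1 (hsum_cvg hb v) _ (divr_gt0 e0 u1).
exists A => B /hA; rewrite ltr_pdivlMr// => lt_e.
have -> : inner u v - \sum_(i <- B) inner u (h i) * inner (h i) v =
    inner u (v - hsum h (fun i => inner (h i) v) B).
  rewrite innerBr inner_sumr; congr (_ - _); apply: eq_bigr => i _.
  by rewrite innerZr mulrC.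
apply: le_lt_trans (cauchy_schwarz _ _) (le_lt_trans _ lt_e).
by rewrite mulrC ler_wpM2l ?hnorm_ge0//; lra.
Qed.

Lemma trace_rank1 u v : trace (rank1 u v) = inner v u.
Proof.
apply: csum_sum; apply: eq_csum (inner_csum v u onb_basis) => e.
by rewrite rank1E innerZr.
Qed.

(** A divergent series has limit [0] by default, so a nonzero trace certifies convergence. *)
Lemma trace_cvg x l : trace x = l -> l != 0 ->
  csum (fun e : onb H => inner (\val e) (x (\val e))) l.
Proof.
rewrite /trace /showcase.summability.sum => trl l0; apply/csum_cvgP.
set F := showcase.summability.partial_sum _ @ _ in trl *.
have [cF|ncF] := pselect (cvg F); first by rewrite -trl; exact: cF.
by move: l0; rewrite -trl (dvgP ncF) eqxx.
Qed.

Definition hs_adjoint (X : S2 H) : S2 H := HS (hs_adj (hs_opP X)).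

(** The adjoint preserves [hs2]; polarization makes it antiunitary. *)
Lemma hs_inner_adj (X Y : S2 H) : hs_inner (hs_adjoint X) (hs_adjoint Y) = hs_inner Y X.
Proof.
have aD (Z W : S2 H) : hs_adjoint (Z + W) = hs_adjoint Z + hs_adjoint W.
  by apply/val_inj; exact: adjD.
have aZ a (Z : S2 H) : hs_adjoint (a *: Z) = a^* *: hs_adjoint Z.
  by apply/val_inj; exact: adjZ.
have hh := @hs_inner_hermitian R H.
rewrite [RHS](formC hh) [LHS](formC hh); congr (_^*).
rewrite [LHS](formC hh).
apply: (sesquilinear_eq (g := fun X Y => (hs_inner (hs_adjoint X) (hs_adjoint Y))^*)) => [||Z].
- split=> *; rewrite ?(aD, aZ).
  + by rewrite (formDr hh) rmorphD.
  + by rewrite (formDl hh) rmorphD.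
  + by rewrite (formZr hh) rmorphM /= conj_invol.
  + by rewrite (formZl hh) rmorphM /= conj_invol.
- exact: hermitian_sesquilinear.
- by rewrite !hs_inner_self conj_real hs2_adj.
Qed.

(** As [Tr (x y) = <x^*, y>], cyclicity is the antiunitarity of the adjoint. *)
Lemma trace_mulC x y : x \in @hs_pred R H -> y \in @hs_pred R H ->
  trace (x * y) = trace (y * x).
Proof.
move=> hx hy; pose X := HS hx; pose Y := HS hy.
have -> : trace (x * y) = hs_inner (hs_adjoint X) Y by rewrite /hs_inner /= adjK.
have -> : trace (y * x) = hs_inner (hs_adjoint Y) X by rewrite /hs_inner /= adjK.
rewrite -[LHS]hs_inner_adj; congr hs_inner; apply: val_inj; exact: adjK.
Qed.

End TraceFacts.

(** * Limits of bounded functions along an ultrafilter *)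

Section Ultrafilter.
Context {R : realType} {T : Type} (U : set_system T) {UU : UltraFilter U}.

Lemma ultra_bounded_real (f : T -> R) (M : R) : U [set x | `|f x| <= M] ->
  exists c, forall d, 0 < d -> U [set x | `|f x - c| < d].
Proof.
move=> fM.
have UF : ProperFilter (f @ U) by exact: fmap_proper_filter.
have FM : (f @ U) `[- M, M]%classic.
  rewrite /fmap /=; apply: filterS fM => x /=.
  by rewrite in_itv /= ler_norml.
have [c [_ cc]] := @segment_compact R (- M) M (f @ U) UF FM.
exists c => d d0.
have [//|nU] := in_ultra_setVsetC [set x | `|f x - c| < d] UU.
have [y []] := cc [set y | ~ `|y - c| < d] (ball c d) nU (nbhsx_ballx c d d0).
by move=> /= nyd; rewrite -ball_normE /= distrC.
Qed.

Lemma ultra_bounded_complex (f : T -> R[i]) (M : R) : U [set x | cabs (f x) <= M] ->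
  exists c, forall d, 0 < d -> U [set x | cabs (f x - c) < d].
Proof.
move=> fM.
have cabs_re_le z : `|re z| <= cabs z :> R.
  by rewrite -ler_sqr ?nnegrE ?cabs_ge0// cabs_sqrE real_normK ?num_real// lerDl sqr_ge0.
have cabs_im_le z : `|complex.Im z| <= cabs z :> R.
  by rewrite -ler_sqr ?nnegrE ?cabs_ge0// cabs_sqrE real_normK ?num_real// lerDr sqr_ge0.
have [a ha] := @ultra_bounded_real (fun x => re (f x)) M
  (filterS (fun x h => le_trans (cabs_re_le _) h) fM).
have [b hb] := @ultra_bounded_real (fun x => complex.Im (f x)) M
  (filterS (fun x h => le_trans (cabs_im_le _) h) fM).
exists (a +i* b) => d d0; have d2 : 0 < d / 2 by rewrite divr_gt0.
apply: filterS (filterI (ha _ d2) (hb _ d2)) => x /= [].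
case: (f x) => p q /= h1 h2.
rewrite -ltr_sqr ?nnegrE ?cabs_ge0 ?(ltW d0)// cabs_sqrE /=.
have h3 : (p - a) ^+ 2 < (d / 2) ^+ 2.
  by rewrite -real_normK ?num_real// ltr_sqr ?nnegrE// ltW.
have h4 : (q - b) ^+ 2 < (d / 2) ^+ 2.
  by rewrite -real_normK ?num_real// ltr_sqr ?nnegrE// ltW.
have : (d / 2) ^+ 2 + (d / 2) ^+ 2 <= d ^+ 2.
  have := sqr_ge0 d; have -> : (d / 2) ^+ 2 = d ^+ 2 / 4 by field.
  lra.
lra.
Qed.

End Ultrafilter.

Section Spectral.
Context {R : realType} {H : hilbertType R} (rho : bop H).
Implicit Types (u v w : H).
Hypothesis rho_pos : positive rho.
Hypothesis rho_inj : forall u, rho u = 0 -> u = 0.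
Let q u := re (inner u (rho u)).
Hypothesis rho_trace : (\esum_(e in [set: onb H]) (q (\val e))%:E < +oo)%E.

Let hq := positive_hermitian rho_pos.
Let p : H -> R := fnorm (fun u v => inner u (rho v)).

Let q_ge0 u : 0 <= q u. Proof. exact: ge0_re_ge0. Qed.
Let pq u : p u ^+ 2 = q u. Proof. exact: (fnorm_sqr rho_pos). Qed.
Let p_ge0 u : 0 <= p u. Proof. exact: fnorm_ge0. Qed.
Let pD u v : p (u + v) <= p u + p v. Proof. exact: (fnormD hq rho_pos). Qed.

Let q_bound : exists2 M, 0 < M & forall u, p u <= M * hnorm u /\ hnorm (rho u) <= M * p u.
Proof.
have [M M0 hM] := bop_bounded rho.
(* One constant for both bounds; the [1] keeps it positive. *)
pose s := Num.sqrt (M + 1); have s0 : 0 < s by rewrite sqrtr_gt0; lra.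
have s2 : s ^+ 2 = M + 1 by rewrite sqr_sqrtr//; lra.
exists s => // u; split.
  rewrite -ler_sqr ?nnegrE ?mulr_ge0 ?hnorm_ge0 ?(ltW s0)// pq exprMn s2.
  apply: le_trans (re_inner_le _ _) _.
  apply: le_trans (ler_wpM2l (hnorm_ge0 u) (hM u)) _.
  by have := sqr_ge0 (hnorm u); rewrite expr2; lra.
rewrite -ler_sqr ?nnegrE ?mulr_ge0 ?hnorm_ge0 ?(ltW s0)// exprMn pq s2.
apply: le_trans (positive_hnorm_le _ rho_pos M0 hM) _.
by rewrite ler_wpM2r ?q_ge0//; lra.
Qed.

(** Compactness in quantitative form. Off a finite set the values of [q] on the basis sum to less
    than [e ^+ 2]; Cauchy-Schwarz and Bessel then bound the seminorm of the remainder. *)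
Let tail_bound (e : R) : 0 < e -> exists A : {fset onb H}, forall u,
  p (u - hsum (fun b : onb H => \val b) (fun b => inner (\val b) u) A) <= e * hnorm u.
Proof.
move=> e0; set hs := hsum (fun b : onb H => \val b).
have trf : \esum_(b in [set: onb H]) (q (\val b))%:E =
    (fine (\esum_(b in [set: onb H]) (q (\val b))%:E))%:E.
  by rewrite fineK// ge0_fin_numE// esum_ge0// => b _; rewrite lee_fin.
have e2 : 0 < e ^+ 2 by rewrite exprn_gt0.
have [A _ hA] := cvg_fset_sum (fun b => q_ge0 (\val b)) trf e2.
have /andP[hA1 _] := hA A (fsubset_refl A).
exists A => u; set c := fun b : onb H => inner (\val b) u.
have fin (B : {fset onb H}) : (A `<=` B)%fset -> p (hs c B - hs c A) <= e * hnorm u.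
  move=> AB; rewrite (hsum_sub _ _ AB); set D := (B `\` A)%fset.
  apply: le_trans (fnorm_sum hq rho_pos _ _) _.
  under eq_bigr do rewrite (fnormZ hq rho_pos).
  rewrite -ler_sqr ?nnegrE ?mulr_ge0 ?hnorm_ge0 ?(ltW e0)//; last first.
    by apply: sumr_ge0 => b _; rewrite mulr_ge0 ?cabs_ge0 ?fnorm_ge0.
  apply: le_trans (sum_cauchy_schwarz _ _ _) _.
  rewrite exprMn mulrC; apply: ler_pM.
  - by apply: sumr_ge0 => b _; exact: sqr_ge0.
  - by apply: sumr_ge0 => b _; exact: sqr_ge0.
  - under eq_bigr do rewrite pq.
    have /andP[_ hB] := hA B AB.
    by move: hB hA1; rewrite (big_fset_subD _ AB) /= -/D; lra.
  - exact: (bessel onb_basis.1).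
have [M M0 hM] := q_bound.
apply/ler_addgt0Pr => d d0.
have [B [AB hB]] := net_hnorm_lt A (hsum_cvg onb_basis u) (divr_gt0 d0 M0).
have -> : u - hs c A = (hs c B - hs c A) + (u - hs c B) by rewrite [RHS]addrC addrA subrK.
apply: le_trans (pD _ _) (lerD (fin B AB) _).
apply: le_trans (hM _).1 _.
by rewrite mulrC -ler_pdivlMr// ltW.
Qed.

Variable E : set H.
Hypothesis E_eigen : forall e, E e -> exists l : R, rho e = l%:C *: e.
(** The orthogonal complement of a set of eigenvectors, stable under [rho]; a further eigenvector is
    sought there. *)
Let M u := forall e, E e -> inner e u = 0.

Let M_rho u : M u -> M (rho u).
Proof.
move=> Mu e Ee; have [l rhoe] := E_eigen Ee.
by rewrite adjP (positive_selfadj rho_pos) rhoe innerZl Mu// mulr0.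
Qed.

(** The supremum [l] of [q] on the unit ball of [M] is an eigenvalue. Limits are taken of the images
    [rho u] and not of the near-maximizers [u], which are not known to converge in norm. *)
Lemma eigenvector_exists u1 : M u1 -> u1 != 0 ->
  exists v, [/\ M v, hnorm v = 1 & exists2 l : R, 0 < l & rho v = l%:C *: v].
Proof.
move=> Mu1 u1n0; have [C C0 hC] := q_bound.
have MZ a u : M u -> M (a *: u) by move=> Mu e Ee; rewrite innerZr Mu// mulr0.
have MB u v : M u -> M v -> M (u - v).
  by move=> Mu Mv e Ee; rewrite innerBr Mu// Mv// subrr.
pose S := [set q u | u in [set u | M u /\ hnorm u <= 1]].
have pos_q u : u != 0 -> 0 < q u.
  move=> un0; rewrite lt_def q_ge0 andbT; apply: contra un0 => /eqP qu0.
  have := (hC u).2; have -> : p u = 0 by apply/eqP; rewrite -sqrf_eq0 pq qu0.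
  rewrite mulr0 => h; apply/eqP/rho_inj/eqP; rewrite -hnorm_eq0.
  by apply/eqP/le_anti; rewrite h hnorm_ge0.
have u10 : 0 < hnorm u1 by rewrite lt_def hnorm_eq0 u1n0 hnorm_ge0.
have qZ (a : R) u : q (a%:C *: u) = a ^+ 2 * q u.
  rewrite /q bopZ innerZr innerZl conj_real mulrA -rmorphM -expr2; exact: reZ.
have supS : has_sup S.
  split; first by exists (q 0), 0; split=> //; [move=> e _; rewrite inner0r|rewrite hnorm0].
  exists (C ^+ 2) => _ [u [_ u1']] <-.
  rewrite -pq ler_sqr ?nnegrE ?p_ge0 ?(ltW C0)//; apply: le_trans (hC u).1 _.
  by rewrite ler_piMr ?(ltW C0).
set l := sup S.
have leS u : M u -> hnorm u <= 1 -> q u <= l.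
  by move=> Mu uu; apply: sup_upper_bound => //; exists u.
have q_le u : M u -> q u <= l * hnorm u ^+ 2.
  move=> Mu; have [->|un0] := eqVneq u 0.
    by rewrite /q bop0 inner0r hnorm0 expr0n mulr0.
  have u0 : 0 < hnorm u by rewrite lt_def hnorm_eq0 un0 hnorm_ge0.
  have := leS ((hnorm u)^-1%:C *: u) (MZ _ _ Mu).
  rewrite hnorm_scale cabsR ger0_norm ?invr_ge0 ?(ltW u0)// mulVf ?gt_eqF// => /(_ (lexx _)).
  by rewrite qZ exprVn mulrC ler_pdivrMr ?exprn_gt0.
have l0 : 0 < l.
  have := q_le _ Mu1; have := pos_q _ u1n0.
  by move=> h1 h2; have := lt_le_trans h1 h2; rewrite pmulr_lgt0// exprn_gt0.
(* Cauchy-Schwarz for the form of [rho] at [rho u] and [u], with [q (rho u)] bounded through the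
   invariance of [M]. *)
have rho_le u : M u -> hnorm (rho u) ^+ 2 <= l * q u.
  move=> Mu; have := form_cauchy_schwarz hq rho_pos (rho u) u.
  rewrite inner_hnorm cabsR ger0_norm ?sqr_ge0//.
  have := q_le _ (M_rho Mu); rewrite -/(q (rho u)) -/(q u).
  have [->|rn0] := eqVneq (hnorm (rho u)) 0.
    by rewrite expr0n /= => _ _; rewrite mulr_ge0 ?q_ge0 ?(ltW l0).
  have r0 : 0 < hnorm (rho u) ^+ 2 by rewrite exprn_gt0// lt_def rn0 hnorm_ge0.
  move=> h1 h2; have := le_trans h2 (ler_wpM2r (q_ge0 u) h1).
  have -> : l * hnorm (rho u) ^+ 2 * q u = hnorm (rho u) ^+ 2 * (l * q u) by ring.
  by rewrite [leLHS]expr2 ler_pM2l.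
(* Expanding the square leaves at most [l q u - 2 l q u + l^2]. *)
have near_eigen u : M u -> hnorm u <= 1 -> hnorm (rho u - l%:C *: u) ^+ 2 <= l * (l - q u).
  move=> Mu uu.
  have -> : hnorm (rho u - l%:C *: u) ^+ 2 =
      hnorm (rho u) ^+ 2 - 2 * l * q u + l ^+ 2 * hnorm u ^+ 2.
    rewrite hnorm_sqr innerBr !innerBl !innerZl !innerZr conj_real.
    rewrite (inner_conj u (rho u)) !reB !reZ reJ -hnorm_sqr inner_hnorm.
    rewrite -/(q u) /=; ring.
  have := rho_le _ Mu.
  have : l ^+ 2 * hnorm u ^+ 2 <= l ^+ 2 * 1.
    by rewrite ler_wpM2l ?sqr_ge0// expr_le1 ?hnorm_ge0.
  by rewrite mulr1 !mulrBr -expr2; lra.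
(* Along an ultrafilter of almost maximizers of [q] all coordinates converge,
   and [tail_bound] then makes the image under [rho] Cauchy. *)
pose B (d : R) := [set u | [/\ M u, hnorm u <= 1 & l - d < q u]].
pose F : set_system H := filter_from [set d : R | 0 < d] B.
have FF : ProperFilter F.
  apply: filter_from_proper; last first.
    move=> d d0; have [_ [u [Mu uu] <-] lu] := sup_adherent d0 supS.
    by exists u.
  apply: filter_from_filter; first by exists 1; exact: ltr01.
  move=> d1 d2 d10 d20; exists (Num.min d1 d2); first by rewrite /= lt_min d10.
  move=> u [Mu uu]; rewrite ltrBlDr -ltrBlDl lt_min => /andP[h1 h2].
  by split; split=> //; [move: h1|move: h2]; lra.
have [U [UU FU]] := ultraFilterLemma FF.
have UB d : 0 < d -> U (B d) by move=> d0; apply: FU; exists d.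
have coord (b : onb H) : exists c, forall d : R, 0 < d ->
    U [set u | cabs (inner (\val b) u - c) < d].
  apply: (@ultra_bounded_complex _ _ _ _ _ 1).
  apply: filterS (UB 1 ltr01) => u [_ uu _] /=.
  apply: le_trans (cauchy_schwarz _ _) _.
  by rewrite (hnorm_orthonormal onb_basis.1) mul1r.
have [c hc] := choice coord.
have [w wlim] : exists w : H, (rho u) @[u --> U] --> w.
  apply: cauchy_hnorm_cvg => e e0.
  (* The tail of [u - v], a vector of norm at most [2], and its finite part each contribute at most
     [e / (2 * C)] to [p (u - v)]. *)
  have e1 : 0 < e / (4 * C) by rewrite divr_gt0// mulr_gt0.
  have [A hA] := tail_bound e1.
  pose s := \sum_(b <- A) p (\val b).
  have s0 : 0 <= s by apply: sumr_ge0 => b _.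
  pose d := e / (4 * C * (s + 1)).
  have d0 : 0 < d by rewrite divr_gt0// !mulr_gt0//; lra.
  pose G := \bigcap_(b in [set` A]) [set u | cabs (inner (\val b) u - c b) < d].
  have UG : U G by apply: filter_bigI => b _; exact: hc.
  exists (B 1 `&` G); first by apply: filterI => //; exact: UB.
  move=> u v [[Mu uu _] Gu] [[Mv vv _] Gv].
  rewrite -bopB; apply: le_trans (hC _).2 _.
  have := hA (u - v); set hh := hsum _ _ A => h1.
  have h2 : p hh <= 2 * d * s.
    apply: le_trans (fnorm_sum hq rho_pos _ _) _.
    rewrite /s mulr_sumr big_seq [leRHS]big_seq; apply: ler_sum => b bA.
    rewrite (fnormZ hq rho_pos) ler_wpM2r//.
    have -> : inner (\val b) (u - v) = (inner (\val b) u - c b) - (inner (\val b) v - c b).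
      by rewrite innerBr; ring.
    apply: le_trans (cabsD _ _) _; rewrite cabsN.
    by have := Gu _ bA; have := Gv _ bA; rewrite /=; lra.
  have h3 : hnorm (u - v) <= 2 by apply: le_trans (hnormB _ _) _; lra.
  have h4 : p (u - v) <= e / (4 * C) * 2 + 2 * d * s.
    have -> : u - v = (u - v - hh) + hh by rewrite subrK.
    apply: le_trans (pD _ _) (lerD _ h2).
    by apply: le_trans h1 _; rewrite ler_wpM2l// ltW.
  have h5 : d * (s + 1) = e / (4 * C).
    by rewrite /d; field; rewrite gt_eqF//=; lra.
  have h6 : C * (e / (4 * C)) = e / 4 by field; rewrite gt_eqF.
  have h7 : d * s <= e / (4 * C) by rewrite -h5; lra.
  apply: le_trans (ler_wpM2l (ltW C0) h4) _.
  have h8 := ler_wpM2l (ltW C0) h7; rewrite h6 in h8.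
  by rewrite mulrDr mulrA h6 -mulrA mulrCA; lra.
have wclose d : 0 < d -> exists u, [/\ M u, hnorm u <= 1, l - d < q u,
    hnorm (rho u - l%:C *: u) < d & hnorm (w - rho u) < d].
  move=> d0.
  (* The second term gives [l * (l - q u) <= d ^+ 2 / 2], as the estimate for near-maximizers
     requires. *)
  pose d' := Num.min d (d ^+ 2 / (2 * l)).
  have d'0 : 0 < d' by rewrite lt_min d0 divr_gt0 ?exprn_gt0// mulr_gt0.
  have [u [[Mu uu qu] hw]] := filter_ex (filterI (UB _ d'0) (cvg_hnorm_lt wlim d0)).
  exists u; split=> //.
    by apply: le_lt_trans qu; rewrite lerD2l lerN2 ge_min lexx.
  rewrite -ltr_sqr ?nnegrE ?hnorm_ge0 ?(ltW d0)//.
  apply: le_lt_trans (near_eigen _ Mu uu) _.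
  have h : l - q u < d ^+ 2 / (2 * l).
    by have : l - q u < d' by [lra]; move=> h; apply: lt_le_trans h _; rewrite ge_min lexx orbT.
  apply: le_lt_trans (ler_wpM2l (ltW l0) (ltW h)) _.
  have -> : l * (d ^+ 2 / (2 * l)) = d ^+ 2 / 2 by field; rewrite gt_eqF.
  by have : 0 < d ^+ 2 by [rewrite exprn_gt0]; lra.
have Mw : M w.
  move=> e Ee; apply/eqP; rewrite -cabs_eq0; apply/eqP/le_anti; rewrite cabs_ge0 andbT.
  apply/ler_addgt0Pr => d d0; rewrite add0r.
  have e1 : 0 < hnorm e + 1 by have := hnorm_ge0 e; lra.
  have [u [Mu _ _ _ hw]] := wclose _ (divr_gt0 d0 e1).
  have -> : inner e w = inner e (w - rho u) by rewrite innerBr (M_rho Mu)// subr0.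
  apply: le_trans (cauchy_schwarz _ _) _.
  move: hw; rewrite ltr_pdivlMr// => hw.
  by have := hnorm_ge0 (w - rho u); lra.
have [K K0 hK] := bop_bounded rho.
have rhow : rho w = l%:C *: w.
  apply/eqP; rewrite -subr_eq0 -hnorm_eq0; apply/eqP/le_anti; rewrite hnorm_ge0 andbT.
  apply/ler_addgt0Pr => d d0; rewrite add0r.
  have k0 : 0 < 2 * K + l + 1 by lra.
  have [u [Mu _ _ hu hw]] := wclose _ (divr_gt0 d0 k0).
  have -> : rho w - l%:C *: w =
      rho (w - rho u) + rho (rho u - l%:C *: u) + l%:C *: (rho u - w).
    rewrite !bopB bopZ scalerBr.
    by rewrite !addrA !subrK.
  apply: le_trans (Defs.hnormD _ _) _.
  have := Defs.hnormD (rho (w - rho u)) (rho (rho u - l%:C *: u)).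
  rewrite hnorm_scale cabsR ger0_norm ?(ltW l0)// (hnormBC (rho u)).
  have := ler_wpM2l K0 (ltW hw); have := ler_wpM2l K0 (ltW hu).
  have := ler_wpM2l (ltW l0) (ltW hw).
  have := hK (w - rho u); have := hK (rho u - l%:C *: u).
  have E1 : d = (2 * K + l + 1) * (d / (2 * K + l + 1)) by rewrite mulrCA mulfV ?mulr1// gt_eqF.
  have := divr_gt0 d0 k0; set dd := d / _ in E1 *.
  by lra.
(* If [w = 0], some near-maximizer has [2 l / 3 < q u <= hnorm (rho u) < l / 3]. *)
have wn0 : w != 0.
  apply/eqP => w0.
  have l3 : 0 < l / 3 by rewrite divr_gt0.
  have [u [Mu uu qu hu hw]] := wclose _ l3.
  move: hw; rewrite w0 sub0r hnormN => hw.
  have : q u <= 1 * hnorm (rho u).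
    by apply: le_trans (re_inner_le _ _) _; rewrite ler_wpM2r ?hnorm_ge0.
  by lra.
have w0 : hnorm w != 0 by rewrite hnorm_eq0.
exists ((hnorm w)^-1%:C *: w); split; first exact: MZ.
  by rewrite hnorm_scale cabsR ger0_norm ?invr_ge0 ?hnorm_ge0// mulVf.
by exists l => //; rewrite bopZ rhow !scalerA mulrC.
Qed.

End Spectral.

(** A nonzero vector orthogonal to a maximal orthonormal family of eigenvectors with positive
    eigenvalues would produce one more such eigenvector orthogonal to the family. *)
Lemma eigenbasis_exists (R : realType) (H : hilbertType R) (rho : bop H) :
  positive rho -> (forall u, rho u = 0 -> u = 0) ->
  (\esum_(e in [set: onb H]) (re (inner (\val e) (rho (\val e))))%:E < +oo)%E ->
  exists (B : set H) (l : B -> R), [/\ orthonormal_basis (fun e : B => \val e),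
    forall e, 0 < l e & forall e : B, rho (\val e) = (l e)%:C *: \val e].
Proof.
move=> rpos rinj rtr.
pose P := [set v | exists2 l : R, 0 < l & rho v = l%:C *: v].
have [B [oB BP Bmax]] := maximal_orthonormal P.
have /choice[l hl] (e : B) : exists l : R, 0 < l /\ rho (\val e) = l%:C *: \val e.
  by have [l l0 rl] := BP _ (set_mem (valP e)); exists l.
exists B, l; split=> [|e|e]; [|exact: (hl e).1|exact: (hl e).2].
split=> // u uB; apply: contrapT => /eqP un0.
have [|e Be|v [vB v1 rv]] := @eigenvector_exists _ _ rho rpos rinj rtr B _ u _ un0.
- by move=> e /BP[l' _ rl]; exists l'.
- by have := uB (SigSub (mem_set Be)).
- by apply: (Bmax v) => // e; apply: vB; exact: set_mem (valP e).
Qed.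

(** * Geometric means of quadratic forms *)

(** If [m 1 > m 0], log-convexity keeps every ratio at least [r = m 1 / m 0 > 1], and geometric
    growth contradicts the bound. *)
Lemma log_convex_bounded (R : realType) (m : nat -> R) (B : R) :
  (forall n, 0 <= m n) -> (forall n, m n.+1 ^+ 2 <= m n * m n.+2) ->
  (forall n, m n <= B) -> m 1%N <= m 0%N.
Proof.
move=> m0 lc mB; rewrite leNgt; apply/negP => m01.
have m0p : 0 < m 0%N.
  rewrite lt_def m0 andbT; apply/eqP => m00.
  by have := lc 0%N; rewrite m00 mul0r expr2 leNgt mulr_gt0// -m00.
pose r := m 1%N / m 0%N.
have r1 : 1 < r by rewrite ltr_pdivlMr// mul1r.
have grow n : 0 < m n /\ r * m n <= m n.+1.
  elim: n => [|n [mn rn]]; first by rewrite /r divfK ?gt_eqF.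
  have mn1 : 0 < m n.+1 by apply: lt_le_trans rn; rewrite mulr_gt0//; lra.
  split=> //; rewrite -(ler_pM2l mn); apply: le_trans (lc n).
  by rewrite mulrCA mulrA expr2 ler_wpM2r// ltW.
(* Bernoulli's inequality is enough to pass any bound. *)
have geom n : (1 + n%:R * (r - 1)) * m 0%N <= m n.
  elim: n => [|n IH]; first by rewrite mul0r addr0 mul1r.
  have [_ rn] := grow n; apply: le_trans rn.
  have r0 : 0 <= r by lra.
  apply: le_trans (ler_wpM2l r0 IH); rewrite mulrA ler_wpM2r ?(ltW m0p)//.
  have n0 : 0 <= n%:R :> R by exact: ler0n.
  have h := mulr_ge0 n0 (sqr_ge0 (r - 1)).
  rewrite -natr1; move: h; rewrite expr2; lra.
have d0 : 0 < (r - 1) * m 0%N by rewrite mulr_gt0// subr_gt0.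
have B0 : 0 <= B by exact: le_trans (m0 0%N) (mB 0%N).
pose n := (Num.truncn (B / ((r - 1) * m 0%N))).+1.
have : B < n%:R * ((r - 1) * m 0%N).
  by rewrite -ltr_pdivrMr// /n truncnS_gt.
have := le_trans (geom n) (mB n); rewrite mulrDl mul1r -mulrA.
by lra.
Qed.

Section GeometricMean.
Context {R : realType} (V : lmodType R[i]) (g : V -> V -> R[i]).
Hypothesis hg : hermitian g.
Variables (K : eqType) (s : seq K) (E : K -> V) (a b w : K -> R).
Hypotheses (a0 : forall k, 0 < a k) (b0 : forall k, 0 < b k) (w0 : forall k, 0 < w k).
Hypothesis wab : forall k, w k ^+ 2 = a k * b k.
Implicit Types u v : K -> R[i].

Let x v := \sum_(k <- s) v k *: E k.
Let wsum (c : K -> R) v := \sum_(k <- s) c k * cabs (v k) ^+ 2.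

Hypothesis g_le : forall u v, cabs (g (x u) (x v)) ^+ 2 <= wsum a u * wsum b v.

(** The inner product with the geometric mean weights [w], of which [wsum w] is the diagonal. *)
Let qf u v := \sum_(k <- s) (w k)%:C * ((u k)^* * v k).

Let cabs_sum (F : K -> R[i]) : cabs (\sum_(k <- s) F k) <= \sum_(k <- s) cabs (F k).
Proof.
elim/big_rec2: _ => [|k y z _ h]; first by rewrite cabs0.
by apply: le_trans (cabsD _ _) _; rewrite lerD2l.
Qed.

Let wsum_ge0 c v : (forall k, 0 < c k) -> 0 <= wsum c v.
Proof. by move=> c0; apply: sumr_ge0 => k _; rewrite mulr_ge0 ?sqr_ge0 ?(ltW (c0 k)). Qed.

Let qf_cauchy_schwarz u v : cabs (qf u v) ^+ 2 <= wsum w u * wsum w v.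
Proof.
pose t k := Num.sqrt (w k).
have t2 k : t k * t k = w k by rewrite -expr2 sqr_sqrtr// ltW.
have tE z : wsum w z = \sum_(k <- s) (t k * cabs (z k)) ^+ 2.
  by apply: eq_bigr => k _; rewrite exprMn [t k ^+ 2]expr2 t2.
rewrite !tE; apply: le_trans (sum_cauchy_schwarz _ _ _).
rewrite ler_sqr ?nnegrE ?cabs_ge0//; last first.
  by apply: sumr_ge0 => k _; rewrite !mulr_ge0 ?cabs_ge0 ?sqrtr_ge0.
apply: le_trans (cabs_sum _) _; apply: ler_sum => k _.
by rewrite !cabsM cabsJ cabsR ger0_norm ?(ltW (w0 k))// mulrACA t2.
Qed.

(* [Z] is symmetric for [qf] and contracts [wsum a]; hence the sequence
   [wsum w (iter n Z v)] is log-convex and bounded, so it does not increase. *)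
Let Z v : K -> R[i] := fun k => ((w k)^-1)%:C * g (E k) (x v).

Let qfZ u v : qf u (Z v) = g (x u) (x v).
Proof.
rewrite /x (form_suml hg); apply: eq_bigr => k _.
rewrite (formZl hg) /Z mulrCA; congr (_ * _); rewrite mulrA -rmorphM mulfV ?mul1r//.
by rewrite gt_eqF.
Qed.

Let Z_contract v : wsum a (Z v) <= wsum a v.
Proof.
(* Chosen so that [g (x y) (x v)] and [wsum b y] both equal [wsum a (Z v)]; one factor then cancels
   in the domination of [g]. *)
pose y k := (a k / w k)%:C * Z v k.
have gE : g (x y) (x v) = (wsum a (Z v))%:C.
  rewrite -qfZ /wsum realc_sum; apply: eq_bigr => k _.
  have yJ : (y k)^* = (a k / w k)%:C * (Z v k)^* by rewrite /y rmorphM /= conj_real.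
  have aE : (a k)%:C = (w k)%:C * (a k / w k)%:C.
    by rewrite -rmorphM mulrC divfK ?gt_eqF.
  by rewrite [RHS]rmorphM /= cabs_sqr yJ aE; ring.
have bE : wsum b y = wsum a (Z v).
  apply: eq_bigr => k _; rewrite /y cabsM cabsR exprMn mulrA; congr (_ * _).
  rewrite real_normK ?num_real// exprMn exprVn wab.
  by field; rewrite !gt_eqF.
have := g_le v y; rewrite (formC hg) cabsJ gE bE cabsR.
have A0 := wsum_ge0 (Z v) a0; rewrite ger0_norm//.
have [->|An0] := eqVneq (wsum a (Z v)) 0; first by move=> _; exact: wsum_ge0.
by rewrite expr2 ler_pM2r// lt_def An0.
Qed.

(** [g (x v) (x v) = qf v (Z v)], so Cauchy-Schwarz bounds its square by [m 0 * m 1] with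
    [m n = wsum w (iter n Z v)], and [m 1 <= m 0]. *)
Lemma form_le_geometric_mean v : re (g (x v) (x v)) <= wsum w v.
Proof.
pose m n := wsum w (iter n Z v).
have m0 n : 0 <= m n by exact: wsum_ge0.
have qfE z : qf z z = (wsum w z)%:C.
  rewrite realc_sum; apply: eq_bigr => k _.
  by rewrite rmorphM /= cabs_sqr [_^* * _]mulrC.
have lc n : m n.+1 ^+ 2 <= m n * m n.+2.
  rewrite /m /=; set z := iter n Z v.
  apply: le_trans (qf_cauchy_schwarz z (Z (Z z))).
  rewrite qfZ (formC hg) -qfZ cabsJ qfE cabsR.
  by rewrite ger0_norm// wsum_ge0.
have alpha_le n : wsum a (iter n Z v) <= wsum a v.
  by elim: n => [//|n IH]; apply: le_trans (Z_contract _) IH.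
(* On finitely many indices [wsum w] is at most a multiple of [wsum a], which [Z] does not
   increase. *)
pose C := \sum_(k <- s) w k / a k.
have mB n : m n <= C * wsum a v.
  rewrite /C mulr_suml /m; set z := iter n Z v.
  rewrite /wsum big_seq [leRHS]big_seq; apply: ler_sum => k ks.
  have zk : a k * cabs (z k) ^+ 2 <= wsum a v.
    apply: le_trans (alpha_le n); rewrite -/z /wsum (big_rem k ks) /= lerDl.
    by apply: sumr_ge0 => j _; rewrite mulr_ge0 ?sqr_ge0 ?(ltW (a0 j)).
  have -> : w k * cabs (z k) ^+ 2 = w k / a k * (a k * cabs (z k) ^+ 2).
    by field; rewrite gt_eqF.
  by rewrite ler_wpM2l// divr_ge0 ?ltW.
have m10 := log_convex_bounded m0 lc mB.
have := qf_cauchy_schwarz v (Z v); rewrite qfZ => h.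
apply: le_trans (le_re_cabs _) _.
rewrite -ler_sqr ?nnegrE ?cabs_ge0 ?wsum_ge0//.
by apply: le_trans h _; rewrite expr2 ler_wpM2l ?wsum_ge0//.
Qed.

End GeometricMean.

(** * Contraction semigroups on a Hilbert space *)

Section DenseExtension.
Context {R : realType} {K : hilbertType R} {V : lmodType R[i]}.
Variables (i : V -> K) (S : V -> V).
Hypotheses (li : linear i) (lS : linear S).
Hypothesis i_dense : forall xi (e : R), 0 < e -> exists x, hnorm (xi - i x) <= e.

Lemma dense_linear_eq (f g : K -> K) : linear f -> linear g ->
  (forall xi, hnorm (f xi) <= hnorm xi) -> (forall xi, hnorm (g xi) <= hnorm xi) ->
  (forall x, f (i x) = g (i x)) -> f = g.
Proof.
move=> lf lg f1 g1 fg; apply/funext => xi.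
apply/eqP; rewrite -subr_eq0 -hnorm_eq0; apply/eqP/le_anti; rewrite hnorm_ge0 andbT.
apply/ler_addgt0Pr => e e0; rewrite add0r.
have [x hx] := i_dense xi (divr_gt0 e0 (ltr0n _ 2)).
have fB u v (k : K -> K) : linear k -> k (u - v) = k u - k v.
  by move=> lk; have := lk (-1) v u; rewrite !scaleN1r ![- _ + _]addrC => ->.
have -> : f xi - g xi = f (xi - i x) - g (xi - i x).
  by rewrite (fB _ _ f)// (fB _ _ g)// fg opprB addrA subrK.
apply: le_trans (hnormB _ _) _.
by have := f1 (xi - i x); have := g1 (xi - i x); lra.
Qed.

Hypothesis S_contract : forall x, hnorm (i (S x)) <= hnorm (i x).

(** The closure [G] of the graph of [i x |-> i (S x)] is a linear relation. Contractivity makes it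
    single-valued; density and completeness give it full domain. *)
Lemma dense_extension : exists f : K -> K, [/\ linear f,
  forall xi, hnorm (f xi) <= hnorm xi & forall x, f (i x) = i (S x)].
Proof.
have iB x y : i (x - y) = i x - i y.
  by have := li (-1) y x; rewrite !scaleN1r ![- _ + _]addrC => ->.
have SB x y : S (x - y) = S x - S y.
  by have := lS (-1) y x; rewrite !scaleN1r ![- _ + _]addrC => ->.
pose G xi y := forall e : R, 0 < e -> exists x,
    hnorm (xi - i x) <= e /\ hnorm (y - i (S x)) <= e.
have G_le xi y : G xi y -> hnorm y <= hnorm xi.
  move=> h; apply/ler_addgt0Pr => e e0.
  have [x [h1 h2]] := h _ (divr_gt0 e0 (ltr0n _ 2)).
  have h3 := ler_hnormB y (i (S x)).
  have h4 := ler_hnormB (i x) xi; rewrite hnormBC in h4.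
  by have := S_contract x; lra.
have GD a xi y eta z : G xi y -> G eta z -> G (a *: xi + eta) (a *: y + z).
  move=> h1 h2 e e0; have a0 := cabs_ge0 a; have a1 : 0 < cabs a + 1 by lra.
  have d0 := divr_gt0 e0 a1.
  have [x1 [h11 h12]] := h1 _ d0; have [x2 [h21 h22]] := h2 _ d0.
  have dE : e = cabs a * (e / (cabs a + 1)) + e / (cabs a + 1) by field; rewrite gt_eqF.
  exists (a *: x1 + x2); split.
    have -> : a *: xi + eta - i (a *: x1 + x2) = a *: (xi - i x1) + (eta - i x2).
      by rewrite li scalerBr opprD addrACA.
    apply: le_trans (Defs.hnormD _ _) _; rewrite hnorm_scale {1}dE.
    by apply: lerD => //; rewrite ler_wpM2l.
  have -> : a *: y + z - i (S (a *: x1 + x2)) = a *: (y - i (S x1)) + (z - i (S x2)).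
    by rewrite lS li scalerBr opprD addrACA.
  apply: le_trans (Defs.hnormD _ _) _; rewrite hnorm_scale {1}dE.
  by apply: lerD => //; rewrite ler_wpM2l.
have GU xi y z : G xi y -> G xi z -> y = z.
  move=> h1 h2; apply/eqP; rewrite -subr_eq0 -hnorm_eq0; apply/eqP/le_anti.
  rewrite hnorm_ge0 andbT -(hnorm0 (H := K)).
  have := GD (-1) _ _ _ _ h2 h1; rewrite !scaleN1r addNr => /G_le.
  by rewrite addrC.
have Gi x : G (i x) (i (S x)) by move=> e e0; exists x; rewrite !subrr hnorm0 ltW.
have /choice[f hf] xi : exists y, G xi y.
  pose F : set_system V := filter_from [set d : R | 0 < d]
    (fun d => [set x | hnorm (xi - i x) <= d]).
  have FF : ProperFilter F.
    apply: filter_from_proper => [|d d0]; last exact: i_dense.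
    apply: filter_from_filter; first by exists 1; exact: ltr01.
    move=> d1 d2 d10 d20; exists (Num.min d1 d2); first by rewrite /= lt_min d10.
    by move=> x /=; rewrite le_min => /andP.
  have [y ylim] : exists y : K, (i (S x)) @[x --> F] --> y.
    apply: cauchy_hnorm_cvg => e e0.
    exists [set x | hnorm (xi - i x) <= e / 2]; first by exists (e / 2); rewrite //= divr_gt0.
    move=> x z /= h1 h2; rewrite -iB -SB; apply: le_trans (S_contract _) _.
    rewrite iB; apply: le_trans (hnorm_triangle xi _ _) _.
    by rewrite (hnormBC (i x)); lra.
  exists y => e e0.
  have Fe : F [set x | hnorm (xi - i x) <= e] by exists e.
  have [x [h1 h2]] := filter_ex (filterI Fe (cvg_hnorm_lt ylim e0)).
  by exists x; split=> //; exact: ltW.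
exists f; split=> [a xi eta|xi|x]; last exact: GU (hf _) (Gi _).
  by apply: GU (hf _) _; apply: GD.
exact: G_le.
Qed.

End DenseExtension.

Section HilbertSemigroups.
Context {R : realType} {K : hilbertType R}.
Variable T : R -> K -> K.
Hypothesis cT : contraction_semigroup (@hnorm R K) T.
Implicit Types xi eta zeta : K.

Let lT t : 0 <= t -> linear (T t).
Proof. by move=> t0; have [[h _ _] _] := cT; have [] := h t t0. Qed.

Let T_le t xi : 0 <= t -> hnorm (T t xi) <= hnorm xi.
Proof. exact: cT.2. Qed.

Let TD s t xi : 0 <= s -> 0 <= t -> T (t + s) xi = T t (T s xi).
Proof. by move=> s0 t0; have [[_ h _] _] := cT; rewrite h. Qed.

Let T0 xi : T 0 xi = xi.
Proof. by have [[_ _ ->] _] := cT. Qed.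

Let TB t xi eta : 0 <= t -> T t (xi - eta) = T t xi - T t eta.
Proof.
by move=> t0; have := lT t0 (-1) eta xi; rewrite !scaleN1r ![- _ + _]addrC => ->.
Qed.

Definition right_continuous_at xi := forall e : R, 0 < e ->
  exists2 d : R, 0 < d & forall t, 0 <= t -> t <= d -> hnorm (T t xi - xi) <= e.

(** For a contraction [|T t xi - xi|^2 <= - 2 re <xi, T t xi - xi>], so weak continuity against [xi]
    itself is enough. *)
Lemma weak_right_continuous xi :
  (forall e : R, 0 < e -> exists2 d : R, 0 < d & forall t, 0 <= t -> t <= d ->
     cabs (inner xi (T t xi - xi)) <= e) -> right_continuous_at xi.
Proof.
move=> h e e0; have e2 : 0 < e ^+ 2 / 2 by rewrite divr_gt0// exprn_gt0.
have [d d0 hd] := h _ e2; exists d => // t t0 td.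
rewrite -ler_sqr ?nnegrE ?hnorm_ge0 ?(ltW e0)//.
have h1 := hd t t0 td.
have h2 : - re (inner xi (T t xi - xi)) <= cabs (inner xi (T t xi - xi)).
  by rewrite -reN -[leRHS]cabsN le_re_cabs.
have h3 : hnorm (T t xi) ^+ 2 <= hnorm xi ^+ 2.
  by rewrite ler_sqr ?nnegrE ?hnorm_ge0// T_le.
have -> : hnorm (T t xi - xi) ^+ 2 =
    hnorm (T t xi) ^+ 2 - hnorm xi ^+ 2 - 2 * re (inner xi (T t xi - xi)).
  by rewrite !hnorm_sqr !innerBr !innerBl (inner_conj xi (T t xi)) !reB reJ; ring.
by lra.
Qed.

Lemma dense_right_continuous (V : Type) (i : V -> K) :
  (forall xi (e : R), 0 < e -> exists x, hnorm (xi - i x) <= e) ->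
  (forall x, right_continuous_at (i x)) -> forall xi, right_continuous_at xi.
Proof.
move=> idense hi xi e e0; have e3 : 0 < e / 3 by rewrite divr_gt0.
have [x hx] := idense xi _ e3; have [d d0 hd] := hi x _ e3.
exists d => // t t0 td; have h1 := hd t t0 td.
have -> : T t xi - xi = T t (xi - i x) - (xi - i x) + (T t (i x) - i x).
  by rewrite TB// opprB addrAC !addrA !subrK.
apply: le_trans (Defs.hnormD _ _) _.
have := hnormB (T t (xi - i x)) (xi - i x); have := T_le (xi - i x) t0.
by lra.
Qed.

Hypothesis rcT : forall xi, right_continuous_at xi.

(** [T s - T t = T t (T (s - t) - 1)] for [t <= s]; continuity at all times thus reduces to right
    continuity at zero. *)
Lemma contraction_semigroup_close xi s t : 0 <= s -> 0 <= t ->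
  hnorm (T s xi - T t xi) <= hnorm (T `|s - t| xi - xi).
Proof.
move=> s0 t0; wlog st : s t s0 t0 / t <= s.
  by move=> h; have [/h->//|/ltW ts] := leP t s; rewrite hnormBC distrC h.
have E : s = t + (s - t) by rewrite addrC subrK.
rewrite ger0_norm ?subr_ge0// {1}E TD ?subr_ge0// -TB//.
exact: T_le.
Qed.

Lemma right_continuous_strongly : strongly_continuous (@hnorm R K) T.
Proof.
move=> xi t t0; apply/cvgrPdist_le => e e0.
have [d d0 hd] := rcT xi e0.
rewrite near_withinE; near=> s => s0.
rewrite sub0r normrN ger0_norm ?hnorm_ge0//.
have {}s0 : 0 <= s by move: s0; rewrite /= in_itv /= andbT.
apply: le_trans (contraction_semigroup_close _ s0 t0) (hd _ (normr_ge0 _) _).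
rewrite distrC; near: s.
by exists d => // s /=; exact: ltW.
Unshelve. all: by end_near. Qed.

Lemma strong_gen_graphP xi zeta : strong_gen_graph (@hnorm R K) T xi zeta <->
  (forall e : R, 0 < e -> exists2 d : R, 0 < d &
    forall t, 0 < t -> t < d -> hnorm (diff_quot T xi t - zeta) <= e).
Proof.
rewrite /strong_gen_graph; split=> [/cvgrPdist_le h e e0|h].
  have [d d0 hd] := h e e0; exists d => // t t0 td.
  have := hd t; rewrite /= sub0r normrN gtr0_norm// => /(_ td t0).
  by rewrite sub0r normrN ger0_norm ?hnorm_ge0.
apply/cvgrPdist_le => e e0; have [d d0 hd] := h e e0.
exists d => // t /=; rewrite sub0r normrN => td t0.
rewrite sub0r normrN ger0_norm ?hnorm_ge0//; apply: hd => //.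
by rewrite gtr0_norm in td.
Qed.

Lemma strong_gen_graph_unique xi zeta zeta' :
  strong_gen_graph (@hnorm R K) T xi zeta -> strong_gen_graph (@hnorm R K) T xi zeta' ->
  zeta = zeta'.
Proof.
move=> /strong_gen_graphP h1 /strong_gen_graphP h2.
apply/eqP; rewrite -subr_eq0 -hnorm_eq0; apply/eqP/le_anti; rewrite hnorm_ge0 andbT.
apply/ler_addgt0Pr => e e0; rewrite add0r; have e2 := divr_gt0 e0 (ltr0n R 2).
have [d1 d10 hd1] := h1 _ e2; have [d2 d20 hd2] := h2 _ e2.
pose t := Num.min d1 d2 / 2.
have t0 : 0 < t by rewrite divr_gt0// lt_min d10.
have tm : t < Num.min d1 d2 by rewrite /t; have : 0 < Num.min d1 d2 by [rewrite lt_min d10]; lra.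
have /andP[td1 td2] : (t < d1) && (t < d2) by rewrite -lt_min.
apply: le_trans (hnorm_triangle (diff_quot T xi t) _ _) _.
by have := hd1 t t0 td1; have := hd2 t t0 td2; rewrite (hnormBC zeta); lra.
Qed.

Lemma strong_genE xi zeta : strong_gen_graph (@hnorm R K) T xi zeta ->
  strong_gen (@hnorm R K) T xi = zeta.
Proof.
move=> h; rewrite /strong_gen; case: xgetP => [z _ hz|/(_ zeta)//].
exact: strong_gen_graph_unique hz h.
Qed.

End HilbertSemigroups.

(** The set of [s] with [g s <= g 0] contains its supremum by continuity, and the local decrease to
    the right forbids a supremum before [t]. *)
Lemma right_nonincreasing (R : realType) (g : R -> R) (t : R) : 0 <= t ->
  (forall s e : R, 0 <= s -> s <= t -> 0 < e -> exists2 d : R, 0 < d &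
     forall s', 0 <= s' -> s' <= t -> `|s' - s| < d -> `|g s' - g s| < e) ->
  (forall s : R, 0 <= s -> s < t -> exists2 d : R, 0 < d &
     forall k, 0 < k -> k < d -> g (s + k) <= g s) ->
  g t <= g 0.
Proof.
move=> t0 cg dg; pose S := [set s | [/\ 0 <= s, s <= t & g s <= g 0]].
have S0 : S 0 by split.
have supS : has_sup S by split; [exists 0|exists t => s []].
have s0 : 0 <= sup S by exact: sup_upper_bound.
have st : sup S <= t by apply: ge_sup; [exists 0|move=> s []].
have gs : g (sup S) <= g 0.
  rewrite leNgt; apply/negP => h; have e0 : 0 < g (sup S) - g 0 by rewrite subr_gt0.
  have [d d0 hd] := cg _ _ s0 st e0.
  have [s [s1 s2 gs0] sd] := sup_adherent d0 supS.
  have sS : s <= sup S by exact: sup_upper_bound.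
  have := hd s s1 s2; rewrite ler0_norm ?subr_le0//.
  by move=> /(_ ltac:(lra)); rewrite ltr_norml => /andP[]; lra.
have [<-//|] := eqVneq (sup S) t => ne.
have lt_t : sup S < t by rewrite lt_def eq_sym ne.
have [d d0 hd] := dg _ s0 lt_t.
pose k := Num.min d (t - sup S) / 2.
have m0 : 0 < Num.min d (t - sup S) by rewrite lt_min d0 subr_gt0.
have k0 : 0 < k by rewrite divr_gt0.
have : k < Num.min d (t - sup S) by rewrite /k; lra.
rewrite lt_min => /andP[kd kt].
have : S (sup S + k) by split; [lra|lra|exact: le_trans (hd k k0 kd) gs].
by move=> /(sup_upper_bound supS); lra.
Qed.

(** * From weak to strong derivatives at zero *)

Section WeakGenerator.
Context {R : realType} {K : hilbertType R}.
Variable T : R -> K -> K.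
Hypothesis cT : contraction_semigroup (@hnorm R K) T.
Hypothesis rcT : forall xi, right_continuous_at T xi.
Implicit Types xi eta zeta : K.

Lemma contraction_bop t : 0 <= t -> exists x : bop K, forall xi, x xi = T t xi.
Proof.
move=> t0; have [[h _ _] _] := cT; have [lT _] := h t t0.
by apply: (bop_exists lT (M := 1)) => xi; rewrite mul1r; exact: cT.2.
Qed.

(* The right derivative of [s |-> <eta, T s xi - xi - s zeta>] is
   [<eta, T s zeta - zeta>], which is small for small [s]. *)
Lemma weak_gen_strong xi zeta :
  (forall eta (e : R), 0 < e -> exists2 d : R, 0 < d & forall t, 0 < t -> t < d ->
     cabs (inner eta (diff_quot T xi t - zeta)) <= e) ->
  strong_gen_graph (@hnorm R K) T xi zeta.
Proof.
move=> weak; apply/strong_gen_graphP => // e e0.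
have [d d0 hd] := rcT zeta e0; exists d => // t t0 td.
suff main : hnorm (T t xi - xi - t%:C *: zeta) <= t * e.
  have -> : diff_quot T xi t - zeta = (t^-1)%:C *: (T t xi - xi - t%:C *: zeta).
    by rewrite [RHS]scalerBr scalerA -rmorphM mulVf ?gt_eqF// scale1r.
  rewrite hnorm_scale cabsR ger0_norm ?invr_ge0 ?(ltW t0)//.
  by rewrite ler_pdivrMl.
set eta := T t xi - xi - _.
(* The error [eta] is tested against itself; [e'] absorbs the weak error at each time and is removed
   at the end. *)
have key (e' : R) : 0 < e' -> hnorm eta ^+ 2 <= (hnorm eta * e + e') * t.
  move=> e'0; set c := hnorm eta * e + e'.
  pose g s := re (inner eta (T s xi - xi - s%:C *: zeta)) - c * s.
  have c0 : 0 < c by rewrite ltr_wpDl// mulr_ge0 ?hnorm_ge0 ?ltW.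
  have gB s s' : g s' - g s =
      re (inner eta (T s' xi - T s xi)) - (s' - s) * (re (inner eta zeta) + c).
    rewrite /g !innerBr !innerZr !reB !reZ; ring.
  suff : g t <= g 0.
    rewrite /g -/eta hnorm_sqr; have [[_ _ ->] _] := cT.
    by rewrite subrr scale0r subr0 inner0r mulr0 subr0; rewrite /= subr_le0.
  apply: right_nonincreasing (ltW t0) _ _ => [s e1 s0 st e10|s s0 st].
    have n0 : 0 < hnorm eta + 1 by have := hnorm_ge0 eta; lra.
    have [d1 d10 hd1] := rcT xi (divr_gt0 e10 (mulr_gt0 n0 (ltr0n R 2))).
    pose k := `|re (inner eta zeta) + c| + 1.
    have k0 : 0 < k by rewrite ltr_wpDl.
    exists (Num.min d1 (e1 / (k * 2))) => [|s' s'0 s't].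
      by rewrite lt_min d10 divr_gt0// mulr_gt0.
    rewrite lt_min => /andP[sd1 sd2].
    have h1 := le_trans (contraction_semigroup_close cT _ s'0 s0) (hd1 _ (normr_ge0 _) (ltW sd1)).
    rewrite gB; apply: le_lt_trans (ler_normB _ _) _.
    have h2 : `|re (inner eta (T s' xi - T s xi))| <= hnorm eta * hnorm (T s' xi - T s xi).
      rewrite ler_norml re_inner_le andbT lerNl -reN -innerNl.
      by apply: le_trans (re_inner_le _ _) _; rewrite hnormN.
    have h3 : hnorm eta * hnorm (T s' xi - T s xi) <= e1 / 2.
      apply: le_trans (ler_wpM2l (hnorm_ge0 _) h1) _.
      rewrite ler_pdivlMr// -mulrA.
      have -> : e1 / ((hnorm eta + 1) * 2) * 2 = e1 / (hnorm eta + 1) by field; rewrite gt_eqF.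
      by rewrite mulrCA ler_piMr ?(ltW e10)// ler_pdivrMr// mul1r; lra.
    have h4 : `|(s' - s) * (re (inner eta zeta) + c)| < e1 / 2.
      rewrite normrM; move: sd2; rewrite ltr_pdivlMr ?mulr_gt0// => sd2.
      have : `|s' - s| * `|re (inner eta zeta) + c| <= `|s' - s| * k.
        by rewrite ler_wpM2l// /k; lra.
      lra.
    lra.
  have [Ts TsE] := contraction_bop s0.
  (* The increment at time [s] is [k] times [T s] of the difference quotient at zero; moving [T s]
     to the other side of the inner product makes it an instance of the weak hypothesis. *)
  have [d1 d10 hd1] := weak (adj Ts eta) _ e'0.
  exists d1 => // k k0 kd1.
  rewrite -subr_le0 gB.
  have -> : s + k - s = k by rewrite addrC addKr.
  have TE : T (s + k) xi - T s xi = k%:C *: Ts (diff_quot T xi k).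
    have [[_ TD _] _] := cT.
    rewrite /diff_quot bopZ scalerA -rmorphM mulfV ?gt_eqF// scale1r bopB !TsE.
    by rewrite TD// ltW.
  rewrite TE innerZr reZ -mulrBr.
  rewrite pmulr_rle0// subr_le0.
  have E1 : inner eta (Ts (diff_quot T xi k)) =
    inner (adj Ts eta) (diff_quot T xi k - zeta) + inner eta (Ts zeta - zeta) + inner eta zeta.
    by rewrite -adjP bopB !innerBr; ring.
  rewrite E1 !reD.
  have h1 := le_trans (le_re_cabs _) (hd1 k k0 kd1).
  have h2 : re (inner eta (Ts zeta - zeta)) <= hnorm eta * e.
    apply: le_trans (re_inner_le _ _) _; rewrite ler_wpM2l ?hnorm_ge0// TsE.
    by apply: hd => //; lra.
  by rewrite /c; lra.
have h : hnorm eta ^+ 2 <= hnorm eta * (t * e).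
  apply/ler_addgt0Pr => e' e'0.
  have := key _ (divr_gt0 e'0 t0); rewrite mulrDl divfK ?gt_eqF//.
  by rewrite -mulrA [e * t]mulrC.
have [->|en0] := eqVneq (hnorm eta) 0; first by rewrite mulr_ge0// ltW.
by move: h; rewrite expr2 ler_pM2l// lt_def en0 hnorm_ge0.
Qed.

End WeakGenerator.

(** * The uniform boundedness principle *)

Section UniformBoundedness.
Context {R : realType} {H : hilbertType R}.
Implicit Types u v : H.
Variable p : nat -> H -> R.
Hypothesis pD : forall n u v, p n (u + v) <= p n u + p n v.
Hypothesis pZ : forall n (a : R[i]) u, p n (a *: u) = cabs a * p n u.
Hypothesis p_bounded : forall n, exists M : R, forall u, p n u <= M * hnorm u.
Hypothesis p_pointwise : forall u, exists C : R, forall n, p n u <= C.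

Let pN n u : p n (- u) = p n u.
Proof. by rewrite -scaleN1r pZ cabsN /cabs normr1 mul1r. Qed.

Let p0 n : p n 0 = 0.
Proof. by rewrite -(scale0r 0) pZ cabs0 mul0r. Qed.

Let p_ge0 n u : 0 <= p n u.
Proof. by have := pD n u (- u); rewrite subrr p0 pN; lra. Qed.

Let pB n u v : p n u - p n v <= p n (u - v).
Proof. by rewrite lerBlDr; apply: le_trans (pD n _ _); rewrite subrK. Qed.

(** Baire's argument with nested balls: some [p n] is at least [k] on the ball chosen in step [k],
    and a common point contradicts pointwise boundedness. Seminorms cover both the moduli of
    antilinear functionals and the norms of operator values. *)
Lemma uniform_boundedness : exists2 M : R, 0 <= M & forall n u, p n u <= M * hnorm u.
Proof.
apply: contrapT => nub.
(* A bound [C] on a ball of radius [r] would give the global constant [2 C / r], by translation to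
   the origin. *)
have large (x : H) (r C : R) : 0 < r -> exists y n, hnorm (y - x) <= r /\ C < p n y.
  move=> r0; apply: contrapT => h; apply: nub.
  have C0 : 0 <= C.
    rewrite leNgt; apply/negP => C0; apply: h; exists x, 0%N.
    by rewrite subrr hnorm0 (ltW r0); split=> //; apply: lt_le_trans C0 (p_ge0 _ _).
  have le_C y n : hnorm (y - x) <= r -> p n y <= C.
    by move=> yr; rewrite leNgt; apply/negP => Cy; apply: h; exists y, n.
  exists (2 * C / r) => [|n u]; first by rewrite divr_ge0 ?mulr_ge0 ?(ltW r0).
  have [->|un0] := eqVneq u 0; first by rewrite p0 hnorm0 mulr0.
  have u0 : 0 < hnorm u by rewrite lt_def hnorm_eq0 un0 hnorm_ge0.
  pose v := (r / hnorm u)%:C *: u.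
  have vr : hnorm v = r.
    by rewrite hnorm_scale cabsR ger0_norm ?divr_ge0 ?ltW// divfK ?gt_eqF.
  have h1 : p n v <= 2 * C.
    have hv := pD n (v + x) (- x); rewrite addrK pN in hv.
    have := le_C (v + x) n; rewrite addrK vr lexx => /(_ isT).
    by have := le_C x n; rewrite subrr hnorm0 (ltW r0) => /(_ isT); lra.
  move: h1; rewrite pZ cabsR ger0_norm ?divr_ge0 ?(ltW r0) ?(ltW u0)//.
  move=> h1; have -> : p n u = r / hnorm u * p n u * (hnorm u / r) by field; rewrite !gt_eqF.
  have -> : 2 * C / r * hnorm u = 2 * C * (hnorm u / r) by ring.
  by rewrite ler_wpM2r// divr_ge0 ?(ltW r0) ?(ltW u0).
have step (k : nat) (b : H * {posnum R}) : exists b' : H * {posnum R},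
    [/\ b'.2%:num <= b.2%:num / 2, hnorm (b'.1 - b.1) <= b.2%:num / 2 &
    exists n, forall y, hnorm (y - b'.1) <= b'.2%:num -> k%:R <= p n y].
  case: b => x r; have [y [n [yx hn]]] := @large x (r%:num / 2) k%:R ltac:(by []).
  have [M hM] := p_bounded n.
  pose d := p n y - k%:R; have d0 : 0 < d by rewrite subr_gt0.
  have M0 : 0 < `|M| + 1 by rewrite ltr_wpDl.
  (* Within the excess of [p n y] over [k], divided by a Lipschitz constant of [p n], the value
     stays at least [k]. *)
  have r'0 : 0 < Num.min (r%:num / 2) (d / (`|M| + 1)) by rewrite lt_min !divr_gt0.
  exists (y, PosNum r'0); split=> //=; first by rewrite ge_min lexx.
  exists n => z; rewrite le_min => /andP[_]; rewrite ler_pdivlMr// => hz.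
  have h1 := pB n y z; rewrite -[p n (y - z)]pN opprB in h1.
  have h2 := hM (z - y).
  have h3 : M * hnorm (z - y) <= `|M| * hnorm (z - y).
    by rewrite ler_wpM2r ?hnorm_ge0// ler_norm.
  by have := hnorm_ge0 (z - y); rewrite /d in hz; lra.
have [f hf] := choice (fun kb : nat * (H * {posnum R}) => step kb.1 kb.2).
pose b := fix b k := if k is k'.+1 then f (k', b k') else (0 : H, PosNum (@ltr01 R)).
have bS k : b k.+1 = f (k, b k) by [].
have rad k : (b k).2%:num <= 2^-1 ^+ k.
  elim: k => [|k IH]; first by rewrite expr0.
  have [h _ _] := hf (k, b k); rewrite bS; apply: le_trans h _ => /=.
  by rewrite exprSr ler_wpM2r.
(* The factor [1 - 2^-j] keeps room for the remaining steps, so every later centre lies in the ball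
   of index [k]. *)
have nest k j : hnorm ((b (k + j)%N).1 - (b k).1) <= (b k).2%:num * (1 - 2^-1 ^+ j) /\
    (b (k + j)%N).2%:num <= (b k).2%:num * 2^-1 ^+ j.
  elim: j => [|j [IH1 IH2]]; first by rewrite addn0 subrr hnorm0 expr0 subrr mulr0 mulr1.
  rewrite addnS bS; have [h1 h2 _] := hf ((k + j)%N, b (k + j)%N).
  rewrite /= in h1 h2; split.
    apply: le_trans (hnorm_triangle (b (k + j)%N).1 _ _) _.
    by rewrite exprSr; lra.
  by apply: le_trans h1 _; rewrite exprSr; lra.
have half0 j : 0 <= 2^-1 ^+ j :> R by rewrite exprn_ge0.
have [x xlim] : exists x : H, (b k).1 @[k --> \oo] --> x.
  apply: cauchy_hnorm_cvg => e e0.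
  have e2 : 0 < e / 2 by rewrite divr_gt0.
  have /cvgrPdist_lt /(_ _ e2) [N _ hN] : (2^-1 ^+ k : R) @[k --> \oo] --> 0.
    by apply: cvg_expr; rewrite gtr0_norm ?invr_gt0// invf_lt1// ltr1n.
  exists [set k | (N <= k)%N]; first by exists N.
  have h k : (N <= k)%N -> hnorm ((b k).1 - (b N).1) <= e / 2.
    move=> /subnKC <-; apply: le_trans (nest _ _).1 _.
    have := hN N (leqnn N); rewrite /= sub0r normrN ger0_norm// => h1.
    apply: le_trans (ltW h1); apply: le_trans (rad N).
    by rewrite ler_piMr// gerBl.
  move=> k j /= Nk Nj; apply: le_trans (hnorm_triangle (b N).1 _ _) _.
  by have := h k Nk; have := h j Nj; rewrite (hnormBC (b N).1); lra.
have xin k : hnorm (x - (b k).1) <= (b k).2%:num.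
  apply/ler_addgt0Pr => e e0.
  have [j [/= h1 kj]] := filter_ex (filterI (cvg_hnorm_lt xlim e0) (nbhs_infty_ge k)).
  apply: le_trans (hnorm_triangle (b j).1 _ _) _.
  rewrite addrC; apply: lerD; last exact: ltW.
  rewrite -(subnKC kj); apply: le_trans (nest _ _).1 _.
  by rewrite ler_piMr// gerBl.
have [C hC] := p_pointwise x.
have C0 : 0 <= C := le_trans (p_ge0 0%N x) (hC 0%N).
pose k := (Num.truncn C).+1.
have [_ _ [n hn]] := hf (k, b k).
have := hn x; rewrite -bS => /(_ (xin k.+1)) /= h1.
have := le_trans h1 (hC n).
by rewrite leNgt truncnS_gt.
Qed.

End UniformBoundedness.

(** * Positive roots and operators of rank one *)

Section Diagonal.
Context {R : realType} {H : hilbertType R}.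
Variables (I : choiceType) (h : I -> H).
Hypothesis hb : orthonormal_basis h.

(** Riesz-Fischer provides the vector with coefficients [m i <h i, u>]; the quadratic form is then a
    sum of nonnegative terms. *)
Lemma diagonal_exists (m : I -> R) (M : R) : (forall i, 0 <= m i) -> (forall i, m i <= M) ->
  exists2 x : bop H, positive x & forall i, x (h i) = (m i)%:C *: h i.
Proof.
move=> m0 mM; have M_sqr i : m i ^+ 2 <= M ^+ 2.
  by rewrite ler_sqr ?nnegrE// (le_trans (m0 i)).
have bnd u (A : {fset I}) :
    \sum_(i <- A) cabs ((m i)%:C * inner (h i) u) ^+ 2 <= M ^+ 2 * hnorm u ^+ 2.
  apply: (@le_trans _ _ (\sum_(i <- A) M ^+ 2 * cabs (inner (h i) u) ^+ 2)).
    apply: ler_sum => i _; rewrite cabsM exprMn cabsR ger0_norm//.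
    by rewrite ler_wpM2r ?sqr_ge0.
  by rewrite -mulr_sumr ler_wpM2l ?sqr_ge0// (bessel hb.1).
have /choice[f hf] u : exists v, (forall i, inner (h i) v = (m i)%:C * inner (h i) u) /\
    hnorm v <= `|M| * hnorm u.
  have [v hv vlim] := riesz_fischer hb.1 (bnd u); exists v; split=> //.
  rewrite -ler_sqr ?nnegrE ?mulr_ge0 ?hnorm_ge0//.
  rewrite -lee_fin -(hsum_esum hb.1 vlim); apply: esum_le_fset => A.
  by rewrite lee_fin exprMn real_normK ?num_real.
have lf : linear f.
  move=> a u v; apply: (basis_inner_eqP hb) => i.
  by rewrite innerDr innerZr !(hf _).1 innerDr innerZr; ring.
have [x xE] := bop_exists lf (fun u => (hf u).2).
exists x => [u|i]; last first.
  apply: (basis_inner_eqP hb) => j.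
  rewrite xE (hf _).1 innerZr hb.1; case: eqVneq => [->//|_]; by rewrite !mulr0.
have c := inner_csum u (x u) hb.
have {}c : csum (fun i => (m i * cabs (inner (h i) u) ^+ 2)%:C) (inner u (x u)).
  apply: eq_csum c => i; rewrite xE (hf u).1 rmorphM /= cabs_sqr (inner_conj (h i)).
  by ring.
have t0 i : 0 <= m i * cabs (inner (h i) u) ^+ 2 by rewrite mulr_ge0 ?sqr_ge0.
have fin := csum_esum t0 c.
rewrite (csum_unique c (esum_csum t0 (esym (fineK _)))).
  by rewrite lecR fine_ge0// esum_ge0// => i _; rewrite lee_fin.
by rewrite ge0_fin_numE// esum_ge0// => i _; rewrite lee_fin.
Qed.

End Diagonal.

Section PositiveRoots.
Context {R : realType} {H : hilbertType R}.
Implicit Types (x y : bop H) (u v : H).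

Lemma bop_expr2E x u : (x ^+ 2) u = x (x u).
Proof. by rewrite expr2. Qed.

Lemma bop_expr4E x u : (x ^+ 4) u = x (x (x (x u))).
Proof. by rewrite (exprM x 2 2) !bop_expr2E. Qed.

Lemma positive_root4_eigen y (l : R) u : positive y -> 0 <= l ->
  (y ^+ 4) u = l%:C *: u -> y u = (Num.sqrt (Num.sqrt l))%:C *: u.
Proof.
move=> py l0 yu.
apply: positive_sqr_eigen; rewrite ?sqrtr_ge0// sqr_sqrtr ?sqrtr_ge0//.
have py2 : positive (y * y) by rewrite -{1}(positive_selfadj py); exact: positive_adjM.
by apply: (positive_sqr_eigen (y := y * y)); rewrite ?sqrtr_ge0// sqr_sqrtr.
Qed.

Lemma pos_root_spec n x : (exists y, positive y /\ y ^+ n = x) ->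
  positive (pos_root n x) /\ pos_root n x ^+ n = x.
Proof. by move=> [y hy]; rewrite /pos_root; case: xgetP => [z _ //|/(_ y)/(_ hy)]. Qed.

(** [abs_op] is some positive root [z] of [|u|^2 |v><v|]. From [|z w| = |u| |<v, w>|] it vanishes on
    the complement of [v], and its value at [v] is that of an eigenvector; Parseval then sums its
    diagonal. *)
Lemma trace_class_rank1 u v : trace_class (rank1 u v).
Proof.
rewrite /trace_class /abs_op; set z := pos_root _ _.
have cE : adj (rank1 u v) * rank1 u v = (hnorm u ^+ 2)%:C *: rank1 v v.
  by rewrite adj_rank1 mul_rank1 rank1E inner_hnorm rank1Zl.
have ex : exists y, positive y /\ y ^+ 2 = adj (rank1 u v) * rank1 u v.
  (* For [v = 0] the quotient is [0] by convention, and so is the operator. *)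
  exists ((hnorm u / hnorm v)%:C *: rank1 v v); split.
    move=> w; rewrite bopZE innerZr mulr_ge0 ?positive_rank1//.
    by rewrite lecR divr_ge0 ?hnorm_ge0.
  rewrite cE; apply: bop_ext => w.
  rewrite bop_expr2E !bopZE bopZ !rank1E innerZr inner_hnorm.
  have [->|v0] := eqVneq v 0; first by rewrite !scaler0.
  rewrite !scalerA; congr (_ *: _).
  have vn0 : hnorm v != 0 by rewrite hnorm_eq0.
  have -> : (hnorm u ^+ 2)%:C =
      (hnorm u / hnorm v)%:C * (hnorm u / hnorm v)%:C * (hnorm v ^+ 2)%:C.
    by rewrite -!rmorphM; congr (_%:C); field.
  by ring.
have [pz z2] := pos_root_spec ex; rewrite -/z in pz z2.
have zz w : hnorm (z w) ^+ 2 = hnorm u ^+ 2 * cabs (inner v w) ^+ 2.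
  rewrite hnorm_sqr -[in X in inner X _](positive_selfadj pz) -adjP -bop_expr2E z2 cE.
  rewrite bopZE innerZr reZ rank1E innerZr (inner_conj v w) -cabs_sqr /=.
  by [].
have zE w : re (inner w (z w)) = hnorm u / hnorm v * cabs (inner w v) ^+ 2.
  have [v0|v0] := eqVneq v 0.
    have -> : z w = 0.
      by apply/eqP; rewrite -hnorm_eq0 -sqrf_eq0 zz v0 inner0l cabs0 expr0n mulr0.
    by rewrite v0 !inner0r cabs0 expr0n mulr0.
  have vn0 : hnorm v != 0 by rewrite hnorm_eq0.
  have zv : z v = (hnorm u * hnorm v)%:C *: v.
    apply: positive_sqr_eigen => //; first by rewrite mulr_ge0 ?hnorm_ge0.
    rewrite -bop_expr2E z2 cE bopZE rank1E inner_hnorm scalerA -rmorphM.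
    by rewrite exprMn.
  (* The coefficient of the projection of [w] onto [v]. *)
  pose c := inner v w * ((hnorm v ^+ 2)^-1)%:C.
  have zw : z (w - c *: v) = 0.
    apply/eqP; rewrite -hnorm_eq0 -sqrf_eq0 zz innerBr innerZr inner_hnorm.
    have -> : c * (hnorm v ^+ 2)%:C = inner v w.
      by rewrite /c -[LHS]mulrA -rmorphM mulVf ?sqrf_eq0// mulr1.
    by rewrite subrr cabs0 expr0n mulr0.
  have -> : z w = c *: z v by apply/eqP; rewrite -subr_eq0 -bopZ -bopB zw.
  rewrite zv scalerA innerZr /c.
  have -> : inner v w * ((hnorm v ^+ 2)^-1)%:C * (hnorm u * hnorm v)%:C * inner w v =
    ((hnorm v ^+ 2)^-1 * (hnorm u * hnorm v))%:C * (inner w v * inner v w).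
    by rewrite [in RHS]rmorphM /=; ring.
  rewrite reZ (inner_conj w v) -cabs_sqr /=; congr (_ * _); by field.
have k0 : 0 <= hnorm u / hnorm v by rewrite divr_ge0 ?hnorm_ge0.
apply: (@le_lt_trans _ _ (\esum_(e in [set: onb H])
    (hnorm u / hnorm v * cabs (inner (\val e) v) ^+ 2)%:E)).
  apply: le_esum => e _ /=; rewrite zE ger0_norm// mulr_ge0 ?sqr_ge0//.
apply: le_lt_trans (esum_EFin_cst k0 _) _; first by move=> e; exact: sqr_ge0.
have -> := parseval onb_basis v.
by rewrite -EFinM ltry.
Qed.

Lemma trace_rank1_mul u v x : trace (rank1 u v * x) = inner v (x u).
Proof. by rewrite rank1_mul trace_rank1 -adjP. Qed.

End PositiveRoots.
Lemma ler_frac_mul (R : realFieldType) (e b : R) : 0 <= e -> 0 <= b ->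
  e / (2 * (b + 1)) * b <= e / 2.
Proof.
move=> e0 b0; have b1 : 0 < b + 1 by lra.
have -> : e / (2 * (b + 1)) * b = e / 2 * (b / (b + 1)) by field; rewrite gt_eqF.
by rewrite ler_piMr ?divr_ge0// ler_pdivrMr// mul1r; lra.
Qed.

Lemma ler_half_third (R : realFieldType) (e : R) : 0 < e -> e / 2 + e / 3 <= e.
Proof. by move=> e0; lra. Qed.

(** * Functions vanishing as time decreases to zero *)

Section Vanishing.
Context {R : realType}.
Implicit Types f g : R -> R[i].

Definition vanishes0 f := forall e : R, 0 < e ->
  exists2 d : R, 0 < d & forall t, 0 < t -> t < d -> cabs (f t) <= e.

Lemma vanishes0D f g : vanishes0 f -> vanishes0 g -> vanishes0 (fun t => f t + g t).
Proof.
move=> vf vg e e0; have e2 : 0 < e / 2 by rewrite divr_gt0.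
have [a a0 ha] := vf _ e2; have [b b0 hb] := vg _ e2.
exists (Num.min a b) => [|t t0]; first by rewrite lt_min a0.
rewrite lt_min => /andP[ta tb]; apply: le_trans (cabsD _ _) _.
by have := ha t t0 ta; have := hb t t0 tb; lra.
Qed.

Lemma vanishes0Z (a : R[i]) f : vanishes0 f -> vanishes0 (fun t => a * f t).
Proof.
move=> vf e e0; have a1 : 0 < cabs a + 1 by have := cabs_ge0 a; lra.
have [d d0 hd] := vf _ (divr_gt0 e0 a1); exists d => // t t0 td.
have := hd t t0 td; rewrite ler_pdivlMr// cabsM.
by have := cabs_ge0 (f t); lra.
Qed.

Lemma vanishes0_sum (K : Type) (s : seq K) (f : K -> R -> R[i]) :
  (forall k, vanishes0 (f k)) -> vanishes0 (fun t => \sum_(k <- s) f k t).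
Proof.
move=> vf; elim: s => [|k s IH].
  by move=> e e0; exists 1 => // t _ _; rewrite big_nil cabs0 ltW.
by under eq_fun do rewrite big_cons; exact: vanishes0D.
Qed.

Lemma cvg_vanishes0 f (l : R[i]) :
  (f t : R[i]^o) @[t --> 0^'+] --> (l : R[i]^o) -> vanishes0 (fun t => f t - l).
Proof.
move=> /cvg_cabsP h e e0; have [d d0 hd] := h e e0; exists d => // t t0 td.
rewrite -cabsN opprB; apply/ltW/hd => //=.
by rewrite sub0r normrN gtr0_norm.
Qed.

Lemma vanishes0_cvg f (l : R[i]) :
  vanishes0 (fun t => f t - l) -> (f t : R[i]^o) @[t --> 0^'+] --> (l : R[i]^o).
Proof.
move=> vf; apply/cvg_cabsP => e e0.
have [d d0 hd] := vf _ (divr_gt0 e0 (ltr0n R 2)); exists d => // t /=.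
rewrite sub0r normrN => td t0; rewrite gtr0_norm// in td.
by rewrite -cabsN opprB; apply: le_lt_trans (hd t t0 td) _; lra.
Qed.

End Vanishing.

(** * The symmetric embedding into S2 *)

Section SymmetricEmbedding.
Context {R : realType} {H : hilbertType R} (rho : bop H).
Variables (I : choiceType) (h : I -> H) (l : I -> R).
Hypothesis rho_pos : positive rho.
Hypothesis hb : orthonormal_basis h.
Hypothesis l_gt0 : forall i, 0 < l i.
Hypothesis rho_h : forall i, rho (h i) = (l i)%:C *: h i.
Hypothesis rho_trace :
  (\esum_(e in [set: onb H]) (re (inner (\val e) (rho (\val e))))%:E < +oo)%E.
Implicit Types (x y : bop H) (u v : H).

(** Eigenvalues: [nu] of [s = rho^(1/2)], [mu] of [r = rho^(1/4)]. *)
Let nu i := Num.sqrt (l i).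
Let mu i := Num.sqrt (nu i).
Let r := pos_root 4 rho.
Let s := r * r.

(** The eigenvalues of a bounded operator are bounded, so the diagonal operator of their fourth
    roots exists; its fourth power agrees with [rho] on the basis. *)
Lemma root4_spec : positive r /\ r ^+ 4 = rho.
Proof.
apply: pos_root_spec.
have [M M0 hM] := bop_bounded rho.
have l_le i : l i <= M.
  have := hM (h i); rewrite rho_h hnorm_scale cabsR (hnorm_orthonormal hb.1) !mulr1.
  by rewrite gtr0_norm.
have [|i|y py yh] := diagonal_exists hb (m := mu) (M := Num.sqrt (Num.sqrt M)).
- by move=> i; exact: sqrtr_ge0.
- by apply/ler_wsqrtr/ler_wsqrtr.
exists y; split=> //; apply: (basis_bop_ext hb) => i.
rewrite bop_expr4E !(yh, bopZ) rho_h !scalerA -!rmorphM; congr (_%:C *: _).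
transitivity ((mu i ^+ 2) ^+ 2); first by ring.
by rewrite !sqr_sqrtr ?sqrtr_ge0// ltW.
Qed.

Let r_pos : positive r := root4_spec.1.
Let r4 : r ^+ 4 = rho := root4_spec.2.

Let nu_gt0 i : 0 < nu i. Proof. by rewrite sqrtr_gt0. Qed.
Let mu_gt0 i : 0 < mu i. Proof. by rewrite sqrtr_gt0. Qed.
Let nu_sqr i : nu i ^+ 2 = l i. Proof. by rewrite sqr_sqrtr// ltW. Qed.
Let mu_sqr i : mu i ^+ 2 = nu i. Proof. by rewrite sqr_sqrtr// ltW. Qed.

Let adj_r : adj r = r. Proof. exact: positive_selfadj. Qed.
Let adj_s : adj s = s. Proof. by rewrite adjM adj_r. Qed.
Let s2 : s * s = rho. Proof. by rewrite -r4 (exprM r 2 2) !expr2. Qed.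

Let r_h i : r (h i) = (mu i)%:C *: h i.
Proof. by apply: positive_root4_eigen => //; [exact: ltW|rewrite r4]. Qed.

Let s_h i : s (h i) = (nu i)%:C *: h i.
Proof. by rewrite bopME r_h bopZ r_h scalerA -rmorphM -expr2 mu_sqr. Qed.

Let r_move u v : inner u (r v) = inner (r u) v. Proof. by rewrite adjP adj_r. Qed.
Let s_move u v : inner u (s v) = inner (s u) v. Proof. by rewrite adjP adj_s. Qed.

Let s_hs : s \in @hs_pred R H.
Proof.
apply/hs_predP; apply: le_lt_trans rho_trace; apply: le_esum => e _.
by rewrite lee_fin hnorm_sqr -s_move -s2 bopME.
Qed.

(** [|x s|^2 = omega (adj x * x)] and [|s x|^2 = omega (x * adj x)]: the one-sided embeddings
    between which [i_S2] interpolates. *)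
Definition right_half x : S2 H := HS (hs_mull x s_hs).
Definition left_half x : S2 H := HS (hs_mulr x s_hs).

(** [rho^(1/4)] is in general not Hilbert-Schmidt, so the ideal property does not apply directly. On
    an eigenvector [|r x r h|^2 = nu <x h, s x h> <= |x s h| |s x h|], and both factors are square
    summable. *)
Lemma i_op_hs x : i_op rho x \in @hs_pred R H.
Proof.
apply/hs_predP; rewrite -(hs2E _ hb).
apply: (@le_lt_trans _ _ (basis_hs h (x * s)%R + basis_hs h (s * x)%R)%E).
  rewrite /basis_hs -esumD => [|i _|i _]; rewrite ?lee_fin ?sqr_ge0//.
  apply: le_esum => i _; rewrite -EFinD lee_fin.
  have -> : i_op rho x (h i) = (mu i)%:C *: r (x (h i)) by rewrite -!bopZ -r_h.
  have -> : (x * s) (h i) = (nu i)%:C *: x (h i) by rewrite -bopZ -s_h.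
  have -> : (s * x) (h i) = s (x (h i)) by [].
  rewrite !hnorm_scale !cabsR !gtr0_norm// exprMn mu_sqr.
  have h1 : hnorm (r (x (h i))) ^+ 2 <= hnorm (x (h i)) * hnorm (s (x (h i))).
    by rewrite hnorm_sqr -r_move; exact: (re_inner_le _ (s _)).
  have := hnorm_ge0 (x (h i)); have := hnorm_ge0 (s (x (h i))).
  move: h1 (nu_gt0 i); set a := hnorm (r _); set b := hnorm (x _).
  set c := hnorm (s _); set n := nu i => h1 n0 c0 b0.
  have h2 : n * a ^+ 2 <= n * (b * c) by rewrite ler_pM2l.
  have := sqr_ge0 (n * b - c); have := sqr_ge0 (n * b); have := sqr_ge0 c.
  by rewrite sqrrB; lra.
rewrite !hs2E//; apply: lte_add_pinfty; apply/hs_predP; [exact: hs_mull|exact: hs_mulr].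
Qed.

Lemma i_S2E x : hs_op (i_S2 rho x) = r * x * r.
Proof. exact: (insubdK _ (i_op_hs x)). Qed.

Lemma i_S2_linear : linear (i_S2 rho).
Proof.
move=> a x y; apply: val_inj => /=; rewrite !i_S2E.
by rewrite mulrDr mulrDl -bop_scalerAr -bop_scalerAl.
Qed.

Lemma right_half_linear : linear right_half.
Proof. by move=> a x y; apply: val_inj => /=; rewrite mulrDl -bop_scalerAl. Qed.

Lemma left_half_linear : linear left_half.
Proof. by move=> a x y; apply: val_inj => /=; rewrite mulrDr -bop_scalerAr. Qed.

(** In each term of the sum over eigenvectors the two scalars [mu] combine to [nu], that is to [s]
    acting before [x], and the two outer [r] combine to [s] acting after [y]. *)
Lemma i_S2_inner x y :
  inner (i_S2 rho x) (i_S2 rho y) = inner (right_half x) (left_half y).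
Proof.
apply: (hs_inner_unique hb).
apply: eq_csum (hs_inner_csum (right_half x) (left_half y) hb) => i.
have E z : (i_S2 rho z) (h i) = (mu i)%:C *: r (z (h i)) by rewrite i_S2E -!bopZ -r_h.
have -> : (right_half x) (h i) = (nu i)%:C *: x (h i) by rewrite -bopZ -s_h.
have -> : (left_half y) (h i) = s (y (h i)) by [].
rewrite !E !innerZl innerZr !conj_real -[in RHS]r_move.
by rewrite mulrA -rmorphM -expr2 mu_sqr.
Qed.

Lemma i_S2_le x : hnorm (i_S2 rho x) ^+ 2 <= hnorm (right_half x) * hnorm (left_half x).
Proof. by rewrite hnorm_sqr i_S2_inner re_inner_le. Qed.

(** The left side is [Tr (s (s x^* x))], and the trace is cyclic for Hilbert-Schmidt factors. *)
Lemma omega_adjM x : omega rho (adj x * x) = (hnorm (right_half x) ^+ 2)%:C.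
Proof.
rewrite /omega -s2 -mulrA trace_mulC//; last by rewrite mulrA; apply: hs_mulr; apply: hs_mulr.
rewrite -inner_hnorm S2_innerE /hs_inner /= adjM adj_s.
by rewrite !mulrA.
Qed.

Lemma left_half_adj x : hnorm (left_half x) = hnorm (right_half (adj x)).
Proof.
apply/eqP; rewrite -(@eqrXn2 _ 2) ?hnorm_ge0//; apply/eqP.
by rewrite !S2_hnormE !hs_norm_sqr /= -(hs2_adj (s * x)) adjM adj_s.
Qed.

(** Matrix units in the eigenbasis of [rho], which form an orthonormal basis of [S2 H]. *)
Definition munit (k : I * I) : bop H := rank1 (h k.1) (h k.2).

Lemma munit_hs k : munit k \in @hs_pred R H.
Proof.
have -> : munit k = ((nu k.2)^-1)%:C *: (munit k * s).
  rewrite /munit rank1_mul adj_s s_h rank1Zr conj_real scalerA -rmorphM mulVf ?scale1r//.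
  by rewrite gt_eqF.
by apply: rpredZ; apply: hs_mull.
Qed.

Definition S2unit k : S2 H := HS (munit_hs k).

Lemma S2unit_inner k (X : S2 H) : inner (S2unit k) X = inner (h k.1) (X (h k.2)).
Proof.
rewrite S2_innerE /hs_inner /= adj_rank1 rank1_mul trace_rank1.
by rewrite -adjP.
Qed.

Lemma S2unit_basis : orthonormal_basis S2unit.
Proof.
split=> [[i j] [i' j']|X X0].
  rewrite S2unit_inner /= innerZr !hb.1 -natrM mulnb [j' == j]eq_sym.
  by rewrite xpair_eqE andbC.
apply: val_inj; apply: (basis_bop_ext hb) => j; apply: (basis_inner_eqP hb) => i.
by have := X0 (i, j); rewrite S2unit_inner /= => ->; rewrite inner0r.
Qed.

(** With the next two lemmas: in matrix units the embeddings are diagonal with weights [nu_j],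
    [nu_i] and their geometric mean [mu_i mu_j]. *)
Lemma right_half_unit k x : inner (S2unit k) (right_half x) =
  (nu k.2)%:C * inner (h k.1) (x (h k.2)).
Proof.
rewrite S2unit_inner -innerZr.
by have -> : (right_half x) (h k.2) = (nu k.2)%:C *: x (h k.2) by rewrite -bopZ -s_h.
Qed.

Lemma left_half_unit k x : inner (S2unit k) (left_half x) =
  (nu k.1)%:C * inner (h k.1) (x (h k.2)).
Proof.
rewrite S2unit_inner; have -> : (left_half x) (h k.2) = s (x (h k.2)) by [].
by rewrite s_move s_h innerZl conj_real.
Qed.

Lemma i_S2_unit k x : inner (S2unit k) (i_S2 rho x) =
  (mu k.1 * mu k.2)%:C * inner (h k.1) (x (h k.2)).
Proof.
rewrite S2unit_inner.
have -> : (i_S2 rho x) (h k.2) = (mu k.2)%:C *: r (x (h k.2)) by rewrite i_S2E -!bopZ -r_h.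
by rewrite innerZr r_move r_h innerZl conj_real rmorphM /=; ring.
Qed.

(** Finite matrices: their images under [i_S2] are dense, and pairing with them involves finitely
    many entries. *)
Definition fmat (c : I * I -> R[i]) (A : {fset I * I}) : bop H :=
  \sum_(k <- A) c k *: munit k.

Lemma fmat_entry c A k : inner (h k.1) (fmat c A (h k.2)) = if k \in A then c k else 0.
Proof.
rewrite /fmat bop_sumE inner_sumr -[RHS]big_fset_delta; apply: eq_bigr => [[i j] _].
rewrite bopZE innerZr /munit rank1E /= innerZr !hb.1 -natrM mulnb.
by case: k => a b /=; rewrite xpair_eqE [a == i]eq_sym andbC.
Qed.

Lemma hsum_entry c A k :
  inner (S2unit k) (hsum S2unit c A) = if k \in A then c k else 0.
Proof. exact: (inner_hsum S2unit_basis.1). Qed.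

Lemma right_half_fmat c A : right_half (fmat c A) = hsum S2unit (fun k => (nu k.2)%:C * c k) A.
Proof.
apply: (basis_inner_eqP S2unit_basis) => k; rewrite right_half_unit hsum_entry fmat_entry.
by case: ifP => // _; rewrite mulr0.
Qed.

Lemma left_half_fmat c A : left_half (fmat c A) = hsum S2unit (fun k => (nu k.1)%:C * c k) A.
Proof.
apply: (basis_inner_eqP S2unit_basis) => k; rewrite left_half_unit hsum_entry fmat_entry.
by case: ifP => // _; rewrite mulr0.
Qed.

Lemma i_S2_fmat c A : i_S2 rho (fmat c A) =
  hsum S2unit (fun k => (mu k.1 * mu k.2)%:C * c k) A.
Proof.
apply: (basis_inner_eqP S2unit_basis) => k; rewrite i_S2_unit hsum_entry fmat_entry.
by case: ifP => // _; rewrite mulr0.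
Qed.

(** All weights are positive, so Fourier coefficients can be divided by them. *)
Lemma i_S2_fmat_dense (X : S2 H) (e : R) : 0 < e -> exists c A,
  hnorm (X - i_S2 rho (fmat c A)) <= e.
Proof.
move=> e0; have [A hA] := hsum_dense S2unit_basis X e0.
exists (fun k => ((mu k.1 * mu k.2)^-1)%:C * inner (S2unit k) X), A.
rewrite i_S2_fmat; set f := fun k => _ * _.
have -> : f = fun k => inner (S2unit k) X.
  apply/funext => k; rewrite /f mulrA -rmorphM mulfV ?mul1r//.
  by rewrite gt_eqF// mulr_gt0.
exact: ltW.
Qed.

Lemma i_S2_dense (X : S2 H) (e : R) : 0 < e -> exists x, hnorm (X - i_S2 rho x) <= e.
Proof. by move=> /(i_S2_fmat_dense X)[c [A ?]]; exists (fmat c A). Qed.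

Lemma entries_i_S2_inner c A x : inner (i_S2 rho (fmat c A)) (i_S2 rho x) =
  \sum_(k <- A) ((mu k.1 * mu k.2) ^+ 2)%:C * (c k)^* * inner (h k.1) (x (h k.2)).
Proof.
rewrite i_S2_fmat /hsum inner_suml; apply: eq_bigr => k _.
rewrite innerZl i_S2_unit; set m := mu _ * _.
have -> : (m%:C * c k)^* = m%:C * (c k)^* by rewrite rmorphM /= conj_real.
by rewrite rmorphXn /=; ring.
Qed.

(** * Schwarz maps in the symmetric embedding *)

Section SchwarzMap.
Variable S : bop H -> bop H.
Hypothesis lS : linear S.
Hypothesis schwarzS : forall x, op_le (adj (S x) * S x) (S (adj x * x)).
Hypothesis omega_linear : scalar (omega rho).
Hypothesis omega_pos : forall x, positive x -> 0 <= omega rho x.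
Hypothesis subinvS : subinvariant (omega rho) S.

Lemma op_le_positive x y : positive x -> op_le x y -> positive y.
Proof.
move=> px xy u; have := addr_ge0 (px u) (xy u).
by rewrite bopBE innerBr addrC subrK.
Qed.

Lemma schwarz_positive x : positive (S (adj x * x)).
Proof. exact: op_le_positive (positive_adjM _) (schwarzS x). Qed.

Let SD x y : S (x + y) = S x + S y.
Proof. by have := lS 1 x y; rewrite !scale1r. Qed.
Let SB x y : S (x - y) = S x - S y.
Proof. by have := lS (-1) y x; rewrite !scaleN1r ![- _ + _]addrC. Qed.
Let SZ a x : S (a *: x) = a *: S x.
Proof.
have S0 : S 0 = 0 by rewrite -(subrr (0 : bop H)) SB !subrr.
by have := lS a x 0; rewrite S0 !addr0.
Qed.

Let n4 : (4 : R[i]) != 0. Proof. by rewrite pnatr_eq0. Qed.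
Let n2 : (2 : R[i]) != 0. Proof. by rewrite pnatr_eq0. Qed.

(** Positivity of [S] is available on products [adj x * x]; a selfadjoint [x] is a combination of
    the squares of [x + 1] and [x - 1]. *)
Let schwarz_selfadj x : adj x = x -> adj (S x) = S x.
Proof.
move=> ax.
have E : x = 4^-1 *: ((x + 1) * (x + 1) - (x - 1) * (x - 1)).
  have -> : (x + 1) * (x + 1) - (x - 1) * (x - 1) = 4 *: x.
    have -> : (x + 1) * (x + 1) = x * x + 1 + (x + x).
      by rewrite mulrDl !mulrDr !mulr1 mul1r [x + 1]addrC addrACA.
    have -> : (x - 1) * (x - 1) = x * x + 1 - (x + x).
      by rewrite mulrBl mul1r mulrBr mulr1 opprB addrACA -opprD.
    by rewrite opprB addrC addrA subrK scaler_nat !mulrS mulr0n addr0 !addrA.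
  by rewrite scalerA mulVf// scale1r.
have p1 : adj (S ((x + 1) * (x + 1))) = S ((x + 1) * (x + 1)).
  apply: positive_selfadj; have := schwarz_positive (x + 1).
  by rewrite adjD ax adj1.
have p2 : adj (S ((x - 1) * (x - 1))) = S ((x - 1) * (x - 1)).
  apply: positive_selfadj; have := schwarz_positive (x - 1).
  by rewrite adjB ax adj1.
have J4 : (4^-1 : R[i])^* = 4^-1 by rewrite fmorphV rmorph_nat.
by rewrite E SZ SB adjZ adjB p1 p2 J4.
Qed.

Lemma schwarz_adj x : S (adj x) = adj (S x).
Proof.
pose a := x + adj x; pose b := 'i *: (x - adj x).
have Ji : ('i : R[i])^* = - 'i by apply/eqP; rewrite eq_complex /= oppr0 !eqxx.
have ii : 'i * 'i = -1 :> R[i] by rewrite -expr2 sqr_i.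
have aa : adj a = a by rewrite /a adjD adjK addrC.
have bb : adj b = b by rewrite /b adjZ adjB adjK Ji scaleNr -scalerN opprB.
have ia : 2 *: x = a - 'i *: b.
  by rewrite /b scalerA ii scaleN1r opprK /a addrACA subrr addr0 scaler_nat mulr2n.
have ib : 2 *: adj x = a + 'i *: b.
  by rewrite /b scalerA ii scaleN1r opprB /a addrC addrA subrK scaler_nat mulr2n.
apply: (scalerI n2); rewrite -SZ ib.
have -> : 2 *: adj (S x) = adj (S (2 *: x)) by rewrite SZ adjZ rmorph_nat.
by rewrite ia SB SD SZ adjB adjZ Ji scaleNr opprK !schwarz_selfadj.
Qed.

Lemma right_half_contract x : hnorm (right_half (S x)) <= hnorm (right_half x).
Proof.
rewrite -ler_sqr ?nnegrE ?hnorm_ge0// -lecR -!omega_adjM.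
apply: le_trans (subinvS (positive_adjM x)).
have := omega_pos (schwarzS x).
have -> : S (adj x * x) - adj (S x) * S x = (-1) *: (adj (S x) * S x) + S (adj x * x).
  by rewrite scaleN1r addrC.
by rewrite omega_linear mulN1r addrC subr_ge0.
Qed.

(** The Schwarz inequality bounds [adj (S x) * S x], hence the right half; the left half has the
    norm of the right half of the adjoint. *)
Lemma left_half_contract x : hnorm (left_half (S x)) <= hnorm (left_half x).
Proof. by rewrite !left_half_adj -schwarz_adj right_half_contract. Qed.

Let right_half_sub x y : right_half (x - y) = right_half x - right_half y.
Proof. by have := right_half_linear (-1) y x; rewrite !scaleN1r ![- _ + _]addrC. Qed.
Let left_half_sub x y : left_half (x - y) = left_half x - left_half y.
Proof. by have := left_half_linear (-1) y x; rewrite !scaleN1r ![- _ + _]addrC. Qed.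
Let i_sub x y : i_S2 rho (x - y) = i_S2 rho x - i_S2 rho y.
Proof. by have := i_S2_linear (-1) y x; rewrite !scaleN1r ![- _ + _]addrC. Qed.

Let hnorm_right_fmat c A : hnorm (right_half (fmat c A)) ^+ 2 =
  \sum_(k <- A) l k.2 * cabs (c k) ^+ 2.
Proof.
rewrite right_half_fmat (hnorm_hsum S2unit_basis.1); apply: eq_bigr => k _.
by rewrite cabsM cabsR exprMn real_normK ?num_real// nu_sqr.
Qed.

Let hnorm_left_fmat c A : hnorm (left_half (fmat c A)) ^+ 2 =
  \sum_(k <- A) l k.1 * cabs (c k) ^+ 2.
Proof.
rewrite left_half_fmat (hnorm_hsum S2unit_basis.1); apply: eq_bigr => k _.
by rewrite cabsM cabsR exprMn real_normK ?num_real// nu_sqr.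
Qed.

(* The form [<i(S x), i(S y)>] is dominated by [|x s|_2 |s y|_2]; the largest
   form with this property is [<i x, i y>], the geometric mean of the two. *)
Lemma i_S2_contract_fmat c A :
  hnorm (i_S2 rho (S (fmat c A))) <= hnorm (i_S2 rho (fmat c A)).
Proof.
pose g x y := inner (i_S2 rho (S x)) (i_S2 rho (S y)).
have lin : linear (fun x => i_S2 rho (S x)) by move=> a x y; rewrite lS i_S2_linear.
have gh : hermitian g.
  split=> [x y z|a x y|x y]; last exact: inner_conj.
    by have := lin 1 y z; rewrite /g !scale1r => ->; rewrite innerDr.
  by rewrite /g SZ -innerZr; congr inner; have := i_S2_linear a (S y) 0;
    rewrite !addr0 => ->; have := i_sub 0 0; rewrite !subrr => ->; rewrite addr0.
apply: ler_hnorm_sqr; first exact: hnorm_ge0.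
rewrite [X in X <= _]hnorm_sqr i_S2_fmat (hnorm_hsum S2unit_basis.1).
apply: (@le_trans _ _ (\sum_(k <- A) nu k.1 * nu k.2 * cabs (c k) ^+ 2)).
  (* For [k = (i, j)] the weights are [l_j] for [|x s|^2] and [l_i] for [|s y|^2]; their mean
     [nu_i nu_j = (mu_i mu_j)^2] is the weight of [|i x|^2]. *)
  apply: (@form_le_geometric_mean _ _ g gh _ (enum_fset A) munit
    (fun k => l k.2) (fun k => l k.1) (fun k => nu k.1 * nu k.2) _ _ _ _ _ c) => [k|k|k|k|u v].
  - exact: l_gt0.
  - exact: l_gt0.
  - exact: mulr_gt0.
  - by rewrite exprMn !nu_sqr mulrC.
  - rewrite -hnorm_right_fmat -hnorm_left_fmat -exprMn.
    rewrite ler_sqr ?nnegrE ?cabs_ge0 ?mulr_ge0 ?hnorm_ge0//.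
    rewrite /g i_S2_inner; apply: le_trans (cauchy_schwarz _ _) _.
    by apply: ler_pM; [exact: hnorm_ge0|exact: hnorm_ge0|
      exact: right_half_contract|exact: left_half_contract].
apply: ler_sum => k _; rewrite cabsM cabsR exprMn real_normK ?num_real//.
by rewrite exprMn !mu_sqr.
Qed.

(** Truncations of [x] have to converge in both halves at once, since on the remainder [y] only
    [|i (S y)|^2 <= |S y s| |s S y|] is available. On the truncation itself Bessel gives
    [|i (fmat c A)| <= |i x|]. *)
Lemma i_S2_contract x : hnorm (i_S2 rho (S x)) <= hnorm (i_S2 rho x).
Proof.
apply/ler_addgt0Pr => e e0.
pose c k := inner (h k.1) (x (h k.2)).
have [A [h1 h2]] : exists A, hnorm (right_half x - right_half (fmat c A)) < e /\
    hnorm (left_half x - left_half (fmat c A)) < e.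
  have cr := hsum_cvg S2unit_basis (right_half x).
  have cl := hsum_cvg S2unit_basis (left_half x).
  have Er : (fun k => inner (S2unit k) (right_half x)) = (fun k => (nu k.2)%:C * c k).
    by apply/funext => k; exact: right_half_unit.
  have El : (fun k => inner (S2unit k) (left_half x)) = (fun k => (nu k.1)%:C * c k).
    by apply/funext => k; exact: left_half_unit.
  rewrite Er in cr; rewrite El in cl.
  have n1 : \forall A \near totally, hnorm (right_half x - right_half (fmat c A)) < e.
    apply: filterS (cvg_hnorm_lt cr e0) => A; rewrite (right_half_fmat c A); exact.
  have n2' : \forall A \near totally, hnorm (left_half x - left_half (fmat c A)) < e.
    apply: filterS (cvg_hnorm_lt cl e0) => A; rewrite (left_half_fmat c A); exact.
  by have [A [h1 h2]] := filter_ex (filterI n1 n2'); exists A.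
have -> : i_S2 rho (S x) = i_S2 rho (S (fmat c A)) + i_S2 rho (S (x - fmat c A)).
  by rewrite SB i_sub addrC subrK.
apply: le_trans (Defs.hnormD _ _) _; apply: lerD.
  apply: le_trans (i_S2_contract_fmat _ _) _.
  apply: ler_hnorm_sqr; first exact: hnorm_ge0.
  rewrite i_S2_fmat (hnorm_hsum S2unit_basis.1).
  apply: le_trans (bessel S2unit_basis.1 _ A).
  by apply: ler_sum => k _; rewrite i_S2_unit.
apply: ler_hnorm_sqr; first exact: ltW.
apply: le_trans (i_S2_le _) _; rewrite [leRHS]expr2.
apply: ler_pM; [exact: hnorm_ge0|exact: hnorm_ge0| |].
  by apply: le_trans (right_half_contract _) _; rewrite right_half_sub; exact: ltW.
by apply: le_trans (left_half_contract _) _; rewrite left_half_sub; exact: ltW.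
Qed.

End SchwarzMap.

(** Any operator bound [M] of [x] bounds both halves by [M] times the Hilbert-Schmidt norm of
    [s]. *)
Lemma i_S2_bounded : exists2 k : R, 0 <= k & forall x M, 0 <= M ->
  (forall u, hnorm (x u) <= M * hnorm u) -> hnorm (i_S2 rho x) <= M * k.
Proof.
exists (hs_norm (HS s_hs)) => [|x M M0 hM]; first exact: hs_norm_ge0.
have k0 := hs_norm_ge0 (HS s_hs).
have half_le (X : S2 H) : (hs2 X <= (M ^+ 2)%:E * hs2 s)%E -> hnorm X <= M * hs_norm (HS s_hs).
  move=> hX; apply: ler_hnorm_sqr; first exact: mulr_ge0.
  have E1 : (hnorm X ^+ 2)%:E = hs2 X := hs_norm_hs2 X.
  by rewrite -lee_fin E1 exprMn EFinM (hs_norm_hs2 (HS s_hs)).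
apply: ler_hnorm_sqr; first exact: mulr_ge0.
apply: le_trans (i_S2_le _) _; rewrite [leRHS]expr2.
apply: ler_pM; [exact: hnorm_ge0|exact: hnorm_ge0| |]; apply: half_le.
  exact: hs2_mull.
exact: hs2_mulr.
Qed.

(** * The induced semigroup and its generator *)

Section InducedSemigroup.
Variable T : R -> bop H -> bop H.
Hypothesis sgT : semigroup opnorm T.
Hypothesis schwarzT : forall t, 0 <= t -> schwarz (T t).
Hypothesis omega_state : state (omega rho).
Hypothesis omega_subinv : forall t, 0 <= t -> subinvariant (omega rho) (T t).

Let lT t : 0 <= t -> linear (T t).
Proof. by move=> t0; have [] := (schwarzT t0).1. Qed.

Let T_contract t x : 0 <= t -> hnorm (i_S2 rho (T t x)) <= hnorm (i_S2 rho x).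
Proof.
have [om_lin om_pos _] := omega_state.
by move=> t0; apply: i_S2_contract => //;
  [exact: lT|exact: (schwarzT t0).2|exact: omega_subinv].
Qed.

Lemma induced_semigroup_exists : exists2 Tt : R -> S2 H -> S2 H,
  contraction_semigroup (@hnorm R (S2 H)) Tt &
  forall x t, 0 <= t -> Tt t (i_S2 rho x) = i_S2 rho (T t x).
Proof.
have /choice[Tt hTt] t : exists f : S2 H -> S2 H, 0 <= t -> [/\ linear f,
    forall xi, hnorm (f xi) <= hnorm xi & forall x, f (i_S2 rho x) = i_S2 rho (T t x)].
  (* Negative times are unconstrained; the identity fills them. *)
  have [t0|] := boolP (0 <= t); last by exists id.
  have [f hf] := dense_extension i_S2_linear (lT t0) i_S2_dense (fun x => T_contract x t0).
  by exists f.
exists Tt => [|x t t0]; last by have [_ _ ->] := hTt t t0.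
split; last by move=> t x t0; have [_ ->] := hTt t t0.
have [_ TD T0] := sgT.
split=> [t t0|s' t s0 t0|].
- have [lf cf _] := hTt t t0; split=> //; exists 1 => xi; rewrite mul1r; exact: cf.
- have [lf cf fi] := hTt _ t0; have [lg cg gi] := hTt _ s0.
  have [lk ck ki] := hTt _ (addr_ge0 t0 s0).
  apply: (dense_linear_eq i_S2_dense lk) => // [a xi eta|xi|x].
  + by rewrite /= lg lf.
  + exact: le_trans (cf _) (cg _).
  + by rewrite /= ki gi fi TD.
- have [lf cf fi] := hTt _ (lexx 0).
  by apply: (dense_linear_eq i_S2_dense lf) => // x; rewrite fi T0.
Qed.

Lemma induced_semigroup_unique (Tt St : R -> S2 H -> S2 H) :
  contraction_semigroup (@hnorm R (S2 H)) Tt ->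
  contraction_semigroup (@hnorm R (S2 H)) St ->
  (forall x t, 0 <= t -> Tt t (i_S2 rho x) = i_S2 rho (T t x)) ->
  (forall x t, 0 <= t -> St t (i_S2 rho x) = i_S2 rho (T t x)) ->
  forall t, 0 <= t -> St t = Tt t.
Proof.
move=> [[bT _ _] cT] [[bS _ _] cS] iT iS t t0.
have [lTt _] := bT t t0; have [lSt _] := bS t t0.
apply: (dense_linear_eq i_S2_dense lSt lTt) => [xi|xi|x]; [exact: cS|exact: cT|].
by rewrite iS// iT.
Qed.

Variable Tt : R -> S2 H -> S2 H.
Hypothesis cTt : contraction_semigroup (@hnorm R (S2 H)) Tt.
Hypothesis Tt_i : forall x t, 0 <= t -> Tt t (i_S2 rho x) = i_S2 rho (T t x).

Let iB x y : i_S2 rho (x - y) = i_S2 rho x - i_S2 rho y.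
Proof. by have := i_S2_linear (-1) y x; rewrite !scaleN1r ![- _ + _]addrC. Qed.
Let i0 : i_S2 rho 0 = 0.
Proof. by rewrite -(subrr (0 : bop H)) iB subrr. Qed.
Let iZ a x : i_S2 rho (a *: x) = a *: i_S2 rho x.
Proof. by have := i_S2_linear a x 0; rewrite i0 !addr0. Qed.

Lemma diff_quot_i x t : 0 <= t ->
  diff_quot Tt (i_S2 rho x) t = i_S2 rho (diff_quot T x t).
Proof. by move=> t0; rewrite /diff_quot Tt_i// -iB -iZ. Qed.

(** The pairing with a finite matrix is a finite combination of matrix elements, so their
    convergence suffices without a bound on [D]. *)
Lemma inner_i_fmat_vanish c A (D : R -> bop H) :
  (forall u v, vanishes0 (fun t => inner v (D t u))) ->
  vanishes0 (fun t => inner (i_S2 rho (fmat c A)) (i_S2 rho (D t))).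
Proof.
move=> hD.
have -> : (fun t => inner (i_S2 rho (fmat c A)) (i_S2 rho (D t))) = (fun t =>
  \sum_(k <- A) ((mu k.1 * mu k.2) ^+ 2)%:C * (c k)^* * inner (h k.1) (D t (h k.2))).
  by apply/funext => t; exact: entries_i_S2_inner.
by apply: vanishes0_sum => k; apply: vanishes0Z.
Qed.

Section WeakStarContinuous.
Hypothesis wT : weak_star_continuous T.

Lemma weak_star_entry x u v : vanishes0 (fun t => inner v ((T t x - x) u)).
Proof.
have /continuous_within_itvcyP[_] := @wT x _ (trace_class_rank1 u v).
move=> /cvg_vanishes0; have [_ _ ->] := sgT.
by under eq_fun do rewrite !trace_rank1_mul -innerBr.
Qed.

(** The test vector in [weak_right_continuous] is the point itself. For images of finite matrices
    the pairing is a finite sum, and these images are dense. *)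
Lemma induced_right_continuous xi : right_continuous_at Tt xi.
Proof.
pose i (p : (I * I -> R[i]) * {fset I * I}) := i_S2 rho (fmat p.1 p.2).
apply: (dense_right_continuous cTt (i := i)) => [{}xi e e0|[c A]].
  by have [c [A hA]] := i_S2_fmat_dense xi e0; exists (c, A).
apply: (weak_right_continuous cTt) => e e0.
have [d d0 hd] := inner_i_fmat_vanish c A (weak_star_entry (fmat c A)) e0.
(* [vanishes0] speaks of [t < d], right continuity of [t <= d]. *)
exists (d / 2) => [|t t0 td]; first by rewrite divr_gt0.
rewrite /i /= Tt_i// -iB.
have [->|tn0] := eqVneq t 0.
  have [_ _ ->] := sgT; rewrite subrr i0 inner0r cabs0; exact: ltW.
by apply: hd; [rewrite lt_def tn0|lra].
Qed.

Lemma weak_star_gen_diff x z u v : weak_star_gen_graph T x z ->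
  vanishes0 (fun t => inner v ((diff_quot T x t - z) u)).
Proof.
move=> /(_ _ (trace_class_rank1 u v)) /cvg_vanishes0.
by under eq_fun do rewrite !trace_rank1_mul -innerBr.
Qed.

(** Matrix elements control pairings with finite matrices; for a general [eta] the difference
    quotients must be bounded. Negating the claim produces a sequence of times, to which uniform
    boundedness applies twice: from matrix elements to vectors, and from vectors to operators. *)
Lemma weak_star_gen_strong x z : weak_star_gen_graph T x z ->
  strong_gen_graph (@hnorm R (S2 H)) Tt (i_S2 rho x) (i_S2 rho z).
Proof.
move=> xz; apply: (weak_gen_strong cTt induced_right_continuous) => eta e e0.
apply: contrapT => no_d.
have /choice[t ht] (k : nat) : exists t, [/\ 0 < t, t < k.+1%:R^-1 &
    e < cabs (inner eta (diff_quot Tt (i_S2 rho x) t - i_S2 rho z))].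
  apply: contrapT => no_t; apply: no_d.
  exists k.+1%:R^-1 => [|t t0 tk]; first by rewrite invr_gt0.
  by rewrite leNgt; apply/negP => et; apply: no_t; exists t.
pose D k := diff_quot T x (t k).
have eventually (f : R -> R[i]) (d : R) : vanishes0 f -> 0 < d ->
    exists N, forall k, (N <= k)%N -> cabs (f (t k)) <= d.
  move=> vf d0; have [d' d'0 hd'] := vf d d0.
  exists (Num.truncn d'^-1) => k Nk; have [t0 tk _] := ht k.
  apply: hd' => //; apply: lt_trans tk _.
  rewrite invf_plt ?posrE//; apply: lt_le_trans (truncnS_gt _) _.
  by rewrite ler_nat ltnS.
have entry_bounded u v : exists C : R, forall k, cabs (inner v (D k u)) <= C.
  have [N hN] := eventually _ _ (weak_star_gen_diff u v xz) ltr01.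
  (* The finitely many early terms are summed; from [N] on the matrix element is within [1] of its
     limit. *)
  exists (\sum_(j < N) cabs (inner v (D j u)) + (1 + cabs (inner v (z u)))) => k.
  have S0 : 0 <= \sum_(j < N) cabs (inner v (D j u)) by apply: sumr_ge0 => j _; exact: cabs_ge0.
  have [Nk|kN] := leqP N k.
    have -> : inner v (D k u) = inner v ((D k - z) u) + inner v (z u).
      by rewrite -innerDr -bopDE subrK.
    apply: le_trans (cabsD _ _) _; have := hN k Nk; lra.
  rewrite (bigD1 (Ordinal kN)) //= -addrA lerDl addr_ge0//.
    by apply: sumr_ge0 => j _; exact: cabs_ge0.
  by rewrite addr_ge0 ?cabs_ge0.
have vec_bounded u : exists C : R, forall k, hnorm (D k u) <= C.
  have [k v w|k a v|k|v|M M0 hM] := @uniform_boundedness R H (fun k v => cabs (inner v (D k u))).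
  - by rewrite innerDl cabsD.
  - by rewrite innerZl cabsM cabsJ.
  - by exists (hnorm (D k u)) => v; rewrite mulrC cauchy_schwarz.
  - exact: entry_bounded.
  (* The bound on the functional at [v = D k u] bounds the vector itself. *)
  exists M => k; have := hM k (D k u); rewrite inner_hnorm cabsR ger0_norm ?sqr_ge0//.
  have [->//|Dn0] := eqVneq (hnorm (D k u)) 0.
  by rewrite expr2 ler_pM2r// lt_def Dn0 hnorm_ge0.
have [k v w|k a v|k||M M0 hM] := @uniform_boundedness R H (fun k u => hnorm (D k u)).
- by rewrite bopD Defs.hnormD.
- by rewrite bopZ hnorm_scale.
- by have [M _ hM] := bop_bounded (D k); exists M.
- exact: vec_bounded.
have [sg sg0 hsg] := i_S2_bounded.
pose B := M * sg + hnorm (i_S2 rho z).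
have iD_le k : hnorm (i_S2 rho (D k) - i_S2 rho z) <= B.
  by apply: le_trans (hnormB _ _) _; rewrite lerD2r; exact: hsg.
have B0 : 0 <= B by rewrite addr_ge0 ?mulr_ge0//; exact: hnorm_ge0.
have B1 : 0 < 2 * (B + 1) by rewrite mulr_gt0//; lra.
(* The approximation error times [B] is at most [e / 2] and the finite matrix contributes at most
   [e / 3], which contradicts a value above [e]. *)
have [c [A hA]] := i_S2_fmat_dense eta (divr_gt0 e0 B1).
have e3 : 0 < e / 3 by rewrite divr_gt0.
have [N hN] := eventually _ _
  (inner_i_fmat_vanish c A (fun u v => weak_star_gen_diff u v xz)) e3.
have [t0 _] := ht N; rewrite diff_quot_i ?(ltW t0)// -/(D N).
have := hN N (leqnn N); rewrite -/(D N) iB => h1.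
have -> : inner eta (i_S2 rho (D N) - i_S2 rho z) =
    inner (eta - i_S2 rho (fmat c A)) (i_S2 rho (D N) - i_S2 rho z) +
    inner (i_S2 rho (fmat c A)) (i_S2 rho (D N) - i_S2 rho z).
  by rewrite -innerDl subrK.
have h2 := cauchy_schwarz (eta - i_S2 rho (fmat c A)) (i_S2 rho (D N) - i_S2 rho z).
have h3 : hnorm (eta - i_S2 rho (fmat c A)) * hnorm (i_S2 rho (D N) - i_S2 rho z) <=
    e / (2 * (B + 1)) * B by apply: ler_pM => //; exact: hnorm_ge0.
have {}h3 := le_trans h2 (le_trans h3 (ler_frac_mul (ltW e0) B0)).
move=> h4; have := lt_le_trans h4 (le_trans (cabsD _ _) (lerD h3 h1)).
by rewrite ltNge => /negP; apply; exact: ler_half_third.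
Qed.

End WeakStarContinuous.

(** Stated for arbitrary eigenvectors of [r]: the basis in the theorem may differ from the one fixed
    here when eigenvalues are degenerate. Entries are recovered from [i_S2] on dividing by the
    eigenvalues. *)
Lemma strong_gen_entry (g g' : H) (m m' : R) x Y : 0 < m -> 0 < m' ->
  r g = m%:C *: g -> r g' = m'%:C *: g' ->
  strong_gen_graph (@hnorm R (S2 H)) Tt (i_S2 rho x) Y ->
  (inner g (diff_quot T x t g') : R[i]^o) @[t --> 0^'+] -->
    ((m^-1)%:C * (m'^-1)%:C * inner g (Y g') : R[i]^o).
Proof.
move=> m0 m'0 rg rg' /strong_gen_graphP hY.
have E y : inner g (y g') = (m^-1)%:C * (m'^-1)%:C * inner g (i_S2 rho y g').
  have -> : (i_S2 rho y) g' = m'%:C *: r (y g') by rewrite i_S2E -!bopZ -rg'.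
  rewrite innerZr r_move rg innerZl conj_real.
  have -> : (m^-1)%:C * (m'^-1)%:C * (m'%:C * (m%:C * inner g (y g'))) =
    ((m^-1)%:C * m%:C) * ((m'^-1)%:C * m'%:C) * inner g (y g') by ring.
  by rewrite -!rmorphM !mulVf ?gt_eqF// !mul1r.
apply: vanishes0_cvg.
have -> : (fun t => inner g (diff_quot T x t g') - (m^-1)%:C * (m'^-1)%:C * inner g (Y g')) =
  (fun t => (m^-1)%:C * (m'^-1)%:C * inner g ((i_S2 rho (diff_quot T x t) - Y) g')).
  apply/funext => t; rewrite E -mulrBr -innerBr.
  by congr (_ * inner _ _).
apply: vanishes0Z => e e0.
have n0 : 0 < hnorm g * hnorm g' + 1 by rewrite ltr_wpDl// mulr_ge0 ?hnorm_ge0.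
have [d d0 hd] := hY _ (divr_gt0 e0 n0).
exists d => // t t0 td; have := hd t t0 td; rewrite diff_quot_i ?(ltW t0)//.
rewrite ler_pdivlMr// => h1; apply: le_trans (cauchy_schwarz _ _) _.
apply: le_trans (ler_wpM2l (hnorm_ge0 _) (hs_norm_apply _ _)) _.
apply: le_trans h1; rewrite mulrCA.
by apply: ler_wpM2l; [exact: hs_norm_ge0|rewrite lerDl].
Qed.

End InducedSemigroup.

End SymmetricEmbedding.

(** * Moore-Penrose inverse of an injective positive operator *)

Section MoorePenrose.
Context {R : realType} {H : hilbertType R} (x : bop H).
Hypotheses (x_pos : positive x) (x_inj : forall u, x u = 0 -> u = 0).

(** The orthogonal complement of the range of a selfadjoint operator is its null space, here zero;
    hence [mp_dom] is the range. *)
Let orth_range v : orth (range x) v -> v = 0.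
Proof.
move=> xv; apply: x_inj; apply: inner_eqP => w.
rewrite inner0r adjP (positive_selfadj x_pos).
by apply: xv; exists w.
Qed.

Let x_injective u v : x u = x v -> u = v.
Proof.
move=> xuv; apply/eqP; rewrite -subr_eq0; apply/eqP/x_inj.
by rewrite bopB xuv subrr.
Qed.

Let mp_dom_range v : mp_dom x v -> range x v.
Proof. by move=> [a [b [xa /orth_range -> ->]]]; rewrite addr0. Qed.

Let range_mp_dom v : range x v -> mp_dom x v.
Proof.
move=> xv; exists v, 0; split=> //; last by rewrite addr0.
by move=> w _; rewrite inner0r.
Qed.

(** The inverse of [x] on its range, extended by [0], meets the defining conditions, which excludes
    the default in [mp_inverse]. *)
Lemma mp_inverse_spec : is_mp_inverse x (mp_inverse x).
Proof.
pose g v := xget 0 [set u | x u = v].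
have gx u : g (x u) = u by rewrite /g; apply: xget_unique => // w xw; exact: x_injective.
suff gP : is_mp_inverse x g by rewrite /mp_inverse; case: xgetP => [k _ //|/(_ g)].
split=> [a u v /mp_dom_range[u' _ <-] /mp_dom_range[v' _ <-]|u _|v|v nv].
- by rewrite -bopZ -bopD !gx.
- exact: gx.
- move=> /mp_dom_range[u _ <-]; rewrite gx; split=> [->|/orth_range/x_inj//].
  by rewrite bop0 => w _; rewrite inner0r.
- rewrite /g; case: xgetP => [u _ xu|//]; case: nv.
  by apply: range_mp_dom; exists u.
Qed.

Lemma mp_inverse_eigen (m : R) v : 0 < m -> x v = m%:C *: v ->
  mp_dom x v /\ mp_inverse x v = (m^-1)%:C *: v.
Proof.
move=> m0 xv; have vE : x ((m^-1)%:C *: v) = v.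
  by rewrite bopZ xv scalerA -rmorphM mulVf ?scale1r// gt_eqF.
split; first by apply: range_mp_dom; exists ((m^-1)%:C *: v).
have [_ gx _ _] := mp_inverse_spec; rewrite -[in LHS]vE gx// => w xw.
by rewrite (x_inj xw) inner0l.
Qed.

End MoorePenrose.

(** * Densities of faithful states *)

Section FaithfulState.
Context {R : realType} {H : hilbertType R} (rho : bop H).
Hypotheses (omega_state : state (omega rho)) (omega_faithful : faithful (omega rho)).

Let omega_rank1 u : omega rho (rank1 u u) = inner u (rho u).
Proof. by rewrite /omega mul_rank1 trace_rank1. Qed.

Lemma density_positive : positive rho.
Proof.
by move=> u; rewrite -omega_rank1; have [_ om_pos _] := omega_state; apply/om_pos/positive_rank1.
Qed.

Lemma density_injective u : rho u = 0 -> u = 0.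
Proof.
move=> ru; apply: contrapT => /eqP un0.
have r0 : rank1 u u != 0.
  apply/eqP => r0; have : rank1 u u u = 0 by rewrite r0.
  rewrite rank1E inner_hnorm => /eqP; rewrite scaler_eq0 (negPf un0) orbF.
  by rewrite (inj_eq (@complexI R) _ 0) sqrf_eq0 hnorm_eq0 (negPf un0).
by have := omega_faithful (positive_rank1 u) r0; rewrite omega_rank1 ru inner0r ltxx.
Qed.

(** [omega rho 1 = 1] is nonzero, so the series for the trace of [rho] converges; its terms are
    nonnegative. *)
Lemma density_trace :
  (\esum_(e in [set: onb H]) (re (inner (\val e) (rho (\val e))))%:E < +oo)%E.
Proof.
have [_ _ om1] := omega_state.
have := trace_cvg om1 (oner_neq0 _); rewrite mulr1 => c.
apply: (csum_esum (l := 1)); first by move=> e; apply/ge0_re_ge0/density_positive.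
by apply: eq_csum c => e; rewrite ge0_re//; exact: density_positive.
Qed.

End FaithfulState.

Theorem theorem2 (R : realType) (H : hilbertType R)
  (T : R -> bop H -> bop H) (rho : bop H)
  (semigroupT : semigroup opnorm T)
  (schwarzT : forall t, 0 <= t -> schwarz (T t))
  (rho_tc : trace_class rho)
  (omega_state : state (omega rho))
  (omega_faithful : faithful (omega rho))
  (omega_subinv : forall t, 0 <= t -> subinvariant (omega rho) (T t)) :
  (forall x, i_op rho x \in hs_pred) /\
  exists Tt : R -> S2 H -> S2 H,
    [/\ contraction_semigroup hs_norm Tt,
        forall x t, 0 <= t -> Tt t (i_S2 rho x) = i_S2 rho (T t x),
        forall St : R -> S2 H -> S2 H,
          contraction_semigroup hs_norm St ->
          (forall x t, 0 <= t -> St t (i_S2 rho x) = i_S2 rho (T t x)) ->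
          forall t, 0 <= t -> St t = Tt t
      & weak_star_continuous T ->
        [/\ strongly_continuous hs_norm Tt,
            forall x, weak_star_gen_dom T x ->
              strong_gen_dom hs_norm Tt (i_S2 rho x) /\
              strong_gen hs_norm Tt (i_S2 rho x) = i_S2 rho (weak_star_gen T x)
          & forall (I : countType) (h : I -> H),
              orthonormal_basis h ->
              (forall n, exists a : R[i], rho (h n) = a *: h n) ->
              (forall n, mp_dom (pos_root 4 rho) (h n)) /\
              forall x, strong_gen_dom hs_norm Tt (i_S2 rho x) ->
                ext_gen_dom h T x /\
                ext_gen h T x = i_inv_mx rho h (strong_gen hs_norm Tt (i_S2 rho x))]].
Proof.
have rpos := density_positive omega_state.
have rinj := density_injective omega_faithful.
have rtr := density_trace omega_state.
have [B [l [hb l0 rl]]] := eigenbasis_exists rpos rinj rtr.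
split; first exact: (i_op_hs hb l0 rl rtr).
have [Tt cTt Tti] := induced_semigroup_exists hb l0 rl rtr semigroupT schwarzT
  omega_state omega_subinv.
exists Tt; split=> //.
  move=> St cSt Sti.
  exact: (induced_semigroup_unique hb l0 rl rtr cTt cSt Tti Sti).
move=> wT.
have rcT := induced_right_continuous hb l0 rl rtr semigroupT cTt Tti wT.
split; first exact: (right_continuous_strongly cTt rcT).
  move=> x xdom.
  have xgen : weak_star_gen_graph T x (weak_star_gen T x).
    (* The generator is a chosen value; membership in its domain excludes the default. *)
    by rewrite /weak_star_gen; case: xgetP => [z _ //|no]; case: xdom => z /no.
  have g := weak_star_gen_strong hb l0 rl rtr semigroupT cTt Tti wT xgen.
  split; first by exists (i_S2 rho (weak_star_gen T x)).
  exact: strong_genE g.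
move=> I h hh heig.
have [r_pos r4] := root4_spec hb l0 rl.
have r_inj u : pos_root 4 rho u = 0 -> u = 0.
  by move=> ru; apply: rinj; rewrite -r4 bop_expr4E ru !bop0.
have /choice[m hm] n : exists m : R, 0 < m /\ pos_root 4 rho (h n) = m%:C *: h n.
  have [a ha] := heig n.
  have h1 : inner (h n) (h n) = 1 by rewrite hh.1 eqxx.
  have hn0 : h n != 0.
    by apply/eqP => h0; have := oner_neq0 R[i]; rewrite -h1 h0 inner0l eqxx.
  (* The given eigenvalue is complex; positivity of [rho] makes it real, injectivity makes it
     nonzero. *)
  have a0 : 0 <= a by have := rpos (h n); rewrite ha innerZr h1 mulr1.
  have aR := ge0_re a0.
  have ra0 : 0 < re a.
    rewrite lt_def ge0_re_ge0// andbT; apply/eqP => ra.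
    by move/eqP: hn0; apply; apply: rinj; rewrite ha -aR ra scale0r.
  exists (Num.sqrt (Num.sqrt (re a))); split; first by rewrite !sqrtr_gt0.
  by apply: positive_root4_eigen => //; [exact: ltW|rewrite r4 ha aR].
have mp n := mp_inverse_eigen r_pos r_inj (hm n).1 (hm n).2.
split=> [n|x [Y xY]]; first exact: (mp n).1.
have entry n k := strong_gen_entry hb l0 rl rtr Tti
  (hm n).1 (hm k).1 (hm n).2 (hm k).2 xY.
have YE : strong_gen hs_norm Tt (i_S2 rho x) = Y by exact: strong_genE xY.
split=> [n k|]; first by apply/cvg_ex; eexists; exact: entry.
apply/funext => n; apply/funext => k; rewrite /ext_gen YE.
rewrite (cvg_lim _ (entry n k))//.
rewrite /i_inv_mx (mp n).2 (mp k).2 bopZ innerZr innerZl conj_real; ring.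
Qed.
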